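(* For the quantum group $\mathfrak{D}$ at $\mathbb{S}_3$ attached to the 12-dimensional Fomin–Kirillov algebra, every proper $\mathfrak{D}$-submodule of the Verma module $\mathsf{M}(\sigma,-)$ is a sum of $\mathfrak{D}$-submodules from the list $$\mathsf{S}(\sigma,-),\quad \mathsf{OPU},\quad\mathsf{VQN},\quad\mathsf{T}_{\lambda,\mu}\ \ (\lambda,\mu\in\Bbbk).$$ In particular, $\mathsf{X}(\sigma,-)=\mathsf{OPU}+\mathsf{VQN}+\mathsf{T}_{1,0}+\mathsf{T}_{0,1}$ and $$\mathsf{L}(\sigma,-)\simeq M(\sigma,-)\oplus M(\tau,1)\oplus M(\tau,2)\oplus M(\sigma,-)$$ as $\mathfrak{D}(\mathbb{S}_3)$-modules. Moreover, the composition factors of $\mathsf{M}(\sigma,-)$, counted with multiplicity, are $\mathsf{L}(\sigma,-),\mathsf{L}(\tau,0),\mathsf{L}(e,\rho),\mathsf{L}(e,+),\mathsf{L}(e,+),\mathsf{L}(\sigma,-)$.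
   Context: $\Bbbk$ is an algebraically closed field of characteristic zero, $\zeta\in\Bbbk$ a fixed primitive cube root of $1$; $\sigma=(12)$, $\tau=(123)$ in $\mathbb{S}_3$, permutations composed right to left, so $\sigma\tau=(23)$, $\sigma\tau^2=(13)$. $V=\Bbbk\{x_{(12)},x_{(23)},x_{(13)}\}$ is the Yetter–Drinfeld module over $\Bbbk\mathbb{S}_3$ with $g\cdot x_{(ij)}=\mathrm{sgn}(g)x_{g(ij)g^{-1}}$ and coaction $x_{(ij)}\mapsto(ij)\otimes x_{(ij)}$. Its Nichols algebra $\mathfrak{B}(V)$ is the 12-dimensional Fomin–Kirillov algebra (top degree 4). $\mathfrak{D}$ is the Drinfeld double of the bosonization $\mathfrak{B}(V)\#\Bbbk\mathbb{S}_3$. Explicitly, $\mathfrak{D}$ is the algebra generated by $x_{(ij)}$, $y_{(ij)}$ (transpositions $(ij)$) and $g,\delta_g$ ($g\in\mathbb{S}_3$), where the $g$ multiply as in $\mathbb{S}_3$, the $\delta_g$ are orthogonal idempotents with sum $1$, and, for distinct $i,j,k$ and $g,h\in\mathbb{S}_3$: $x_{(ij)}^2=0$, $x_{(ij)}x_{(ik)}+x_{(jk)}x_{(ij)}+x_{(ik)}x_{(jk)}=0$; the same relations for the $y$'s; $\delta_hg=g\delta_{g^{-1}hg}$; $gx_{(ij)}=\mathrm{sgn}(g)x_{g(ij)g^{-1}}g$; $\delta_hx_{(ij)}=x_{(ij)}\delta_{(ij)h}$; $\delta_gy_{(ij)}=y_{(ij)}\delta_{(ij)g}$; $y_{(ij)}g=\mathrm{sgn}(g)\,g\,y_{g^{-1}(ij)g}$;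 $y_{(ij)}x_{(ij)}+x_{(ij)}y_{(ij)}=1+(ij)(\delta_{(ij)}-\delta_e)$; $y_{(ik)}x_{(ij)}+x_{(ij)}y_{(jk)}=(ij)(\delta_{(ik)}-\delta_{(ik)(ij)})$. The $g,\delta_g$ generate the Drinfeld double $\mathfrak{D}(\mathbb{S}_3)$ of $\Bbbk\mathbb{S}_3$; $\overline V=\Bbbk\{y_{(ij)}\}$ generates $\mathfrak{B}(\overline V)$; multiplication $\mathfrak{B}(V)\otimes\mathfrak{D}(\mathbb{S}_3)\otimes\mathfrak{B}(\overline V)\to\mathfrak{D}$ is a linear isomorphism. Simple $\mathfrak{D}(\mathbb{S}_3)$-modules (''degree $h$'' means $\delta_h$ acts as identity and other $\delta$'s by $0$): $M(e,\pm)=\Bbbk|e\rangle$ in degree $e$ with $g$ acting by $1$, resp. $\mathrm{sgn}(g)$; $M(e,\rho)$, the 2-dimensional irreducible $\mathbb{S}_3$-module in degree $e$; $M(\sigma,\pm)$ with basis $|12\rangle,|23\rangle,|13\rangle$, $|ij\rangle$ of degree $(ij)$, $g|ij\rangle=|g(ij)g^{-1}\rangle$ for $+$ and $g|ij\rangle=\mathrm{sgn}(g)|g(ij)g^{-1}\rangle$ for $-$; $M(\tau,\ell)$, $\ell=0,1,2$, with basis $|\tau\rangle,|\tau^{-1}\rangle$, $|\tau^{\pm1}\rangle$ of degree $\tau^{\pm1}$, $\tau^t|\tau^{\pm1}\rangle=\zeta^{\pm t\ell}|\tau^{\pm1}\rangle$, $\sigma\tau^t|\tau^{\pm1}\rangle=\zeta^{\pm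 t\ell}|\tau^{\mp1}\rangle$. Let $\mathfrak{D}^{\ge0}$ be the subalgebra generated by $\mathfrak{D}(\mathbb{S}_3)$ and $\overline V$; a simple $\mathfrak{D}(\mathbb{S}_3)$-module $M(g,\varrho)$ is a $\mathfrak{D}^{\ge0}$-module with $\overline V$ acting by $0$. The Verma module is $\mathsf{M}(g,\varrho)=\mathfrak{D}\otimes_{\mathfrak{D}^{\ge0}}M(g,\varrho)=\mathfrak{B}(V)\otimes M(g,\varrho)$; write $x|h\rangle$ for $x\otimes|h\rangle$. $\mathsf{X}(g,\varrho)$ is its unique maximal $\mathfrak{D}$-submodule, $\mathsf{L}(g,\varrho)$ its head and $\mathsf{S}(g,\varrho)$ its socle. In $\mathsf{M}(\sigma,-)$: let $\mathsf{V},\mathsf{Q},\mathsf{N}_0,\mathsf{U},\mathsf{P},\mathsf{O}_0$ be the $\mathfrak{D}(\mathbb{S}_3)$-submodules generated respectively by $\mathsf v=\zeta^{-1}x_{(23)}|23\rangle+\zeta x_{(13)}|13\rangle+x_{(12)}|12\rangle$; $\mathsf q=x_{(12)}x_{(23)}|23\rangle-x_{(12)}x_{(13)}|13\rangle$; $\mathsf n_0=x_{(13)}x_{(12)}x_{(23)}|23\rangle+x_{(12)}x_{(13)}x_{(23)}|12\rangle-x_{(12)}x_{(13)}x_{(12)}|13\rangle$; $\mathsf u=-\zeta^{-1}x_{(12)}x_{(13)}x_{(12)}|23\rangle+\zeta x_{(12)}x_{(13)}x_{(23)}|13\rangle+x_{(13)}x_{(12)}x_{(23)}|12\rangle$; $\mathsf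 p=-(2x_{(13)}x_{(12)}+x_{(12)}x_{(23)})|23\rangle-(2x_{(13)}x_{(23)}+x_{(12)}x_{(13)})|13\rangle$; $\mathsf o_0=x_{(13)}|12\rangle+x_{(12)}|23\rangle+x_{(23)}|13\rangle$. For $\lambda,\mu\in\Bbbk$ let $\mathsf t_{\lambda,\mu}=\Bbbk(\lambda|e\rangle^1+\mu|e\rangle^3)$ with $|e\rangle^1=x_{(12)}|12\rangle+x_{(23)}|23\rangle+x_{(13)}|13\rangle$ and $|e\rangle^3=x_{(13)}x_{(12)}x_{(23)}|12\rangle-x_{(12)}x_{(13)}x_{(12)}|23\rangle+x_{(12)}x_{(13)}x_{(23)}|13\rangle$. Set $\mathsf{VQN}=\mathsf{S}(\sigma,-)\oplus\mathsf V\oplus\mathsf Q\oplus\mathsf N_0$, $\mathsf{OPU}=\mathsf{S}(\sigma,-)\oplus\mathsf U\oplus\mathsf P\oplus\mathsf O_0$, $\mathsf{T}_{\lambda,\mu}=\mathsf t_{\lambda,\mu}\oplus\mathsf{S}(\sigma,-)$; these are $\mathfrak{D}$-submodules of $\mathsf{M}(\sigma,-)$. *)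

(* Defs.v *)
From HB Require Import structures.
From mathcomp Require Import all_boot all_order all_algebra all_fingroup.
From mathcomp Require Import generic_quotient ring_quotient boolp classical_sets functions.

Set Implicit Arguments.
Unset Strict Implicit.
Unset Printing Implicit Defensive.

Import GRing.Theory.
Local Open Scope ring_scope.
Local Open Scope classical_set_scope.
Local Open Scope quotient_scope.

(* A [rep k A] is a k-vector space with a linear operator for each element of
   A, that is, a module over the free algebra k<A>.  A module over an algebra
   presented by generators A and relations is a [rep k A] satisfying the
   relations; submodules, quotients, etc. are those of the k<A>-module. *)
Record rep (k : fieldType) (A : Type) := Rep {
  car :> lmodType k;
  act : A -> car -> car;
  act_linear : forall s, linear (act s) }.

HB.instance Definition _ (k : fieldType) (A : Type) (M : rep k A) (s : A) :=
  GRing.isLinear.Build k M M *:%R (@act k A M s) (@act_linear k A M s).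

Lemma actZ (k : fieldType) (A : Type) (M : rep k A) s c (v : M) :
  act s (c *: v) = c *: act s v.
Proof. exact: linearZ. Qed.

Lemma act0 (k : fieldType) (A : Type) (M : rep k A) s :
  act s (0 : M) = 0.
Proof. exact: linear0. Qed.

Definition is_hom (k : fieldType) (A : Type) (M N : rep k A) (f : M -> N) :=
  linear f /\ forall s v, f (act s v) = act s (f v).

Definition rep_iso (k : fieldType) (A : Type) (M N : rep k A) :=
  exists f : M -> N, is_hom f /\ bijective f.

Definition restrict (k : fieldType) (A B : Type) (h : A -> B) (M : rep k B) :
    rep k A :=
  Rep (fun s => @act_linear k B M (h s)).

Section DirectSum.
Variables (k : fieldType) (A : Type) (M N : rep k A).

Definition dsum_act (s : A) (v : M * N) : M * N := (act s v.1, act s v.2).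

Lemma dsum_act_linear s : linear (dsum_act s).
Proof. by move=> c u v; rewrite /dsum_act /= !linearP. Qed.

Definition dsum : rep k A := @Rep k A (M * N)%type dsum_act dsum_act_linear.

End DirectSum.

Section Submodules.
Variables (k : fieldType) (A : Type) (M : rep k A).

Definition is_submod (U : set M) : Prop :=
  [/\ U 0, forall c u v, U u -> U v -> U (c *: u + v)
    & forall s v, U v -> U (act s v)].

Record submod := Submod { sset :> set M; ssetP : is_submod sset }.

Definition gen_sub (E : set M) : set M :=
  [set v | forall U, is_submod U -> E `<=` U -> U v].

Lemma gen_subP E : is_submod (gen_sub E).
Proof.
split=> [U [] //|c u v Hu Hv U HU EU|s v Hv U HU EU].
  by have [_ UD _] := HU; apply: UD; [exact: Hu|exact: Hv].
by have [_ _ Ua] := HU; apply: Ua; exact: Hv.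
Qed.

Definition add_set (U W : set M) : set M :=
  [set v | exists u w, [/\ U u, W w & v = u + w]].

Definition sum_of (F : set (set M)) : set M :=
  [set v | exists s : seq M,
     (forall u, u \in s -> exists2 U, F U & U u) /\ v = \sum_(u <- s) u].

Definition maximal_submod (U : set M) : Prop :=
  [/\ is_submod U, U <> setT
    & forall W, is_submod W -> W <> setT -> U `<=` W -> W = U].

Definition rad : set M := [set v | forall U, maximal_submod U -> U v].

Lemma rad_submod : is_submod rad.
Proof.
split=> [U [[] //]|c u v Hu Hv U HU|s v Hv U HU].
  by have [[_ UD _] _ _] := HU; apply: UD; [exact: Hu|exact: Hv].
by have [[_ _ Ua] _ _] := HU; apply: Ua; exact: Hv.
Qed.

Definition simple : Prop :=
  (exists v : M, v <> 0) /\
  forall U : set M, is_submod U -> U = [set 0] \/ U = setT.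

Variable U : submod.

Definition smem : {pred M} := fun v => `[< sset U v >].

Lemma smem_closed : submod_closed smem.
Proof.
have [U0 UD _] := ssetP U; split=> [|c u v /asboolP Uu /asboolP Uv].
  exact/asboolP.
by apply/asboolP; exact: UD.
Qed.

HB.instance Definition _ := GRing.isSubmodClosed.Build k M smem smem_closed.

Definition subcar := {v : M | v \in smem}.
HB.instance Definition _ := SubChoice.on subcar.
HB.instance Definition _ := [SubChoice_isSubZmodule of subcar by <:].
HB.instance Definition _ := [SubZmodule_isSubLmodule of subcar by <:].

Lemma subact_proof s (v : subcar) : act s (val v) \in smem.
Proof.
have [_ _ Ua] := ssetP U; apply/asboolP/Ua/asboolP; exact: (valP v).
Qed.

Definition subact (s : A) (v : subcar) : subcar :=
  exist _ (act s (val v)) (subact_proof s v).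

Lemma subact_linear s : linear (subact s).
Proof. by move=> c u v; apply: val_inj; rewrite /= linearP. Qed.

Definition subrep : rep k A := Rep subact_linear.

Definition quocar := Quotient.quot (smem : zmodClosed M).
HB.instance Definition _ := GRing.Zmodule.on quocar.

Definition qpi (v : M) : quocar := \pi_(Quotient.quot (smem : zmodClosed M)) v.

Lemma qpi_eq u v : (qpi u = qpi v) <-> sset U (u - v).
Proof.
split=> [/eqP|Uuv].
  by rewrite /qpi -Quotient.idealrBE => /asboolP.
by apply/eqP; rewrite /qpi -Quotient.idealrBE; exact/asboolP.
Qed.

Lemma qpi_surj (q : quocar) : exists v, q = qpi v.
Proof. by exists (repr q); rewrite /qpi reprK. Qed.

Lemma qpiD u v : qpi (u + v) = qpi u + qpi v.
Proof. by rewrite /qpi [LHS]raddfD. Qed.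

Definition qscale (c : k) (q : quocar) : quocar := qpi (c *: repr q).

Lemma qpi_repr v : sset U (repr (qpi v) - v).
Proof. by apply/qpi_eq; rewrite /qpi reprK. Qed.

Lemma qpiZ c v : qpi (c *: v) = qscale c (qpi v).
Proof.
apply/esym/qpi_eq; rewrite -scalerBr -[_ *: _]addr0.
by have [U0 UD _] := ssetP U; apply: UD => //; exact: qpi_repr.
Qed.

Fact qscaleA a b q : qscale a (qscale b q) = qscale (a * b) q.
Proof. by have [v ->] := qpi_surj q; rewrite -!qpiZ scalerA. Qed.
Fact qscale1 : left_id 1 qscale.
Proof. by move=> q; have [v ->] := qpi_surj q; rewrite -!qpiZ scale1r. Qed.
Fact qscaleDr : right_distributive qscale +%R.
Proof.
move=> c p q; have [u ->] := qpi_surj p; have [v ->] := qpi_surj q.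
by rewrite -qpiD -!qpiZ scalerDr qpiD.
Qed.
Fact qscaleDl q : {morph qscale^~ q : a b / a + b}.
Proof.
by move=> a b; have [v ->] := qpi_surj q; rewrite -!qpiZ scalerDl qpiD.
Qed.

HB.instance Definition _ := GRing.Zmodule_isLmodule.Build k quocar
  qscaleA qscale1 qscaleDr qscaleDl.

Lemma qpi_linear : linear qpi.
Proof. by move=> c u v; rewrite qpiD qpiZ. Qed.

Definition quoact (s : A) (q : quocar) : quocar := qpi (act s (repr q)).

Lemma qpi_act s v : qpi (act s v) = quoact s (qpi v).
Proof.
apply/esym/qpi_eq; rewrite -linearB /=.
by have [_ _ Ua] := ssetP U; apply: Ua; exact: qpi_repr.
Qed.

Lemma quoact_linear s : linear (quoact s).
Proof.
move=> c p q; have [u ->] := qpi_surj p; have [v ->] := qpi_surj q.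
by rewrite -qpi_linear -!qpi_act linearP qpi_linear.
Qed.

Definition quorep : rep k A := Rep quoact_linear.

End Submodules.

Section Structure.
Variables (k : fieldType) (A : Type).

Definition socle (M : rep k A) : set M :=
  sum_of [set sset U | U in [set U : submod M | simple (subrep U)]].

(* Agrees with M / X when M has a unique maximal submodule X. *)
Definition head (M : rep k A) : rep k A := quorep (Submod (@rad_submod k A M)).

Lemma meet_submod (M : rep k A) (U W : submod M) :
  @is_submod k A (subrep W) [set w | sset U (val w)].
Proof.
have [U0 UD Ua] := ssetP U.
by split=> [|c u v|s v]; [exact: U0|exact: UD|exact: Ua].
Qed.

(* W / (U `&` W), that is, W / U when U is contained in W. *)
Definition subquo (M : rep k A) (U W : submod M) : rep k A :=
  quorep (Submod (meet_submod U W)).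

Definition has_composition_factors (M : rep k A) (Ls : seq (rep k A)) : Prop :=
  exists (N : nat -> submod M) (p : 'S_(size Ls)),
  [/\ sset (N 0%N) = [set 0], sset (N (size Ls)) = setT
    & forall i : 'I_(size Ls),
      [/\ sset (N i) `<=` sset (N i.+1), simple (subquo (N i) (N i.+1))
        & rep_iso (subquo (N i) (N i.+1)) (nth M Ls (p i))]].

End Structure.

(* Products in 'S_3 are taken right to left here: (g ** h) i = g (h i),
   whereas MathComp's (g * h)%g i = h (g i). *)
Notation "g ** h" := (h * g)%g (at level 40, left associativity).

Definition i1 : 'I_3 := @Ordinal 3 0 isT.
Definition i2 : 'I_3 := @Ordinal 3 1 isT.
Definition i3 : 'I_3 := @Ordinal 3 2 isT.

(* The odd elements of 'S_3 are exactly the transpositions. *)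
Definition transp := {s : 'S_3 | odd_perm s}.

Lemma transp_proof (i j : 'I_3) : i != j -> odd_perm (tperm i j).
Proof. by rewrite odd_tperm. Qed.
Definition mk_transp (i j : 'I_3) (ij : i != j) : transp :=
  exist _ (tperm i j) (transp_proof ij).
Definition t12 : transp := @mk_transp i1 i2 isT.
Definition t23 : transp := @mk_transp i2 i3 isT.
Definition t13 : transp := @mk_transp i1 i3 isT.

Lemma conj_proof (g : 'S_3) (a : transp) : odd_perm (g ** val a ** g^-1%g).
Proof. by rewrite !odd_permM odd_permV (valP a) /=; case: odd_perm. Qed.
Definition conj (g : 'S_3) (a : transp) : transp :=
  exist _ (g ** val a ** g^-1%g) (conj_proof g a).

Definition sgn (k : fieldType) (g : 'S_3) : k := (-1) ^+ odd_perm g.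
Arguments sgn : clear implicits.

Definition sigma : 'S_3 := val t12.
Definition tau : 'S_3 := val t12 ** val t23.

(* Generators: of the double of k S_3 (group elements and delta's), and of
   the double of B(V) # k S_3 (adding the x's and the y's). *)
Inductive ggen := Gr of 'S_3 | De of 'S_3.
Inductive gen := H of ggen | X of transp | Y of transp.

Section Relations.
Variable k : fieldType.
Implicit Types (g h : 'S_3) (a b c : transp).

(* In each rule the vector u - v stands for the relation u = v. *)
Inductive DS3_rel (M : rep k ggen) : set M :=
| rel_gr1 v : DS3_rel (act (Gr 1%g) v - v)
| rel_grM g h v : DS3_rel (act (Gr g) (act (Gr h) v) - act (Gr (g ** h)) v)
| rel_deM g h v :
    DS3_rel (act (De g) (act (De h) v) - (if g == h then act (De g) v else 0))
| rel_de1 v : DS3_rel (\sum_(h : 'S_3) act (De h) v - v)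
| rel_degr g h v :
    DS3_rel (act (De h) (act (Gr g) v)
             - act (Gr g) (act (De (g^-1%g ** h ** g)) v)).

Notation Gr g := (H (Gr g)).
Notation De g := (H (De g)).

(* (ij), (ik), (jk) with i, j, k distinct are three arbitrary distinct
   transpositions a, b, c. *)
Inductive D_rel (M : rep k gen) : set M :=
| rel_DS3 (v : M) : DS3_rel (M := restrict H M) v -> D_rel v
| rel_xx a v : D_rel (act (X a) (act (X a) v))
| rel_xxx a b c v : a != b -> a != c -> b != c ->
    D_rel (act (X a) (act (X b) v) + act (X c) (act (X a) v)
           + act (X b) (act (X c) v))
| rel_yy a v : D_rel (act (Y a) (act (Y a) v))
| rel_yyy a b c v : a != b -> a != c -> b != c ->
    D_rel (act (Y a) (act (Y b) v) + act (Y c) (act (Y a) v)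
           + act (Y b) (act (Y c) v))
| rel_grx g a v :
    D_rel (act (Gr g) (act (X a) v)
           - sgn k g *: act (X (conj g a)) (act (Gr g) v))
| rel_dex h a v :
    D_rel (act (De h) (act (X a) v) - act (X a) (act (De (val a ** h)) v))
| rel_dey h a v :
    D_rel (act (De h) (act (Y a) v) - act (Y a) (act (De (val a ** h)) v))
| rel_ygr g a v :
    D_rel (act (Y a) (act (Gr g) v)
           - sgn k g *: act (Gr g) (act (Y (conj g^-1%g a)) v))
| rel_yx a v :
    D_rel (act (Y a) (act (X a) v) + act (X a) (act (Y a) v)
           - (v + act (Gr (val a)) (act (De (val a)) v - act (De 1%g) v)))
| rel_yxx a b c v : a != b -> a != c -> b != c ->
    D_rel (act (Y b) (act (X a) v) + act (X a) (act (Y c) v)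
           - act (Gr (val a))
               (act (De (val b)) v - act (De (val b ** val a)) v)).

Definition DS3_module (M : rep k ggen) : Prop := DS3_rel (M := M) `<=` [set 0].
Definition D_module (M : rep k gen) : Prop := D_rel (M := M) `<=` [set 0].

End Relations.

HB.instance Definition _ := gen_eqMixin gen.

(* k<A> (x) M, realised as the finitely supported functions from words to M,
   with f standing for the sum over w of w (x) f w. *)
Section FreeRep.
Variables (k : fieldType) (A : eqType) (M : lmodType k).

Definition word_act (s : A) (f : seq A -> M) : seq A -> M :=
  fun w => if w is s' :: w' then (if s' == s then f w' else 0) else 0.

Lemma word_act_linear s : linear (word_act s).
Proof.
move=> c f g; apply/funext => -[|s' w]; rewrite /word_act !fctE.
  by rewrite scaler0 addr0.
by case: eqP => // _; rewrite scaler0 addr0.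
Qed.

Definition word_rep : rep k A := Rep word_act_linear.

Definition finite_supp : set word_rep :=
  [set f : seq A -> M | exists s : seq (seq A), forall w, w \notin s -> f w = 0].

Lemma finite_supp_submod : is_submod finite_supp.
Proof.
split=> [|c f g [s Hs] [t Ht]|a f [s Hs]].
- by exists [::].
- exists (s ++ t) => w; rewrite mem_cat negb_or => /andP[/Hs fw /Ht gw].
  by rewrite !fctE fw gw scaler0 addr0.
- exists (map (cons a) s) => -[|a' w] //= Hw.
  case: eqP => // aa'; apply: Hs; apply: contra Hw => ws.
  by rewrite aa'; exact: map_f.
Qed.

Definition free_rep : rep k A := subrep (Submod finite_supp_submod).

Lemma single_proof (m : M) :
  ((fun w => if w is [::] then m else 0) : seq A -> M)
    \in smem (Submod finite_supp_submod).
Proof. by apply/asboolP; exists [:: [::]] => -[|a w]. Qed.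

(* 1 (x) m *)
Definition single (m : M) : free_rep :=
  exist (fun v : word_rep => v \in smem (Submod finite_supp_submod))
    _ (single_proof m).

Lemma single_linear : linear single.
Proof.
move=> c u v; apply: val_inj => /=; apply/funext => -[|a w].
  by rewrite !fctE.
by rewrite !fctE scaler0 addr0.
Qed.

Section Universal.
Variables (N : rep k A) (phi : M -> N).
Hypothesis phi_lin : linear phi.

Lemma phi0 : phi 0 = 0.
Proof.
have /= := phi_lin (-1) 0 0; rewrite scaler0 addr0 scaleN1r => {1}->.
by rewrite addNr.
Qed.

Definition word_op (w : seq A) (v : N) : N := foldr (@act k A N) v w.

Lemma word_op_linear w : linear (word_op w).
Proof.
by elim: w => // s w IH c u v; rewrite /= -!/(word_op w _) IH linearP.
Qed.

Lemma word_op0 w : word_op w 0 = 0.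
Proof. by elim: w => // s w; rewrite /= -/(word_op w 0) => ->; rewrite linear0. Qed.

Lemma supp_exists (f : free_rep) :
  exists s : seq (seq A), forall w, w \notin s -> val f w = 0.
Proof. by have /asboolP := valP f. Qed.

Definition supp (f : free_rep) : seq (seq A) :=
  undup (projT1 (cid (supp_exists f))).

Lemma suppP f w : w \notin supp f -> val f w = 0.
Proof. by rewrite mem_undup; case: cid => s /= /(_ w). Qed.

Definition lift_sum (s : seq (seq A)) (f : seq A -> M) : N :=
  \sum_(w <- s) word_op w (phi (f w)).

Lemma lift_sum_supp (f : seq A -> M) s t :
    uniq s -> uniq t -> (forall w, w \notin s -> f w = 0) ->
    (forall w, w \notin t -> f w = 0) ->
  lift_sum s f = lift_sum t f.
Proof.
move=> us ut fs ft.
have E r : lift_sum r f =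
    \sum_(w <- [seq w <- r | f w != 0]) word_op w (phi (f w)).
  rewrite big_filter big_mkcond /=; apply: eq_bigr => w _.
  by case: eqP => //= ->; rewrite phi0 word_op0.
rewrite !E; apply: perm_big; apply: uniq_perm; rewrite ?filter_uniq // => w.
rewrite !mem_filter; case: eqP => //= fw.
by rewrite (contra_notT (fs w) fw) (contra_notT (ft w) fw).
Qed.

Definition free_lift (f : free_rep) : N := lift_sum (supp f) (val f).

Lemma free_liftE (f : free_rep) s :
  uniq s -> (forall w, w \notin s -> val f w = 0) ->
  free_lift f = lift_sum s (val f).
Proof.
by move=> us fs; apply: lift_sum_supp; rewrite ?undup_uniq//; exact: suppP.
Qed.

Lemma free_lift_hom : is_hom free_lift.
Proof.
split=> [c f g|s f].
  pose t := undup (supp f ++ supp g).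
  have tf w : w \notin t -> val f w = 0.
    by rewrite mem_undup mem_cat negb_or => /andP[/suppP].
  have tg w : w \notin t -> val g w = 0.
    by rewrite mem_undup mem_cat negb_or => /andP[_ /suppP].
  have tfg w : w \notin t -> val (c *: f + g) w = 0.
    by move=> wt; rewrite /= !fctE tf ?tg// scaler0 addr0.
  rewrite !(@free_liftE _ t) ?undup_uniq// /lift_sum scaler_sumr -big_split /=.
  by apply: eq_bigr => w _; rewrite !fctE phi_lin word_op_linear.
rewrite (@free_liftE _ (map (cons s) (supp f))).
- rewrite /free_lift /lift_sum big_map linear_sum /=; apply: eq_bigr => w _.
  by rewrite eqxx.
- by rewrite map_inj_uniq ?undup_uniq// => u v [].
- move=> [|s' w] //= ws; case: eqP => // ss'; apply: suppP.
  by apply: contra ws => ws; rewrite ss' map_f.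
Qed.

Lemma free_lift_single m : free_lift (single m) = phi m.
Proof.
rewrite (@free_liftE _ [:: [::]]) //; last by case.
by rewrite /lift_sum big_seq1.
Qed.

End Universal.

Lemma free_ind (P : set free_rep) : is_submod P -> (forall m, P (single m)) ->
  forall f, P f.
Proof.
move=> [P0 PD Pa] Ps f; have [s] := supp_exists f.
have PDD u v : P u -> P v -> P (u + v).
  by move=> Pu Pv; rewrite -[u]scale1r; exact: PD.
pose mono (w : seq A) (m : M) : free_rep := foldr (@act k A free_rep) (single m) w.
have Pm w m : P (mono w m) by elim: w => //= a w; exact: Pa.
have monoE w m v : val (mono w m) v = if v == w then m else 0.
  elim: w v => [|a w IH] [|b v] //=.
  by rewrite IH eqseq_cons; case: eqP; case: eqP.
move=> fs; have -> : f = \sum_(w <- undup s) mono w (val f w).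
  apply: val_inj; apply/funext => v.
  pose ev (g : free_rep) := val g v.
  have -> : val (\sum_(w <- undup s) mono w (val f w)) v
      = \sum_(w <- undup s) val (mono w (val f w)) v.
    apply: (big_morph ev) => //=.
  under eq_bigr do rewrite monoE.
  have [vs|vs] := boolP (v \in undup s).
    rewrite (bigD1_seq v) ?undup_uniq//= eqxx big1 ?addr0// => w.
    by rewrite eq_sym => /negPf->.
  rewrite big_seq_cond big1 => [|w /andP[ws _]].
    by rewrite fs// -mem_undup.
  by case: eqP => // vw; rewrite vw ws in vs.
apply: (big_ind P) => // w _; exact: Pm.
Qed.

End FreeRep.

Section RelHom.
Variable k : fieldType.

Lemma hom0 (A : Type) (M N : rep k A) (f : M -> N) : is_hom f -> f 0 = 0.
Proof.
case=> fl _; have := fl (-1) 0 0; rewrite scaler0 addr0 scaleN1r => {1}->.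
by rewrite addNr.
Qed.

Lemma homD (A : Type) (M N : rep k A) (f : M -> N) u v : is_hom f ->
  f (u + v) = f u + f v.
Proof. by case=> fl _; have := fl 1 u v; rewrite !scale1r. Qed.

Lemma homZ (A : Type) (M N : rep k A) (f : M -> N) c u : is_hom f ->
  f (c *: u) = c *: f u.
Proof.
by move=> fh; have [fl _] := fh; have := fl c u 0; rewrite (hom0 fh) !addr0.
Qed.

Lemma homN (A : Type) (M N : rep k A) (f : M -> N) u : is_hom f ->
  f (- u) = - f u.
Proof. by move=> fh; rewrite -scaleN1r homZ// scaleN1r. Qed.

Lemma homB (A : Type) (M N : rep k A) (f : M -> N) u v : is_hom f ->
  f (u - v) = f u - f v.
Proof. by move=> fh; rewrite homD// homN. Qed.

Lemma hom_act (A : Type) (M N : rep k A) (f : M -> N) s u : is_hom f ->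
  f (act s u) = act s (f u).
Proof. by case. Qed.

Lemma restrict_hom (A B : Type) (h : A -> B) (M N : rep k B) (f : M -> N) :
  is_hom f -> is_hom (f : restrict h M -> restrict h N).
Proof. by case=> fl fa; split=> // s v; exact: fa. Qed.

Lemma DS3_rel_hom (M N : rep k ggen) (f : M -> N) v : is_hom f ->
  DS3_rel v -> DS3_rel (f v).
Proof.
move=> fh; have E := (fun u v => homB u v fh, fun s u => hom_act s u fh).
case=> [u|g h u|g h u|u|g h u]; rewrite !E.
- exact: rel_gr1.
- exact: rel_grM.
- have -> : f (if g == h then act (De g) u else 0) =
            if g == h then act (De g) (f u) else 0.
    by case: eqP; rewrite ?E// (hom0 fh).
  exact: rel_deM.
- rewrite (big_morph f (fun a b => homD a b fh) (hom0 fh)).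
  by under eq_bigr do rewrite E; exact: rel_de1.
- exact: rel_degr.
Qed.

Lemma D_rel_hom (M N : rep k gen) (f : M -> N) v : is_hom f ->
  D_rel v -> D_rel (f v).
Proof.
move=> fh; have E := (fun u => homN u fh, fun s u => hom_act s u fh,
  fun u v => homD u v fh, fun c u => homZ c u fh).
case=> *; rewrite ?E.
- by apply/rel_DS3/(DS3_rel_hom (restrict_hom H fh)).
- exact: rel_xx.
- exact: rel_xxx.
- exact: rel_yy.
- exact: rel_yyy.
- exact: rel_grx.
- exact: rel_dex.
- exact: rel_dey.
- exact: rel_ygr.
- exact: rel_yx.
- exact: rel_yxx.
Qed.

Lemma DS3_rel_lift (M N : rep k ggen) (f : M -> N) w : is_hom f ->
  (forall q, exists v, q = f v) -> DS3_rel w -> exists2 v, DS3_rel v & w = f v.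
Proof.
move=> fh fs; have E := (fun u v => homB u v fh, fun s u => hom_act s u fh).
case=> [q|g h q|g h q|q|g h q]; have [u ->] := fs q.
- by exists (act (Gr 1%g) u - u); rewrite ?E//; constructor.
- by eexists; [exact: (rel_grM g h u)|rewrite !E].
- eexists; first exact: (rel_deM g h u).
  by rewrite !E; case: eqP; rewrite ?E// (hom0 fh).
- eexists; first exact: (rel_de1 u).
  rewrite !E (big_morph f (fun a b => homD a b fh) (hom0 fh)).
  by congr (_ - _); apply: eq_bigr => h _; rewrite E.
- by eexists; [exact: (rel_degr g h u)|rewrite !E].
Qed.

Lemma D_rel_lift (M N : rep k gen) (f : M -> N) w : is_hom f ->
  (forall q, exists v, q = f v) -> D_rel w -> exists2 v, D_rel v & w = f v.
Proof.
move=> fh fs; have E := (fun u => homN u fh, fun s u => hom_act s u fh,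
  fun u v => homD u v fh, fun c u => homZ c u fh).
case=> [q|a q|a b c q ab ac bc|a q|a b c q ab ac bc|g a q|h a q|h a q|g a q|a q
       |a b c q ab ac bc]; last first.
all: try have [u ->] := fs q.
- by eexists; [exact: (rel_yxx u ab ac bc)|rewrite !E].
- by eexists; [exact: (rel_yx a u)|rewrite !E].
- by eexists; [exact: (rel_ygr g a u)|rewrite !E].
- by eexists; [exact: (rel_dey h a u)|rewrite !E].
- by eexists; [exact: (rel_dex h a u)|rewrite !E].
- by eexists; [exact: (rel_grx g a u)|rewrite !E].
- by eexists; [exact: (rel_yyy u ab ac bc)|rewrite !E].
- by eexists; [exact: (rel_yy a u)|rewrite !E].
- by eexists; [exact: (rel_xxx u ab ac bc)|rewrite !E].
- by eexists; [exact: (rel_xx a u)|rewrite !E].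
- move=> /(DS3_rel_lift (restrict_hom H fh) fs)[v Dv ->].
  by exists v => //; exact: rel_DS3.
Qed.

End RelHom.

(* D (x)_{D^{>=0}} M, for a D(S_3)-module M on which the y's act by 0:
   the quotient of k<gen> (x) M by the submodule generated by the relations
   of D and by s (x) m - 1 (x) s m for the generators s of D^{>=0}. *)
Section Verma.
Variables (k : fieldType) (M : rep k ggen).

Inductive verma_rel : set (free_rep gen M) :=
| vrel_D v : D_rel v -> verma_rel v
| vrel_H s m : verma_rel (act (H s) (single gen m) - single gen (act s m))
| vrel_Y a m : verma_rel (act (Y a) (single gen m)).

Definition verma_ker := Submod (gen_subP verma_rel).

Definition verma : rep k gen := quorep verma_ker.

(* 1 (x) m *)
Definition vemb (m : M) : verma := qpi verma_ker (single gen m).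

Lemma qpi_hom : is_hom (qpi verma_ker : free_rep gen M -> verma).
Proof. by split; [exact: qpi_linear|move=> s v; exact: qpi_act]. Qed.

Lemma verma_D_module : D_module verma.
Proof.
move=> q /(D_rel_lift qpi_hom (@qpi_surj _ _ _ verma_ker))[v Dv ->] /=.
rewrite -(hom0 qpi_hom); apply/qpi_eq; rewrite subr0 => U _; apply.
exact: vrel_D.
Qed.

Lemma verma_universal (N : rep k gen) (phi : M -> N) :
  D_module N -> linear phi ->
  (forall s m, phi (act s m) = act (H s) (phi m)) ->
  (forall a m, act (Y a) (phi m) = 0) ->
  exists! F : verma -> N, is_hom F /\ forall m, F (vemb m) = phi m.
Proof.
move=> DN phil phiH phiY.
have fh := free_lift_hom phil.
pose K : set (free_rep gen M) := [set v | free_lift phi v = 0].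
have KP : is_submod K.
  split=> [|c u v Ku Kv|s v Kv]; rewrite /K /= ?(hom0 fh)//.
    by rewrite homD// homZ// Ku Kv scaler0 addr0.
  by rewrite hom_act// Kv linear0.
have KK u : sset verma_ker u -> K u.
  apply=> // v [{}v Dv|s m|a m]; rewrite /K /=.
  - by apply: DN; exact: (D_rel_hom fh).
  - by rewrite homB// hom_act// !free_lift_single// phiH subrr.
  - by rewrite hom_act// free_lift_single.
pose F (q : verma) : N := free_lift phi (repr q).
have FE v : F (qpi verma_ker v) = free_lift phi v.
  by apply/eqP; rewrite -subr_eq0 -homB//; apply/eqP/KK; exact: qpi_repr.
exists F; split.
  split; first split.
  - move=> c p q; have [u ->] := qpi_surj p; have [v ->] := qpi_surj q.
    by rewrite -qpi_linear !FE homD// homZ.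
  - move=> s q; have [u ->] := qpi_surj q.
    by rewrite -(hom_act _ _ qpi_hom) !FE hom_act.
  - by move=> m; rewrite FE free_lift_single.
move=> G [Gh Gm]; apply/funext => q; have [u ->] := qpi_surj q.
rewrite FE.
apply: (free_ind (P := [set u | free_lift phi u = G (qpi verma_ker u)])).
  split=> [|c v w|s v] /=; first by rewrite (hom0 fh) (hom0 qpi_hom) (hom0 Gh).
    move=> Kv Kw; rewrite (homD _ _ qpi_hom) (homZ _ _ qpi_hom).
    by rewrite (homD _ _ Gh) (homZ _ _ Gh) (homD _ _ fh) (homZ _ _ fh) Kv Kw.
  by rewrite (hom_act _ _ qpi_hom) (hom_act _ _ Gh) (hom_act _ _ fh) => ->.
by move=> m /=; rewrite free_lift_single// -Gm.
Qed.

End Verma.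

Definition simple_head (k : fieldType) (M : rep k ggen) : rep k gen :=
  head (verma M).
(* The D(S_3)-module with basis |b>, b in B, where |b> has degree deg b and
   g |b> = c g b |p g b>. *)
Section Monomial.
Variables (k : fieldType) (B : finType) (deg : B -> 'S_3).
Variables (p : 'S_3 -> B -> B) (c : 'S_3 -> B -> k).

Definition ket (b : B) : {ffun B -> k^o} := [ffun b' => (b' == b)%:R].

Definition mono_act (s : ggen) (v : {ffun B -> k^o}) : {ffun B -> k^o} :=
  match s with
  | Gr g => \sum_b (v b * c g b) *: ket (p g b)
  | De h => [ffun b => if deg b == h then v b else 0]
  end.

Lemma mono_act_linear s : linear (mono_act s).
Proof.
move=> a u v; case: s => [g|h] /=.
  rewrite scaler_sumr -big_split; apply: eq_bigr => b _ /=.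
  by rewrite !ffunE mulrDl scalerDl scalerA mulrA.
by apply/ffunP => b; rewrite !ffunE; case: ifP; rewrite ?scaler0 ?addr0.
Qed.

Definition mono : rep k ggen := Rep mono_act_linear.

Lemma mono_GrE g b : act (Gr g) (ket b : mono) = c g b *: ket (p g b).
Proof.
rewrite /act /= (bigD1 b) //= big1 ?addr0 ?ffunE ?eqxx ?mul1r// => b' bb'.
by rewrite ffunE (negPf bb') mul0r scale0r.
Qed.

Lemma mono_DeE h b :
  act (De h) (ket b : mono) = if deg b == h then ket b else 0.
Proof.
apply/ffunP => b'; rewrite /act /= ffunE; case: (eqVneq b' b) => [->|bb'].
  by case: ifP; rewrite ?ffunE.
by case: ifP; case: ifP => _ _; rewrite !ffunE// (negPf bb').
Qed.

Lemma ket_expand (v : mono) : v = \sum_b (v : {ffun B -> k^o}) b *: ket b.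
Proof.
apply/ffunP => b; rewrite sum_ffunE (bigD1 b) //= big1 => [|b' bb'].
  by rewrite !ffunE eqxx addr0 [RHS]mulr1.
by rewrite !ffunE eq_sym (negPf bb') [LHS]mulr0.
Qed.

Hypothesis p1 : forall b, p 1%g b = b.
Hypothesis c1 : forall b, c 1%g b = 1.
Hypothesis pM : forall g h b, p (g ** h) b = p g (p h b).
Hypothesis cM : forall g h b, c (g ** h) b = c g (p h b) * c h b.
Hypothesis deg_p : forall g b, deg (p g b) = g ** deg b ** g^-1%g.

Lemma mono_ext (f : mono -> mono) : linear f -> (forall b, f (ket b) = 0) ->
  forall v, f v = 0.
Proof.
move=> fl fk v.
have f0 : f 0 = 0.
  have := fl (-1) 0 0; rewrite scaler0 addr0 scaleN1r => {1}->.
  by rewrite addNr.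
have fD u w : f (u + w) = f u + f w by have := fl 1 u w; rewrite !scale1r.
rewrite [v]ket_expand (big_morph f fD f0) big1// => b _.
by have := fl ((v : {ffun B -> k^o}) b) (ket b) 0; rewrite f0 !addr0 fk scaler0.
Qed.

Lemma mono_DS3 : DS3_module mono.
Proof.
have lsub (f f' : mono -> mono) : linear f -> linear f' ->
    linear (fun v => f v - f' v).
  move=> fl fl' a u v; rewrite fl fl' opprD scalerBr !addrA; congr (_ + _).
  by rewrite addrAC.
have lact s : linear (act s : mono -> mono) by exact: act_linear.
have lcomp (f f' : mono -> mono) : linear f -> linear f' ->
    linear (fun v => f (f' v)) by move=> fl fl' a u v; rewrite fl' fl.
have lid : linear (fun v : mono => v) by [].
have l0 : linear (fun v : mono => 0 : mono).
  by move=> a u v; rewrite scaler0 addr0.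
move=> _ [v|g h v|g h v|v|g h v]; red.
- move: v; apply: mono_ext => [|b]; first exact: lsub.
  by cbv beta; rewrite mono_GrE c1 p1 scale1r subrr.
- move: v; apply: mono_ext => [|b]; first by apply: lsub => //; exact: lcomp.
  by cbv beta; rewrite !mono_GrE actZ mono_GrE scalerA pM cM mulrC subrr.
- move: v; apply: mono_ext => [|b].
    by apply: lsub; [exact: lcomp|case: eqP].
  cbv beta; rewrite !mono_DeE; case: (eqVneq (deg b) h) => [bh|bh].
    rewrite mono_DeE bh eq_sym; case: (eqVneq g h) => _; first by rewrite subrr.
    by rewrite subrr.
  rewrite act0; case: (eqVneq g h) => [->|_]; last by rewrite subrr.
  by rewrite (negPf bh) subrr.
- move: v; apply: mono_ext => [|b].
    apply: lsub => // a u v; rewrite scaler_sumr -big_split.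
    by apply: eq_bigr => h _; exact: act_linear.
  cbv beta; rewrite (bigD1 (deg b)) // big1 => [|h bh].
    by rewrite [X in X - _ = _]addr0 mono_DeE eqxx subrr.
  by rewrite mono_DeE eq_sym (negPf bh).
- move: v; apply: mono_ext => [|b].
    by apply: lsub; apply: lcomp.
  cbv beta; rewrite mono_GrE actZ !mono_DeE deg_p.
  have -> : (g ** deg b ** g^-1%g == h) = (deg b == g^-1%g ** h ** g).
    by apply/eqP/eqP => E; [rewrite -E|rewrite E]; rewrite !mulgA ?mulgV ?mulVg ?mul1g ?mulgK ?mulgKV.
  by case: eqP => _; rewrite ?act0 ?mono_GrE ?scaler0 subrr.
Qed.

End Monomial.

Section SimpleModules.
Variables (k : fieldType) (zeta : k).

(* M(e,+) (s = false) and M(e,-) (s = true) *)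
Definition M_e (s : bool) : rep k ggen :=
  mono (fun _ : unit => 1%g) (fun _ b => b)
    (fun g _ => if s then sgn k g else 1).

(* M(sigma,+) (s = false) and M(sigma,-) (s = true), with |ij> = ket (ij) *)
Definition M_sigma (s : bool) : rep k ggen :=
  mono (fun a : transp => val a) conj (fun g _ => if s then sgn k g else 1).

(* The t in {0,1,2} such that g is tau^t or sigma tau^t. *)
Definition tau_exp (g : 'S_3) : nat :=
  val (if odd_perm g then sigma (g i1) else g i1).

Definition rot_coef (l : nat) (g : 'S_3) (b : bool) : k :=
  (if b then zeta else zeta^-1) ^+ (l * tau_exp g).
Definition rot_perm (g : 'S_3) (b : bool) : bool := b (+) odd_perm g.

(* |tau> = ket true and |tau^-1> = ket false *)
Definition M_tau (l : nat) : rep k ggen :=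
  mono (fun b : bool => if b then tau else tau^-1%g) rot_perm (rot_coef l).

(* The two-dimensional irreducible representation of S_3, in an eigenbasis
   of tau. *)
Definition M_rho : rep k ggen :=
  mono (fun _ : bool => 1%g) rot_perm (rot_coef 1).

Lemma M_e_DS3 s : DS3_module (M_e s).
Proof.
apply: mono_DS3 => // [_|g h _|g _].
- by case: s; rewrite // /sgn odd_perm1.
- by case: s; rewrite ?mulr1// /sgn odd_permM -signr_addb addbC.
- by rewrite !(mulg1, mul1g) mulVg.
Qed.

Lemma M_sigma_DS3 s : DS3_module (M_sigma s).
Proof.
apply: mono_DS3 => // [a|_|g h a|g h _].
- by apply: val_inj; rewrite /= invg1 mul1g mulg1.
- by case: s; rewrite // /sgn odd_perm1.
- by apply: val_inj; rewrite /= invMg !mulgA.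
- by case: s; rewrite ?mulr1// /sgn odd_permM -signr_addb addbC.
Qed.

Lemma ord3_ind (P : 'I_3 -> Prop) : P i1 -> P i2 -> P i3 -> forall i, P i.
Proof.
move=> P1 P2 P3 [[|[|[|n]]] lt_n3] //.
- by rewrite (_ : Ordinal _ = i1)//; exact: val_inj.
- by rewrite (_ : Ordinal _ = i2)//; exact: val_inj.
- by rewrite (_ : Ordinal _ = i3)//; exact: val_inj.
Qed.

Lemma perm3P (g h : 'S_3) :
  g i1 = h i1 -> g i2 = h i2 -> g i3 = h i3 -> g = h.
Proof. by move=> E1 E2 E3; apply/permP; apply: ord3_ind. Qed.

Lemma sigmaE : (sigma i1 = i2) * (sigma i2 = i1) * (sigma i3 = i3).
Proof. by rewrite /sigma /= tpermL tpermR tpermD. Qed.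

Lemma tauE : (tau i1 = i2) * (tau i2 = i3) * (tau i3 = i1).
Proof.
by rewrite /tau /= !permM !(tpermL, tpermR, @tpermD _ i2 i3 i1)//
  (@tpermD _ i1 i2 i3).
Qed.

Lemma tau_odd : odd_perm tau = false.
Proof. by rewrite odd_permM !odd_tperm. Qed.
Lemma sigma_odd : odd_perm sigma = true.
Proof. by rewrite odd_tperm. Qed.

Definition S3E := (sigmaE, tauE, perm1, permM).

Lemma S3_ind (P : 'S_3 -> Prop) :
  P 1%g -> P tau -> P (tau ** tau) -> P sigma -> P (sigma ** tau) ->
  P (sigma ** (tau ** tau)) -> forall g, P g.
Proof.
move=> P1 P2 P3 P4 P5 P6 g.
have inj i j : g i = g j -> i = j by exact: perm_inj.
have C h : P h -> g i1 = h i1 -> g i2 = h i2 -> g i3 = h i3 -> P g.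
  by move=> Ph *; rewrite (@perm3P g h).
have ex i : g i = i1 \/ g i = i2 \/ g i = i3.
  by elim/ord3_ind: (g i); [left|right; left|right; right].
have F12 : i1 = i2 -> False by [].
have F13 : i1 = i3 -> False by [].
have F23 : i2 = i3 -> False by [].
case: (ex i1) => [|[]] E1; case: (ex i2) => [|[]] E2; case: (ex i3) => [|[]] E3;
  try (by case: F12; apply: inj; rewrite E1 E2);
  try (by case: F13; apply: inj; rewrite E1 E3);
  try (by case: F23; apply: inj; rewrite E2 E3).
- by apply: (C _ P1); rewrite !S3E.
- by apply: (C _ P5); rewrite !S3E.
- by apply: (C _ P4); rewrite !S3E.
- by apply: (C _ P2); rewrite !S3E.
- by apply: (C _ P3); rewrite !S3E.
- by apply: (C _ P6); rewrite !S3E.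
Qed.

Lemma tau3 : tau ** tau ** tau = 1%g.
Proof. by move: tau tauE => t tE; apply: perm3P; rewrite !(tE, permM, perm1). Qed.

Lemma tauV : tau^-1%g = tau ** tau.
Proof. by apply: (mulgI tau); rewrite mulgV -tau3. Qed.

Lemma tau_exp1 : tau_exp 1 = 0%N.
Proof. by rewrite /tau_exp odd_perm1 perm1. Qed.

Hypothesis zetaP : 3.-primitive_root zeta.

Lemma rot_perm1 b : rot_perm 1 b = b.
Proof. by rewrite /rot_perm odd_perm1 addbF. Qed.

Lemma rot_permM g h b : rot_perm (g ** h) b = rot_perm g (rot_perm h b).
Proof. by rewrite /rot_perm odd_permM addbA. Qed.

Lemma rot_coef1 l b : rot_coef l 1 b = 1.
Proof. by rewrite /rot_coef tau_exp1 muln0 expr0. Qed.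

Lemma rot_coefM l g h b :
  rot_coef l (g ** h) b = rot_coef l g (rot_perm h b) * rot_coef l h b.
Proof.
have z3 : zeta ^+ 3 = 1 by exact: prim_expr_order.
have z0 : zeta != 0 by apply/eqP => z0; move/eqP: z3; rewrite z0 expr0n eq_sym oner_eq0.
have zVz : zeta * zeta^-1 = 1 by rewrite mulfV.
have zV : zeta^-1 = zeta ^+ 2.
  by apply: (mulfI z0); rewrite zVz -exprS z3.
rewrite /rot_coef /rot_perm !(mulnC l) !exprM -!exprMn; congr (_ ^+ l).
elim/S3_ind: g; elim/S3_ind: h; rewrite /tau_exp;
  move: tau tauE tau_odd => t tE todd;
  rewrite !(odd_permM, odd_perm1, todd, sigma_odd) /=;
  rewrite !(tE, sigmaE, permM, perm1) /=;
  by case: b; rewrite /= ?zV -?exprM -?exprD -(expr_mod _ z3)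
    -[RHS](expr_mod _ z3).
Qed.

Lemma M_tau_DS3 l : DS3_module (M_tau l).
Proof.
apply: mono_DS3 => [|b|g h b|g h b|g b].
- exact: rot_perm1.
- exact: rot_coef1.
- exact: rot_permM.
- exact: rot_coefM.
- rewrite /rot_perm; apply/eqP; rewrite eq_sym -(inj_eq (mulgI g)) /=.
  apply/eqP; rewrite tauV mulKVg.
  elim/S3_ind: g; move: tau tauE tau_odd => t tE todd;
    rewrite !(odd_permM, odd_perm1, todd, sigma_odd) /=.
  all: by case: b => /=; apply: perm3P; rewrite !(tE, sigmaE, permM, perm1).
Qed.

Lemma M_rho_DS3 : DS3_module M_rho.
Proof.
apply: mono_DS3 => [|b|g h b|g h b|g _].
- exact: rot_perm1.
- exact: rot_coef1.
- exact: rot_permM.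
- exact: rot_coefM.
- by rewrite !(mulg1, mul1g) mulVg.
Qed.

End SimpleModules.


Section SigmaMinus.
Variables (k : fieldType) (zeta : k).

Definition verma_sm : rep k gen := verma (M_sigma k true).

Local Notation M := verma_sm.
Local Notation x a := (@act k gen M (X a)).
Local Notation v12 := (@vemb k (M_sigma k true) (ket k t12)).
Local Notation v23 := (@vemb k (M_sigma k true) (ket k t23)).
Local Notation v13 := (@vemb k (M_sigma k true) (ket k t13)).

Definition vec_v : M :=
  zeta^-1 *: x t23 v23 + zeta *: x t13 v13 + x t12 v12.
Definition vec_q : M := x t12 (x t23 v23) - x t12 (x t13 v13).
Definition vec_n0 : M :=
  x t13 (x t12 (x t23 v23)) + x t12 (x t13 (x t23 v12))
  - x t12 (x t13 (x t12 v13)).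
Definition vec_u : M :=
  - (zeta^-1 *: x t12 (x t13 (x t12 v23))) + zeta *: x t12 (x t13 (x t23 v13))
  + x t13 (x t12 (x t23 v12)).
Definition vec_p : M :=
  - (2%:R *: x t13 (x t12 v23) + x t12 (x t23 v23))
  - (2%:R *: x t13 (x t23 v13) + x t12 (x t13 v13)).
Definition vec_o0 : M := x t13 v12 + x t12 v23 + x t23 v13.
Definition vec_e1 : M := x t12 v12 + x t23 v23 + x t13 v13.
Definition vec_e3 : M :=
  x t13 (x t12 (x t23 v12)) - x t12 (x t13 (x t12 v23))
  + x t12 (x t13 (x t23 v13)).

Definition DS3_gen (w : M) : set M := @gen_sub k ggen (restrict H M) [set w].

Definition S_sm : set M := socle (M := M).
Definition VQN : set M :=
  add_set (add_set (add_set S_sm (DS3_gen vec_v)) (DS3_gen vec_q))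
    (DS3_gen vec_n0).
Definition OPU : set M :=
  add_set (add_set (add_set S_sm (DS3_gen vec_u)) (DS3_gen vec_p))
    (DS3_gen vec_o0).
Definition T_sm (lambda mu : k) : set M :=
  add_set [set v | exists c : k, v = c *: (lambda *: vec_e1 + mu *: vec_e3)]
    S_sm.

Definition listed : set (set M) :=
  [set U | [\/ U = S_sm, U = OPU, U = VQN
            | exists lambda mu : k, U = T_sm lambda mu]].

End SigmaMinus.

(* Main.v *)
(* A proper submodule of a Verma module lies in the span of the images of the x's
   (Nakayama's lemma: the x's are nilpotent), so Verma modules have unique maximal
   submodules, and any simple D-module generated by a simple D(S_3)-module killed
   by the y's is the corresponding simple head.

   M(sigma,-) has a monomial basis |w b> with w one of the 12 monomials of the
   Fomin-Kirillov algebra; the generators act on it by integer matrices.  Spanning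
   follows from the relations, independence from a 36-dimensional model whose
   defining relations are checked by computation.  In a basis adapted to
   the submodules S, OPU, VQN, T the structure is read off from a few operators,
   again by integer computations: every nonzero vector reaches the top degree, which
   generates S; modulo S the radical X is the sum of OPU/S, VQN/S and the two
   trivial lines, and for each of its 14 coordinates in OPU/S and VQN/S some product
   of generators is a rank one operator isolating that coordinate, so a submodule
   between S and X contains OPU (VQN) as soon as it has a vector with a nonzero
   component there; the symmetrizer of S_3 in degree e isolates the two lines. *)

Require Import Defs.
From HB Require Import structures.
From mathcomp Require Import all_boot all_order all_algebra all_fingroup.
From mathcomp Require Import boolp classical_sets.
From mathcomp Require Import generic_quotient ring.
Import Defs.

Set Implicit Arguments.
Unset Strict Implicit.
Unset Printing Implicit Defensive.

Import GRing.Theory.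
Local Open Scope ring_scope.
Local Open Scope classical_set_scope.

(** * Submodules and homomorphisms *)

(** Neither ['S_3] nor the field is data on which [vm_compute] can decide an equation, so the finite
    checks run on integers: elements of S_3 are replaced by codes, vectors by lists of integer
    coefficients on monomials, elements of D by integer combinations of words in the coded
    generators. A computed identity then holds over every field, and the only integers that have to
    be invertible are products of 2 and 3. Zeta stays out of the tables: a vector containing it is
    split into integral parts, which are recovered inside a submodule by applying sigma, or by
    inverting the Fourier transform over the powers of tau. The adapted basis is ordered so that its
    initial segments of length 10, 17, 24, 25, 26 and 36 span submodules; the coordinates used for
    the lattice thus also give the composition series. VQN is not an initial segment and is cut out
    by its own set of coordinates. The two trivial factors of X/S are isomorphic, which is why a
    two-parameter family of submodules T appears in the list. *)

Section Submodules.
Variables (k : fieldType) (A : Type) (M : rep k A).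

Lemma actD s (u v : M) : act s (u + v) = act s u + act s v.
Proof. exact: linearD. Qed.

Lemma actN s (v : M) : act s (- v) = - act s v.
Proof. exact: linearN. Qed.

Lemma act_sum s (I : Type) (r : seq I) (P : pred I) (F : I -> M) :
  act s (\sum_(i <- r | P i) F i) = \sum_(i <- r | P i) act s (F i).
Proof. exact: linear_sum. Qed.

Implicit Types U W : set M.

Lemma submod0 U : is_submod U -> U 0.
Proof. by case. Qed.

Lemma submodD U u v : is_submod U -> U u -> U v -> U (u + v).
Proof. by case=> _ UD _ Uu Uv; rewrite -[u]scale1r; exact: UD. Qed.

Lemma submodZ U c u : is_submod U -> U u -> U (c *: u).
Proof. by case=> U0 UD _ Uu; rewrite -[_ *: _]addr0; exact: UD. Qed.

Lemma submodB U u v : is_submod U -> U u -> U v -> U (u - v).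
Proof.
by move=> HU Uu Uv; apply: submodD => //; rewrite -scaleN1r; exact: submodZ.
Qed.

Lemma submod_act U s u : is_submod U -> U u -> U (act s u).
Proof. by case=> _ _; exact. Qed.

Lemma submod_unscale U (c : k) u : is_submod U -> c != 0 -> U (c *: u) -> U u.
Proof.
by move=> HU c0 /(submodZ c^-1 HU); rewrite scalerA mulVf// scale1r.
Qed.

Lemma submod_sum U (I : Type) (r : seq I) (P : pred I) (F : I -> M) :
  is_submod U -> (forall i, P i -> U (F i)) -> U (\sum_(i <- r | P i) F i).
Proof.
move=> HU UF; elim/big_ind: _ => //; first exact: submod0.
by move=> u v; exact: submodD.
Qed.

Lemma zero_submod : is_submod ([set 0] : set M).
Proof.
by split=> [//|c u v u0 v0|s v v0] /=;
  [rewrite u0 v0 scaler0 addr0|rewrite v0 linear0].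
Qed.

Lemma setT_submod : is_submod (setT : set M).
Proof. by []. Qed.

Lemma add_set_submod U W :
  is_submod U -> is_submod W -> is_submod (add_set U W).
Proof.
move=> HU HW; split=> [|c _ _ [u [w [Uu Ww ->]]] [u' [w' [Uu' Ww' ->]]]|
    s _ [u [w [Uu Ww ->]]]].
- by exists 0, 0; rewrite addr0; split=> //; exact: submod0.
- exists (c *: u + u'), (c *: w + w'); rewrite scalerDr addrACA.
  by split=> //; apply: submodD => //; exact: submodZ.
- exists (act s u), (act s w); rewrite linearD.
  by split=> //; exact: submod_act.
Qed.

Lemma add_setl U W : is_submod W -> U `<=` add_set U W.
Proof. by move=> HW u Uu; exists u, 0; rewrite addr0; split=> //; exact: submod0. Qed.

Lemma add_setr U W : is_submod U -> W `<=` add_set U W.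
Proof. by move=> HU u Wu; exists 0, u; rewrite add0r; split=> //; exact: submod0. Qed.

Lemma val_hom (U : submod M) : is_hom (val : subrep U -> M).
Proof. by []. Qed.

Lemma quo_hom (U : submod M) : is_hom (qpi U : M -> quorep U).
Proof. by split; [exact: qpi_linear|move=> s v; exact: qpi_act]. Qed.

End Submodules.

Section Homs.
Variables (k : fieldType) (A : Type).

Lemma ker_submod (M N : rep k A) (f : M -> N) :
  is_hom f -> is_submod [set v | f v = 0].
Proof.
move=> fh; split=> [|c u v /= fu fv|s v /= fv]; rewrite /= ?(hom0 fh)//.
  by rewrite (homD _ _ fh) (homZ _ _ fh) fu fv scaler0 addr0.
by rewrite (hom_act _ _ fh) fv linear0.
Qed.

Lemma image_submod (M N : rep k A) (f : M -> N) (U : set M) :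
  is_hom f -> is_submod U -> is_submod (f @` U).
Proof.
move=> fh HU; split=> [|c _ _ [u Uu <-] [v Uv <-]|s _ [u Uu <-]].
- by exists 0; [exact: submod0|exact: hom0].
- exists (c *: u + v); last by rewrite (homD _ _ fh) (homZ _ _ fh).
  by apply: submodD => //; exact: submodZ.
- by exists (act s u); [exact: submod_act|exact: hom_act].
Qed.

Lemma rep_iso_sym (M N : rep k A) : rep_iso M N -> rep_iso N M.
Proof.
move=> [f [fh [g fK gK]]]; exists g; split; last by exists f.
split=> [c u v|s v]; apply: (can_inj fK); rewrite gK.
  by rewrite (homD _ _ fh) (homZ _ _ fh) !gK.
by rewrite (hom_act _ _ fh) gK.
Qed.

(** First isomorphism theorem; preimages are picked by choice. *)
Lemma quo_iso (M N : rep k A) (f : M -> N) (U : submod M) :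
  is_hom f -> (forall n, exists v, f v = n) ->
  (forall v, sset U v <-> f v = 0) -> rep_iso (quorep U) N.
Proof.
move=> fh fs fU; pose g (q : quorep U) := f (repr q).
have gE v : g (qpi U v) = f v.
  by apply/eqP; rewrite -subr_eq0 -(homB _ _ fh); apply/eqP/fU; exact: qpi_repr.
exists g; split; first split.
- move=> c p q; have [u ->] := qpi_surj p; have [v ->] := qpi_surj q.
  by rewrite -qpi_linear !gE (homD _ _ fh) (homZ _ _ fh).
- move=> s q; have [u ->] := qpi_surj q.
  by rewrite -(hom_act _ _ (quo_hom U)) !gE (hom_act _ _ fh).
exists (fun n => qpi U (projT1 (cid (fs n)))) => [q|n].
  have [u ->] := qpi_surj q; apply/qpi_eq/fU; case: cid => v /=.
  by rewrite gE (homB _ _ fh) => ->; rewrite subrr.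
by rewrite gE; case: cid.
Qed.

(** Correspondence theorem: a submodule [V] of W / U is replaced by its preimage [Z] in [M], which
    lies between [U] and [W]. *)
Lemma subquo_simple (M : rep k A) (U W : submod M) :
  (exists2 w, sset W w & ~ sset U w) ->
  (forall Z : set M, is_submod Z -> sset U `<=` Z -> Z `<=` sset W ->
     (exists2 z, Z z & ~ sset U z) -> sset W `<=` Z) ->
  sset U `<=` sset W -> simple (subquo U W).
Proof.
move=> [w Ww Uw] UW sUW; split.
  have Ww' : w \in smem W by exact/asboolP.
  exists (qpi _ (exist _ w Ww' : subrep W)).
  by rewrite -(hom0 (quo_hom _)) => /qpi_eq /=; rewrite subr0.
move=> V HV.
pose Z : set M := [set v | exists u : subrep W, val u = v /\ V (qpi _ u)].
have qh := quo_hom (Submod (meet_submod U W)).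
have HZ : is_submod Z.
  split=> [|c _ _ [u [<- Vu]] [v [<- Vv]]|s _ [u [<- Vu]]].
  - by exists 0; rewrite (hom0 qh); split=> //; exact: submod0.
  - exists (c *: u + v); split=> //; rewrite (homD _ _ qh) (homZ _ _ qh).
    by apply: (submodD HV) => //; exact: (submodZ _ HV).
  - by exists (act s u); split=> //; rewrite (hom_act _ _ qh); exact: (submod_act _ HV).
have UZ : sset U `<=` Z.
  move=> u Uu; have Wu : u \in smem W by apply/asboolP; exact: sUW.
  exists (exist _ u Wu); split=> //.
  suff -> : qpi (Submod (meet_submod U W)) (exist _ u Wu : subrep W) = 0.
    exact: (submod0 HV).
  by rewrite -(hom0 qh); apply/qpi_eq; rewrite subr0.
have ZW : Z `<=` sset W by move=> _ [u [<- _]]; apply/asboolP; exact: (valP u).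
have [E|] := pselect (exists2 z, Z z & ~ sset U z).
  right; apply/seteqP; split=> // q _; have [u ->] := qpi_surj q.
  have [|u' [uu' Vu']] := UW Z HZ UZ ZW E (val u).
    by apply/asboolP; exact: (valP u).
  by rewrite -(val_inj uu').
move=> /forall2NP nE; left; apply/seteqP; split=> q; last first.
  by move=> /= ->; exact: (submod0 HV).
have [u ->] := qpi_surj q => Vu /=; rewrite -(hom0 qh); apply/qpi_eq.
rewrite subr0 /=; have [Zu|] := nE (val u); last by move=> /contrapT.
by case: Zu; exists u.
Qed.

End Homs.

Section DModules.
Variable k : fieldType.

Lemma sub_D_module (M : rep k gen) (U : submod M) :
  D_module M -> D_module (subrep U).
Proof.
by move=> DM v /(D_rel_hom (val_hom U))/DM v0; apply: val_inj.
Qed.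

Lemma quo_D_module (M : rep k gen) (U : submod M) :
  D_module M -> D_module (quorep U).
Proof.
move=> DM q /(D_rel_lift (quo_hom U) (@qpi_surj _ _ _ U))[v Dv ->] /=.
by rewrite (DM v Dv) (hom0 (quo_hom U)).
Qed.

Section VermaBasics.
Variable M0 : rep k ggen.
Local Notation V := (verma M0).

Lemma vemb_linear : linear (@vemb k M0).
Proof. by move=> c u v; rewrite /vemb single_linear qpi_linear. Qed.

Lemma vembH s m : @vemb k M0 (act s m) = act (H s) (vemb m).
Proof.
rewrite /vemb -(hom_act _ _ (qpi_hom M0)); apply/esym/qpi_eq => U _; apply.
exact: vrel_H.
Qed.

Lemma vembY a m : act (Y a) (@vemb k M0 m) = 0.
Proof.
rewrite /vemb -(hom_act _ _ (qpi_hom M0)) -(hom0 (qpi_hom M0)).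
by apply/qpi_eq; rewrite subr0 => U _; apply; exact: vrel_Y.
Qed.

Lemma verma_ind (P : set V) :
  is_submod P -> (forall m, P (vemb m)) -> forall v, P v.
Proof.
move=> HP Pm q; have [v ->] := qpi_surj q.
apply: (free_ind (P := [set u | P (qpi (verma_ker M0) u)])) => //.
split=> [|c u w /= Pu Pw|s u /= Pu] /=.
- by rewrite (hom0 (qpi_hom M0)); exact: submod0.
- rewrite (homD _ _ (qpi_hom M0)) (homZ _ _ (qpi_hom M0)).
  by apply: submodD => //; exact: submodZ.
- by rewrite (hom_act _ _ (qpi_hom M0)); exact: submod_act.
Qed.

End VermaBasics.
End DModules.

(** * Codes for the elements of S_3 *)

(** A bare three-element type instead of ['I_3], so that case analysis and [vm_compute] meet
    constructors only. *)
Inductive z3 := z0 | z1 | z2.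

Definition z3_eqb (a b : z3) : bool :=
  match a, b with z0, z0 | z1, z1 | z2, z2 => true | _, _ => false end.

Lemma z3_eqbP : Equality.axiom z3_eqb.
Proof. by move=> [] []; constructor. Qed.

HB.instance Definition _ := hasDecEq.Build z3 z3_eqbP.

Definition z3_all : seq z3 := [:: z0; z1; z2].

Lemma mem_z3 (a : z3) : a \in z3_all.
Proof. by case: a. Qed.

Definition z3_val (a : z3) : nat := match a with z0 => 0 | z1 => 1 | z2 => 2 end.
Definition z3_opp (a : z3) : z3 :=
  match a with z0 => z0 | z1 => z2 | z2 => z1 end.
Definition z3_succ (a : z3) : z3 :=
  match a with z0 => z1 | z1 => z2 | z2 => z0 end.
Definition z3_add (a b : z3) : z3 :=
  match a with z0 => b | z1 => z3_succ b | z2 => z3_succ (z3_succ b) end.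

(* [(s, t)] encodes [sigma ^ s ** tau ^ t]; the transpositions [t12], [t23],
   [t13] are [sigma ** tau ^ t] for [t] = 0, 1, 2. *)
Definition code : Type := (bool * z3)%type.
HB.instance Definition _ := Equality.on code.

(** Moving sigma to the left uses tau^t sigma = sigma tau^-t, hence the sign change when [d] is
    odd. *)
Definition code_mul (c d : code) : code :=
  (c.1 (+) d.1, z3_add (if d.1 then z3_opp c.2 else c.2) d.2).
Definition code_inv (c : code) : code :=
  (c.1, if c.1 then c.2 else z3_opp c.2).
(** A conjugate of an odd element is odd, so its exponent of tau determines it. *)
Definition code_conj (c : code) (a : z3) : z3 :=
  (code_mul (code_mul c (true, a)) (code_inv c)).2.
Definition codes : seq code := [seq (s, t) | s <- [:: false; true], t <- z3_all].

Lemma mem_codes (c : code) : c \in codes.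
Proof. by case: c => [[] []]. Qed.

Definition decode (c : code) : 'S_3 :=
  match c with
  | (false, z0) => 1%g
  | (false, z1) => tau
  | (false, z2) => tau ** tau
  | (true, z0) => sigma
  | (true, z1) => sigma ** tau
  | (true, z2) => sigma ** (tau ** tau)
  end.
Definition trz (a : z3) : transp :=
  match a with z0 => t12 | z1 => t23 | z2 => t13 end.

Arguments trz : simpl never.

Definition encode (g : 'S_3) : code :=
  (odd_perm g, match tau_exp g with 0 => z0 | 1 => z1 | _ => z2 end).
Arguments encode : simpl never.
Arguments decode : simpl never.
Definition zcode (a : transp) : z3 := (encode (val a)).2.

Lemma decodeK : cancel decode encode.
Proof.
case=> [[] []]; rewrite /encode /tau_exp /decode; move: tau tauE tau_odd => t tE todd;
  by rewrite !(odd_permM, odd_perm1, todd, sigma_odd) /= !(tE, sigmaE, permM, perm1).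
Qed.

Lemma encodeK : cancel encode decode.
Proof.
move=> g; suff [c ->] : exists c, g = decode c by rewrite decodeK.
by elim/S3_ind: g; [exists (false, z0)|exists (false, z1)|exists (false, z2)
  |exists (true, z0)|exists (true, z1)|exists (true, z2)].
Qed.

Lemma encodeM g h : encode (g ** h) = code_mul (encode g) (encode h).
Proof.
rewrite -{1}(encodeK g) -{1}(encodeK h).
suff E c d : decode c ** decode d = decode (code_mul c d) by rewrite E decodeK.
by case: c d => [[] []] [[] []]; rewrite /decode /=; move: tau tauE => t tE;
  apply: perm3P; rewrite /= !(tE, sigmaE, permM, perm1).
Qed.

Lemma encode1 : encode 1%g = (false, z0).
Proof. by rewrite -(decodeK (false, z0)). Qed.

Lemma encodeV g : encode g^-1%g = code_inv (encode g).
Proof.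
have: code_mul (encode g) (encode g^-1%g) = (false, z0).
  by rewrite -encodeM mulVg encode1.
by case: (encode g) (encode g^-1%g) => [[] []] [[] []].
Qed.

Lemma odd_encode g : odd_perm g = (encode g).1.
Proof. by []. Qed.

Lemma encode_inj : injective encode.
Proof. exact: can_inj encodeK. Qed.

Lemma encode_transp (a : transp) : encode (val a) = (true, zcode a).
Proof. by rewrite /zcode /encode (valP a). Qed.

Lemma zcode_conj g a : zcode (conj g a) = code_conj (encode g) (zcode a).
Proof. by rewrite /zcode -[val _]/(g ** val a ** g^-1%g) !encodeM encodeV encode_transp. Qed.

Lemma val_trz a : val (trz a) = decode (true, a).
Proof.
by case: a; rewrite /decode /=; move: tau tauE => t tE; apply: perm3P;
  rewrite !(tE, sigmaE, permM) /= ?tpermL ?tpermR ?tpermD//.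
Qed.

Lemma trzK : cancel trz zcode.
Proof. by move=> a; rewrite /zcode val_trz decodeK. Qed.

Lemma zcodeK : cancel zcode trz.
Proof.
by move=> a; apply/val_inj/encode_inj; rewrite val_trz decodeK encode_transp.
Qed.

Lemma conj_trz c a : conj (decode c) (trz a) = trz (code_conj c a).
Proof. by apply: (can_inj zcodeK); rewrite trzK zcode_conj decodeK trzK. Qed.

(** * Action of the generators on monomials *)

Inductive op := OpG of code | OpD of code | OpX of z3 | OpY of z3.

Definition gen_of (o : op) : gen :=
  match o with
  | OpG c => H (Gr (decode c))
  | OpD c => H (De (decode c))
  | OpX a => X (trz a)
  | OpY a => Y (trz a)
  end.
Definition op_of (s : gen) : op :=
  match s with
  | H (Gr g) => OpG (encode g)
  | H (De g) => OpD (encode g)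
  | X a => OpX (zcode a)
  | Y a => OpY (zcode a)
  end.

Lemma op_ofK : cancel op_of gen_of.
Proof. by case=> [[g|g]|a|a] /=; rewrite ?encodeK ?zcodeK. Qed.

Lemma gen_ofK : cancel gen_of op_of.
Proof. by case=> [c|c|a|a] /=; rewrite ?decodeK ?trzK. Qed.

(* [(w, b)] stands for [x_w |b>], where [x_w] is the monomial with factors
   [x (trz a)] for [a] in [w]. *)
Definition idx : Type := (seq z3 * z3)%type.
HB.instance Definition _ := Equality.on idx.
Definition svec : Type := seq (int * idx).

Definition sv_scale (c : int) (u : svec) : svec := [seq (c * x.1, x.2) | x <- u].
Definition sv_lin (f : idx -> svec) (u : svec) : svec :=
  flatten [seq sv_scale x.1 (f x.2) | x <- u].
Definition coef (u : svec) (p : idx) : int :=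
  foldr (fun x n => if x.2 == p then x.1 + n else n) 0 u.
(** The indices that do not occur in [u] have coefficient 0 anyway, so it is enough to test those
    that do. *)
Definition sv_zero (u : svec) : bool := all (fun x => coef u x.2 == 0) u.

(* Left multiplication in the Fomin-Kirillov algebra on its monomial basis, the
   words empty, 0, 1, 2, 01, 02, 20, 21, 201, 021, 020, 0201, closed under
   suffixes. *)
Definition xmul (a : z3) (w : seq z3) : seq (int * seq z3) :=
  match a, w with
  | z0, z0 :: _ | z1, z1 :: _ | z2, z2 :: _ => [::]
  | z1, [:: z0] => [:: (-1, [:: z0; z2]); (-1, [:: z2; z1])]
  | z1, [:: z2] => [:: (-1, [:: z0; z1]); (-1, [:: z2; z0])]
  | z1, [:: z0; z1] => [:: (-1, [:: z0; z2; z1])]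
  | z1, [:: z0; z2] => [:: (1, [:: z2; z0; z1])]
  | z1, [:: z2; z0] => [:: (1, [:: z0; z2; z1])]
  | z1, [:: z2; z1] => [:: (-1, [:: z2; z0; z1])]
  | z2, [:: z0; z2] => [:: (1, [:: z0; z2; z0])]
  | z1, [:: z2; z0; z1] => [::]
  | z1, [:: z0; z2; z1] => [::]
  | z1, [:: z0; z2; z0] => [:: (-1, [:: z0; z2; z0; z1])]
  | z2, [:: z0; z2; z1] => [:: (1, [:: z0; z2; z0; z1])]
  | z2, [:: z0; z2; z0] => [::]
  | z1, [:: z0; z2; z0; z1] => [::]
  | z2, [:: z0; z2; z0; z1] => [::]
  | _, _ => [:: (1, a :: w)]
  end.

Definition xop (a : z3) (p : idx) : svec :=
  [seq (x.1, (x.2, p.2)) | x <- xmul a p.1].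

Definition csgn (c : code) : int := if c.1 then -1 else 1.

(** The group element is moved past the leftmost letter by g x_a = sgn(g) x_(g a g^-1) g; at the
    empty word it acts on a ket of M(sigma,-), which contributes one more sign. *)
Fixpoint gop (c : code) (w : seq z3) (b : z3) : svec :=
  if w is a :: w' then
    sv_scale (csgn c) (sv_lin (xop (code_conj c a)) (gop c w' b))
  else [:: (csgn c, ([::], code_conj c b))].

(** By delta_h x_a = x_a delta_(a h), a factor x_a multiplies the degree by a on the left. *)
Definition idx_deg (p : idx) : code :=
  foldr (fun a d => code_mul (true, a) d) (true, p.2) p.1.
Definition dop (c : code) (p : idx) : svec :=
  if idx_deg p == c then [:: (1, p)] else [::].

Definition gop1 (c : code) (p : idx) : svec := gop c p.1 p.2.

(* The transposition different from [a] and [b], if these differ. *)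
Definition z3_third (a b : z3) : z3 := z3_opp (z3_add a b).

(** The letter y is commuted to the right through the word with the two relations between y's and
    x's; it changes into the third transposition when it passes a different letter, and kills the
    ket at the end. *)
Fixpoint yop (y : z3) (w : seq z3) (b : z3) : svec :=
  if w is a :: w' then
    if a == y then
      sv_scale (-1) (sv_lin (xop a) (yop y w' b)) ++ (1, (w', b)) ::
        sv_lin (gop1 (true, a)) (dop (true, a) (w', b) ++
          sv_scale (-1) (dop (false, z0) (w', b)))
    else
      sv_scale (-1) (sv_lin (xop a) (yop (z3_third a y) w' b)) ++
        sv_lin (gop1 (true, a)) (dop (true, y) (w', b) ++
          sv_scale (-1) (dop (code_mul (true, y) (true, a)) (w', b)))
  else [::].

Definition op1 (o : op) (p : idx) : svec :=
  match o with
  | OpG c => gop c p.1 p.2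
  | OpD c => dop c p
  | OpX a => xop a p
  | OpY a => yop a p.1 p.2
  end.
Definition app (o : op) : svec -> svec := sv_lin (op1 o).
Definition appw (w : seq op) (u : svec) : svec := foldr app u w.

(** Elements of the free algebra on the coded generators; the last letter of a word acts first. *)
Definition expr : Type := seq (int * seq op).
Definition appe (E : expr) (u : svec) : svec :=
  flatten [seq sv_scale x.1 (appw x.2 u) | x <- E].

Section Vec.
Variables (k : fieldType) (V : lmodType k) (e : idx -> V).

Definition vec (u : svec) : V := \sum_(x <- u) x.1%:~R *: e x.2.

Lemma vec_nil : vec [::] = 0.
Proof. exact: big_nil. Qed.

Lemma vec_cons x u : vec (x :: u) = x.1%:~R *: e x.2 + vec u.
Proof. exact: big_cons. Qed.

Lemma vec1 p : vec [:: (1, p)] = e p.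
Proof. by rewrite vec_cons vec_nil addr0 scale1r. Qed.

Lemma vec_cat u v : vec (u ++ v) = vec u + vec v.
Proof. exact: big_cat. Qed.

Lemma vec_scale c u : vec (sv_scale c u) = c%:~R *: vec u.
Proof.
rewrite /vec big_map scaler_sumr; apply: eq_bigr => x _ /=.
by rewrite intrM scalerA.
Qed.

Lemma vec_lin f u : vec (sv_lin f u) = \sum_(x <- u) x.1%:~R *: vec (f x.2).
Proof.
elim: u => [|x u IH]; first by rewrite vec_nil big_nil.
by rewrite big_cons -IH -vec_scale -vec_cat.
Qed.

Lemma vec_coef u (r : seq idx) : uniq r -> {subset map snd u <= r} ->
  vec u = \sum_(p <- r) (coef u p)%:~R *: e p.
Proof.
move=> ur; elim: u => [|[c q] u IH] sub.
  by rewrite vec_nil big1// => p _; rewrite scale0r.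
rewrite vec_cons IH => [/=|p pu]; last by apply: sub; rewrite inE pu orbT.
rewrite (bigD1_seq q) ?(bigD1_seq q (r := r)) ?ur ?sub ?mem_head//= eqxx.
rewrite intrD scalerDl -addrA; congr (_ + (_ + _)).
by apply: eq_bigr => p; rewrite eq_sym => /negPf->.
Qed.

Lemma vec_zero u : sv_zero u -> vec u = 0.
Proof.
move=> /allP u0; rewrite (vec_coef (undup_uniq (map snd u))) => [|p]; last first.
  by rewrite mem_undup.
rewrite big_seq big1// => p; rewrite mem_undup => /mapP[x xu ->].
by rewrite (eqP (u0 x xu)) scale0r.
Qed.

End Vec.

(** * Rewriting rules and the action of the generators in an arbitrary D-module *)

Section Semantics.
Variables (k : fieldType) (M : rep k gen).

Definition act_word (w : seq op) (v : M) : M :=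
  foldr (fun o => act (gen_of o)) v w.
Definition act_expr (E : expr) (v : M) : M :=
  \sum_(x <- E) x.1%:~R *: act_word x.2 v.

Lemma act_word_submod (U : set M) w v : is_submod U -> U v -> U (act_word w v).
Proof. by move=> HU Uv; elim: w => //= o w IH; exact: submod_act. Qed.

Lemma act_expr_submod (U : set M) E v : is_submod U -> U v -> U (act_expr E v).
Proof.
move=> HU Uv; apply: submod_sum => // x _.
by apply: submodZ => //; exact: act_word_submod.
Qed.

Lemma act_word_linear w : linear (act_word w).
Proof. by elim: w => // o w IH c u v; rewrite /= IH linearP. Qed.

Lemma act_expr_linear E : linear (act_expr E).
Proof.
move=> c u v; rewrite /act_expr scaler_sumr -big_split; apply: eq_bigr => x _ /=.
by rewrite act_word_linear scalerDr !scalerA mulrC.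
Qed.

Hypothesis DM : D_module M.
Local Notation x a := (act (X (trz a))).

Lemma xx0 a v : x a (x a v) = 0 :> M.
Proof. exact: (DM (rel_xx _ _)). Qed.

Let x_inj a b : a != b -> trz a != trz b.
Proof. by rewrite (can_eq trzK). Qed.

(** [x10] and [x12] remove every x_1 that is followed by x_0 or x_2, so that x_1 survives only as
    the last letter. What precedes it is an alternating word in 0 and 2 modulo 202 = 020; this
    leaves 6 * 2 = 12 normal words. *)
Lemma x10 (v : M) : x z1 (x z0 v) = - x z0 (x z2 v) - x z2 (x z1 v).
Proof.
have /= := DM (@rel_xxx _ _ (trz z0) (trz z2) (trz z1) v
  (@x_inj z0 z2 isT) (@x_inj z0 z1 isT) (@x_inj z2 z1 isT)).
by move=> /eqP; rewrite addrAC addrC addr_eq0 opprD => /eqP.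
Qed.

Lemma x12 (v : M) : x z1 (x z2 v) = - x z0 (x z1 v) - x z2 (x z0 v).
Proof.
have /= := DM (@rel_xxx _ _ (trz z0) (trz z1) (trz z2) v
  (@x_inj z0 z1 isT) (@x_inj z0 z2 isT) (@x_inj z1 z2 isT)).
by move=> /eqP; rewrite addrC addr_eq0 opprD => /eqP.
Qed.

Let xN a (v : M) : x a (- v) = - x a v. Proof. exact: linearN. Qed.
Let xB a (u v : M) : x a (u - v) = x a u - x a v. Proof. exact: linearB. Qed.
Let x0 a : x a (0 : M) = 0. Proof. exact: linear0. Qed.
Let xE := (xx0, xN, xB, x0, @oppr0 M, @addr0 M, @add0r M, @subr0 M, @sub0r M,
  @opprK M).

Lemma x101 (v : M) : x z1 (x z0 (x z1 v)) = - x z0 (x z2 (x z1 v)).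
Proof. by rewrite x10 !xE. Qed.

Lemma x102 (v : M) : x z1 (x z0 (x z2 v)) = x z2 (x z0 (x z1 v)).
Proof. by rewrite x10 x12 !xE. Qed.

Lemma x120 (v : M) : x z1 (x z2 (x z0 v)) = x z0 (x z2 (x z1 v)).
Proof. by rewrite x12 x10 !xE. Qed.

Lemma x121 (v : M) : x z1 (x z2 (x z1 v)) = - x z2 (x z0 (x z1 v)).
Proof. by rewrite x12 !xE. Qed.

(** The braid relation is a consequence of the cyclic ones: applying [x12] to x_2 v, where the left
    side vanishes, gives x_2 x_0 x_2 = - x_0 x_1 x_2, and [x12] with x_0^2 = 0 finishes. *)
Lemma x202 (v : M) : x z2 (x z0 (x z2 v)) = x z0 (x z2 (x z0 v)).
Proof.
have := x12 (x z2 v); rewrite !xE => /eqP; rewrite eq_sym subr_eq0 => /eqP <-.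
by rewrite x12 !xE.
Qed.

(** True for all words: outside its special cases [xmul] only prepends the letter. The case analysis
    goes deep enough to tell the special words apart. *)
Lemma x_mul a w (v : M) : foldr (fun b => x b) v (a :: w) =
  \sum_(y <- xmul a w) y.1%:~R *: foldr (fun b => x b) v y.2.
Proof.
have s1 c u : \sum_(y <- [:: (c : int, u : seq z3)])
    y.1%:~R *: foldr (fun b => x b) v y.2 = c%:~R *: foldr (fun b => x b) v u.
  by rewrite big_seq1.
case: a w => [] [|[] [|[] [|[] [|[] [|? ?]]]]] /=;
  rewrite ?s1 ?big_nil ?big_cons ?big_nil ?scale1r ?scaleN1r /= ?addr0 //.
all: rewrite ?xx0 //.
all: rewrite ?(x10, x12, x101, x102, x120, x121, x202) ?xE //.
by rewrite x202.
Qed.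

Section Monomials.
Variable m : z3 -> M.

Definition mon (p : idx) : M := foldr (fun a => x a) (m p.2) p.1.

Lemma vec_act s f : (forall p, act s (mon p) = vec mon (f p)) ->
  forall u, act s (vec mon u) = vec mon (sv_lin f u).
Proof.
move=> sf u; rewrite vec_lin linear_sum; apply: eq_bigr => y _ /=.
by rewrite actZ sf.
Qed.

Lemma mon_x a p : x a (mon p) = vec mon (xop a p).
Proof.
have /= -> := x_mul a p.1 (m p.2); rewrite /vec big_map.
by apply: eq_bigr.
Qed.

Lemma grx c a (v : M) : act (H (Gr (decode c))) (x a v)
  = (csgn c)%:~R *: x (code_conj c a) (act (H (Gr (decode c))) v).
Proof.
have -> : (csgn c)%:~R = sgn k (decode c).
  by rewrite /sgn odd_encode decodeK /csgn; case: c.1.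
rewrite -conj_trz; apply/eqP; rewrite -subr_eq0; apply/eqP.
exact: (DM (rel_grx _ _ _)).
Qed.

Let decodeM c d : decode (code_mul c d) = decode c ** decode d.
Proof. by apply: encode_inj; rewrite decodeK encodeM !decodeK. Qed.

Lemma dex c a (v : M) : act (H (De (decode c))) (x a v)
  = x a (act (H (De (decode (code_mul (true, a) c)))) v).
Proof.
rewrite decodeM -val_trz.
by apply/eqP; rewrite -subr_eq0; apply/eqP; exact: (DM (rel_dex _ _ _)).
Qed.

Lemma yx a (v : M) : act (Y (trz a)) (x a v) = - x a (act (Y (trz a)) v)
  + (v + act (H (Gr (decode (true, a))))
      (act (H (De (decode (true, a)))) v - act (H (De (decode (false, z0)))) v)).
Proof.
rewrite -val_trz; apply/eqP.
by rewrite addrC -subr_eq opprK -subr_eq0; apply/eqP; exact: (DM (rel_yx _ _)).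
Qed.

Lemma yxx a y (v : M) : a != y ->
  act (Y (trz y)) (x a v) = - x a (act (Y (trz (z3_third a y))) v)
  + act (H (Gr (decode (true, a)))) (act (H (De (decode (true, y)))) v
      - act (H (De (decode (code_mul (true, y) (true, a))))) v).
Proof.
move=> ay; rewrite decodeM -!val_trz; apply/eqP.
rewrite addrC -subr_eq opprK -subr_eq0; apply/eqP.
by apply: (DM (rel_yxx _ _ _ _)); rewrite (can_eq trzK); case: a y ay => [] [].
Qed.

(** The family [m] transforms like the kets of M(sigma,-) and is killed by the y's. The integer
    formulas follow from this and the relations of D alone; independence of the monomials is not
    involved. *)
Hypothesis mG : forall c b, act (H (Gr (decode c))) (m b)
  = (csgn c)%:~R *: m (code_conj c b).
Hypothesis mD : forall c b, act (H (De (decode c))) (m b)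
  = if (true, b) == c then m b else 0.
Hypothesis mY : forall y b, act (Y (trz y)) (m b) = 0.

Lemma mon_g c p : act (H (Gr (decode c))) (mon p) = vec mon (gop1 c p).
Proof.
case: p => w b; rewrite /gop1; elim: w => [|a w IH] /=.
  by rewrite mG vec_cons vec_nil addr0.
rewrite [mon _]/= grx vec_scale; congr (_ *: _).
by rewrite -/(mon (w, b)) IH; apply: vec_act => p; exact: mon_x.
Qed.

Lemma mon_d c p : act (H (De (decode c))) (mon p) = vec mon (dop c p).
Proof.
have -> : vec mon (dop c p) = if idx_deg p == c then mon p else 0.
  by rewrite /dop; case: eqP; rewrite ?vec1 ?vec_nil.
case: p => w b; elim: w c => [|a w IH] c /=; first exact: mD.
rewrite [mon _]/= dex -/(mon (w, b)) IH.
(* Left multiplication by a transposition is an involution. *)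
have -> : (idx_deg (w, b) == code_mul (true, a) c) = (idx_deg (a :: w, b) == c).
  rewrite /idx_deg /=; move: (foldr _ _ w) => d.
  by case: d c a => [[] []] [[] []] [].
by case: eqP => // _; rewrite linear0.
Qed.

Lemma mon_y y p : act (Y (trz y)) (mon p) = vec mon (yop y p.1 p.2).
Proof.
case: p => w b; rewrite /=; elim: w y => [|a w IH] y.
  by rewrite vec_nil mY.
rewrite [mon _]/= -/(mon (w, b)) [yop _ _ _]/=.
have hx z : x a (act (Y (trz z)) (mon (w, b))) =
    vec mon (sv_lin (xop a) (yop z w b)).
  by rewrite IH; apply: vec_act => p; exact: mon_x.
have hg c d : act (H (Gr (decode (true, a)))) (act (H (De (decode c))) (mon (w, b))
    - act (H (De (decode d))) (mon (w, b))) = vec mon (sv_lin (gop1 (true, a))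
      (dop c (w, b) ++ sv_scale (-1) (dop d (w, b)))).
  rewrite !mon_d -scaleN1r -[-1]/((-1)%:~R) -vec_scale -vec_cat.
  by apply: vec_act => p; exact: mon_g.
case: eqP => [<-|/eqP ay].
  by rewrite yx vec_cat vec_scale vec_cons scaleN1r scale1r hx hg.
by rewrite yxx// vec_cat vec_scale scaleN1r hx hg.
Qed.

Lemma mon_op o p : act (gen_of o) (mon p) = vec mon (op1 o p).
Proof.
by case: o => [c|c|a|y]; [exact: mon_g|exact: mon_d|exact: mon_x|exact: mon_y].
Qed.

Lemma vec_app o u : act (gen_of o) (vec mon u) = vec mon (app o u).
Proof. by apply: vec_act => p; exact: mon_op. Qed.

Lemma vec_word w u : act_word w (vec mon u) = vec mon (appw w u).
Proof. by elim: w => //= o w ->; exact: vec_app. Qed.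

Lemma vec_expr E u : act_expr E (vec mon u) = vec mon (appe E u).
Proof.
elim: E => [|[c w] E IH]; rewrite /act_expr ?big_nil ?vec_nil// big_cons.
by rewrite -/(act_expr E _) IH vec_word vec_cat vec_scale.
Qed.

End Monomials.

(** The Fomin-Kirillov algebra has top degree 4: all 3^5 words of length 5 reduce to 0. The family
    [m] is constant because only the left factor of the monomials matters here. *)
Lemma x_nilpotent (w : seq z3) (v : M) : size w = 5 ->
  foldr (fun a => x a) v w = 0.
Proof.
move=> w5; pose m (_ : z3) := v.
have -> : foldr (fun a => x a) v w =
    vec (mon m) (foldr (fun a => sv_lin (xop a)) [:: (1, ([::], z0))] w).
  elim: {w5} w => [|a w IH] /=; first by rewrite vec1.
  by rewrite IH; apply: vec_act => p; exact: mon_x.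
apply: vec_zero.
case: w w5 => [|a [|b [|c [|d [|e []]]]]] // _.
have /allP/(_ _ (mem_z3 a))/allP/(_ _ (mem_z3 b))/allP/(_ _ (mem_z3 c))
  /allP/(_ _ (mem_z3 d))/allP/(_ _ (mem_z3 e)) // :
  all (fun a => all (fun b => all (fun c => all (fun d => all (fun e =>
    sv_zero (foldr (fun a => sv_lin (xop a)) [:: (1, ([::], z0))]
      [:: a; b; c; d; e])) z3_all) z3_all) z3_all) z3_all) z3_all.
by vm_compute.
Qed.

End Semantics.

(** * Maximal submodules of Verma modules *)

Section UniqueMaximal.
Variable k : fieldType.

Inductive xspan (M : rep k gen) : set M :=
| xspan0 : xspan 0
| xspanD a u v : xspan v -> xspan (act (X a) u + v).

Lemma xspan_add (M : rep k gen) (u v : M) : xspan u -> xspan v -> xspan (u + v).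
Proof.
elim=> [|a w w' _ IH] xv; first by rewrite add0r.
by rewrite -addrA; apply: xspanD; exact: IH.
Qed.

Lemma xspan_x (M : rep k gen) a (v : M) : xspan (act (X a) v).
Proof. by rewrite -[act _ _]addr0; apply/xspanD/xspan0. Qed.

Lemma xspan_scale (M : rep k gen) c (v : M) : xspan v -> xspan (c *: v).
Proof.
elim=> [|a w w' _ IH]; first by rewrite scaler0; exact: xspan0.
by rewrite scalerDr -actZ; exact: xspanD.
Qed.

Lemma xspan_opp (M : rep k gen) (v : M) : xspan v -> xspan (- v).
Proof. by rewrite -scaleN1r; exact: xspan_scale. Qed.

Lemma xspan_H (M : rep k gen) s (v : M) : D_module M -> xspan v -> xspan (act (H s) v).
Proof.
move=> DM; elim=> [|a u w _ IH]; first by rewrite act0; exact: xspan0.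
rewrite actD; apply: xspan_add => //; case: s {IH} => [g|g].
  have /eqP := DM _ (rel_grx g a u); rewrite subr_eq0 => /eqP ->.
  by apply: xspan_scale; exact: xspan_x.
have /eqP := DM _ (rel_dex g a u); rewrite subr_eq0 => /eqP ->.
exact: xspan_x.
Qed.

(* The x's generate a nilpotent ideal of the nonpositive part of D. *)
Lemma nakayama (M : rep k gen) (U : set M) : D_module M -> is_submod U ->
  (forall v, exists u w, [/\ U u, xspan w & v = u + w]) -> U = setT.
Proof.
move=> DM HU UP; apply/seteqP; split=> // v _.
(* Downward induction on the length of [w]: x_w M lies in [U], trivially for length 5 by nilpotency,
   and the empty word gives the claim. *)
suff E n : forall w : seq z3, (size w + n)%N = 5%N ->
    forall v : M, U (foldr (fun a => act (X (trz a))) v w).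
  exact: (E 5 [::]).
elim: n => [|n IH] w wn {}v.
  by rewrite (x_nilpotent DM); [exact: (submod0 HU)|rewrite addn0 in wn].
have [u [p [Uu xp ->]]] := UP v.
have wD (b c : M) : foldr (fun a => act (X (trz a))) (b + c) w =
    foldr (fun a => act (X (trz a))) b w + foldr (fun a => act (X (trz a))) c w.
  by elim: (w) => //= a w' ->; rewrite actD.
rewrite wD; apply: submodD => //.
  by elim: (w) => //= a w' Uw'; exact: (submod_act _ HU).
elim: xp => [|a b c _ Uc].
  suff -> : foldr (fun a => act (X (trz a))) (0 : M) w = 0 by exact: submod0.
  by elim: (w) => //= a w' ->; rewrite act0.
rewrite wD; apply: submodD => //.
have := IH (rcons w (zcode a)); rewrite size_rcons addSnnS => /(_ wn b).
by rewrite foldr_rcons zcodeK.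
Qed.

Variable M0 : rep k ggen.
Local Notation V := (verma M0).

(** One half of the triangular decomposition: [verma_xgen] shows that this set is everything, i.e.
    that B(V) (x) M0 maps onto the Verma module. Scalars need no constructor, since [vemb] absorbs
    them. *)
Inductive xgen : set V :=
| xgen_emb m : xgen (vemb m)
| xgen_add u v : xgen u -> xgen v -> xgen (u + v)
| xgen_x a u : xgen u -> xgen (act (X a) u).

Lemma vembD u v : @vemb k M0 (u + v) = vemb u + vemb v.
Proof. by have := @vemb_linear k M0 1 u v; rewrite !scale1r. Qed.

Lemma vemb0 : @vemb k M0 0 = 0.
Proof. by apply: (addrI (vemb 0)); rewrite -vembD !addr0. Qed.

Lemma vembZ c u : @vemb k M0 (c *: u) = c *: vemb u.
Proof. by have := @vemb_linear k M0 c u 0; rewrite vemb0 !addr0. Qed.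

Lemma xgen_scale c (v : V) : xgen v -> xgen (c *: v).
Proof.
elim=> [m|u w _ Hu _ Hw|a u _ Hu]; first by rewrite -vembZ; exact: xgen_emb.
  by rewrite scalerDr; exact: xgen_add.
by rewrite -actZ; exact: xgen_x.
Qed.

Lemma xgen_H s (v : V) : xgen v -> xgen (act (H s) v).
Proof.
have DV := @verma_D_module k M0.
move=> xv; elim: xv s => [m|u w _ Hu _ Hw|a u _ Hu] s.
- by rewrite -vembH; exact: xgen_emb.
- by rewrite actD; exact: xgen_add.
case: s => g.
  have /eqP := DV _ (rel_grx g a u); rewrite subr_eq0 => /eqP ->.
  exact/xgen_scale/xgen_x.
have /eqP := DV _ (rel_dex g a u); rewrite subr_eq0 => /eqP ->.
exact: xgen_x.
Qed.

Lemma xgen_Y y (v : V) : xgen v -> xgen (act (Y y) v).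
Proof.
have DV := @verma_D_module k M0.
have xN u : xgen u -> xgen (- u) by rewrite -scaleN1r; exact: xgen_scale.
move=> xv; elim: xv y => [m|u w _ Hu _ Hw|a u xu Hu] y.
- by rewrite vembY -vemb0; exact: xgen_emb.
- by rewrite actD; exact: xgen_add.
rewrite -(zcodeK y) -(zcodeK a); have [<-|ay] := eqVneq (zcode a) (zcode y).
  rewrite yx//; apply: xgen_add; first exact/xN/xgen_x/Hu.
  by apply: xgen_add => //; apply/xgen_H/xgen_add; [|apply: xN]; exact: xgen_H.
rewrite yxx//; apply: xgen_add; first exact/xN/xgen_x/Hu.
by apply/xgen_H/xgen_add; [|apply: xN]; exact: xgen_H.
Qed.

Lemma verma_xgen (v : V) : xgen v.
Proof.
apply: verma_ind => [|m]; last exact: xgen_emb.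
split=> [|c u w Hu Hw|[s|a|a] u Hu].
- by rewrite -vemb0; exact: xgen_emb.
- by apply: xgen_add => //; exact: xgen_scale.
- exact: xgen_H.
- exact: xgen_x.
- exact: xgen_Y.
Qed.

Lemma verma_decomp (v : V) : exists m w, xspan w /\ v = vemb m + w.
Proof.
elim: (verma_xgen v) => [m|_ _ _ [m [w [xw ->]]] _ [n [z [xz ->]]]|a u _ _].
- by exists m, 0; rewrite addr0; split=> //; exact: xspan0.
- exists (m + n), (w + z); rewrite vembD addrACA; split=> //.
  exact: xspan_add.
- by exists 0, (act (X a) u); rewrite vemb0 add0r; split=> //; exact: xspan_x.
Qed.

Hypothesis M0_simple : simple M0.

(** The components in [M0] of elements of [U], modulo the images of the x's, form a D(S_3)-submodule
    [T] of the simple module [M0]. If T = 0 then [U] consists of images of the x's; if T = M0 then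
    Nakayama gives U = V. *)
Lemma proper_xspan (U : set V) : is_submod U -> U <> setT -> U `<=` @xspan V.
Proof.
have DV := @verma_D_module k M0.
move=> HU; apply: contra_notP => /existsNP[u /not_implyP[Uu xu]].
pose T := [set m : M0 | exists u w, [/\ U u, xspan w & vemb m = u + w]].
have HT : is_submod T.
  split=> [|c a b [v [w [Uv xw va]]] [v' [w' [Uv' xw' vb]]]|s a [v [w [Uv xw va]]]].
  - by exists 0, 0; rewrite addr0 vemb0; split=> //; [exact: submod0|exact: xspan0].
  - exists (c *: v + v'), (c *: w + w'); split.
    + by apply: submodD => //; exact: submodZ.
    + by apply: xspan_add => //; exact: xspan_scale.
    + by rewrite vembD vembZ va vb scalerDr addrACA.
  - exists (act (H s) v), (act (H s) w); rewrite vembH va actD; split=> //.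
      exact: submod_act.
    exact: xspan_H.
have [_ /(_ T HT)[T0|TT]] := M0_simple.
  case: xu; have [m [w [xw um]]] := verma_decomp u.
  suff -> : u = w by [].
  suff m0 : T m by rewrite T0 in m0; rewrite um m0 vemb0 add0r.
  exists u, (- w); split=> //; first exact: xspan_opp.
  by rewrite um addrK.
apply: nakayama => // v; have [m [w [xw ->]]] := verma_decomp v.
have [a [b [Ua xb ->]]] : T m by rewrite TT.
by exists a, (b + w); rewrite addrA; split=> //; exact: xspan_add.
Qed.

(** The universal property yields a map [F] onto [L]. As the head is the quotient by the
    intersection of all maximal submodules, it remains to see that the kernel [K] is the only
    one. *)
Lemma head_iso (L : rep k gen) (phi : M0 -> L) :
  D_module L -> simple L -> linear phi ->
  (forall s m, phi (act s m) = act (H s) (phi m)) ->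
  (forall a m, act (Y a) (phi m) = 0) ->
  (exists m, phi m <> 0) -> rep_iso L (simple_head M0).
Proof.
move=> DL [_ L_simple] phil phiH phiY [m phim].
have [F [[Fh Fm] _]] := verma_universal DL phil phiH phiY.
pose K : set V := [set v | F v = 0].
have HK : is_submod K by exact: ker_submod.
have KT : K <> setT by move=> KT; apply: phim; rewrite -Fm; have : K (vemb m) by rewrite KT.
have KW (W : set V) : is_submod W -> K `<=` W -> W = setT \/ W = K.
  move=> HW KW; have [W0|WT] := L_simple _ (image_submod Fh HW).
    right; apply/seteqP; split=> // w Ww.
    by rewrite -[K w]/([set 0] (F w)) -W0; exists w.
  left; apply/seteqP; split=> // v _.
  have [w Ww Fwv] : (F @` W) (F v) by rewrite WT.
  rewrite -(subrK w v); apply: (submodD HW) => //; apply: KW.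
  by rewrite /K /= (homB _ _ Fh) Fwv subrr.
have Fs n : exists v, F v = n.
  have [W0|WT] := L_simple _ (image_submod Fh (@setT_submod _ _ V)).
    have : (F @` setT) (phi m) by exists (vemb m).
    by rewrite W0 => /phim.
  have [v _ <-] : (F @` setT) n by rewrite WT.
  by exists v.
(* Otherwise Nakayama applied to the zero submodule would make the Verma module zero, and [K] all of
   it. *)
have xT : @xspan V <> setT.
  move=> xT; apply: KT; apply/seteqP; split=> // v _.
  have T0 : [set 0] = setT :> set V.
    apply: (nakayama (@verma_D_module k M0) (@zero_submod _ _ V)) => u.
    by exists 0, u; rewrite add0r xT.
  have -> : v = 0 by have : [set 0] v by rewrite T0.
  exact: (submod0 HK).
have Kmax : maximal_submod K.
  by split=> // W HW WT /(KW _ HW)[/WT|].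
(* Two proper submodules both lie in [xspan], so their sum is still proper. *)
have uniq_max (W : set V) : maximal_submod W -> W = K.
  move=> [HW WT Wmax].
  have WK : add_set W K <> setT.
    move=> E; apply: xT; apply/seteqP; split=> // v _.
    have [w [z [Ww Kz ->]]] : add_set W K v by rewrite E.
    by apply: xspan_add; [exact: (proper_xspan HW)|exact: (proper_xspan HK)].
  have HWK := add_set_submod HW HK.
  have E := Wmax _ HWK WK (add_setl HK).
  by have [//|E'] := KW _ HWK (add_setr HW); exact: etrans (esym E) E'.
apply/rep_iso_sym/(quo_iso Fh Fs) => v; split=> [Rv|Fv W /uniq_max -> //].
exact: (Rv K Kmax).
Qed.

(** The y's need to kill the weight only modulo [U], so a weight that is lowest in the subquotient
    alone suffices. *)
Lemma subquo_head (M : rep k gen) (U W : submod M) (phi : M0 -> M) :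
  D_module M -> simple (subquo U W) -> linear phi ->
  (forall s m, phi (act s m) = act (H s) (phi m)) ->
  (forall m, sset W (phi m)) -> (forall a m, sset U (act (Y a) (phi m))) ->
  (exists m, ~ sset U (phi m)) -> rep_iso (subquo U W) (simple_head M0).
Proof.
move=> DM UW phil phiH phiW phiY [m phim].
have qh := quo_hom (Submod (meet_submod U W)).
have Wphi a : phi a \in smem W by exact/asboolP.
pose f a : subquo U W := qpi _ (exist _ (phi a) (Wphi a) : subrep W).
apply: (head_iso (phi := f)) => //.
- exact/quo_D_module/sub_D_module.
- move=> c a b; rewrite /f -(homZ _ _ qh) -(homD _ _ qh); congr qpi.
  exact/val_inj/phil.
- by move=> s a; rewrite /f -(hom_act _ _ qh); congr qpi; exact/val_inj/phiH.
- move=> a b; rewrite /f -(hom_act _ _ qh) -(hom0 qh); apply/qpi_eq.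
  by rewrite subr0; exact: phiY.
- by exists m => E; apply: phim; move: E; rewrite -(hom0 qh) => /qpi_eq; rewrite subr0.
Qed.

End UniqueMaximal.

(** * A model of the Verma module of M(sigma,-) *)

Definition all_ops : seq op :=
  [seq OpG c | c <- codes] ++ [seq OpD c | c <- codes] ++
  [seq OpX a | a <- z3_all] ++ [seq OpY a | a <- z3_all].

Lemma all_opsP (P : pred op) : all P all_ops -> forall o, P o.
Proof.
rewrite !all_cat !all_map => /and4P[/allP PG /allP PD /allP PX /allP PY].
by move=> [c|c|a|a]; [exact/PG/mem_codes|exact/PD/mem_codes|exact/PX/mem_z3|
  exact/PY/mem_z3].
Qed.

Definition words : seq (seq z3) :=
  [:: [::]; [:: z0]; [:: z1]; [:: z2]; [:: z0; z1]; [:: z0; z2]; [:: z2; z0];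
      [:: z2; z1]; [:: z2; z0; z1]; [:: z0; z2; z1]; [:: z0; z2; z0];
      [:: z0; z2; z0; z1]].
Definition bas : seq idx := [seq (w, b) | w <- words, b <- z3_all].

Definition supported (u : svec) : bool := all (fun x => x.2 \in bas) u.

Lemma op1_supported o p : p \in bas -> supported (op1 o p).
Proof.
have check : all (fun o => all (fun p => supported (op1 o p)) bas) all_ops.
  by vm_compute.
exact: (allP (all_opsP check o)).
Qed.

Lemma app_supported o u : supported u -> supported (app o u).
Proof.
move=> /allP us; apply/allP => x /flattenP[_ /mapP[y yu ->] /mapP[z zo ->]] /=.
by have /allP/(_ _ zo) := op1_supported o (us y yu).
Qed.

Lemma appw_supported w u : supported u -> supported (appw w u).
Proof. by move=> us; elim: w => //= o w; exact: app_supported. Qed.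

Lemma supported1 p : p \in bas -> supported [:: (1, p)].
Proof. by move=> pb; rewrite /supported /= pb. Qed.

Definition bas_at (i : 'I_36) : idx := nth ([::], z0) bas i.

Lemma bas_at_inj : injective bas_at.
Proof. by move=> i j /eqP; rewrite nth_uniq// => /eqP/val_inj. Qed.

Lemma bas_atP p : p \in bas -> exists i, p = bas_at i.
Proof.
move=> pb; have lt_p : (index p bas < 36)%N by rewrite index_mem.
by exists (Ordinal lt_p); rewrite /bas_at nth_index.
Qed.

Lemma mem_bas_at i : bas_at i \in bas.
Proof. exact: mem_nth. Qed.

Section Model.
Variable k : fieldType.

(* A concrete D-module in which the 36 monomials are linearly independent: the
   universal property of the Verma module maps it here. *)
Definition fock : Type := {ffun 'I_36 -> k^o}.
HB.instance Definition _ := GRing.Lmodule.on fock.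

Definition fket (p : idx) : fock := [ffun i => (bas_at i == p)%:R].

Definition fock_act (s : gen) (v : fock) : fock :=
  \sum_i (v i : k) *: vec fket (op1 (op_of s) (bas_at i)).

Lemma fock_act_linear s : linear (fock_act s).
Proof.
move=> c u v; rewrite /fock_act scaler_sumr -big_split; apply: eq_bigr => i _ /=.
by rewrite !ffunE scalerDl scalerA.
Qed.

Definition fock_rep : rep k gen := Rep fock_act_linear.

Lemma fock_act1 o p : p \in bas ->
  act (gen_of o) (fket p : fock_rep) = vec fket (op1 o p).
Proof.
move=> /bas_atP[i ->]; rewrite /act /= /fock_act (bigD1 i)//= big1 => [|j ji].
  by rewrite ffunE eqxx scale1r addr0 gen_ofK.
by rewrite ffunE (inj_eq bas_at_inj) (negPf ji) scale0r.
Qed.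

Lemma fock_app o u : supported u ->
  act (gen_of o) (vec fket u : fock_rep) = vec fket (app o u).
Proof.
move=> /allP us; rewrite /app vec_lin act_sum big_seq [RHS]big_seq.
by apply: eq_bigr => x xu; rewrite actZ fock_act1//; exact: us.
Qed.

Lemma fock_word w u : supported u ->
  act_word w (vec fket u : fock_rep) = vec fket (appw w u).
Proof.
move=> us; elim: w => //= o w ->; apply: fock_app; exact: appw_supported.
Qed.

Lemma fock_expr E u : supported u ->
  act_expr E (vec fket u : fock_rep) = vec fket (appe E u).
Proof.
move=> us; elim: E => [|[c w] E IH]; rewrite /act_expr ?big_nil ?vec_nil//.
by rewrite big_cons -/(act_expr E _) IH fock_word// vec_cat vec_scale.
Qed.

Lemma fock_expand (v : fock_rep) :
  v = \sum_i ((v : {ffun 'I_36 -> k^o}) i : k) *: fket (bas_at i).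
Proof.
apply/ffunP => j; rewrite sum_ffunE (bigD1 j)//= big1 => [|i ij].
  by rewrite !ffunE eqxx addr0 [RHS]mulr1.
by rewrite !ffunE (inj_eq bas_at_inj) eq_sym (negPf ij) [LHS]mulr0.
Qed.

(** The 36 monomials span the model, so these values decide whether [E] acts by 0. *)
Definition valid (E : expr) : bool :=
  all (fun p => sv_zero (appe E [:: (1, p)])) bas.

Lemma fock_valid E (v : fock_rep) : valid E -> act_expr E v = 0.
Proof.
move=> /allP E0; rewrite [v]fock_expand.
have El := act_expr_linear (M := fock_rep) E.
have F0 : act_expr E (0 : fock_rep) = 0.
  by have := El (-1) 0 0; rewrite scaler0 addr0 scaleN1r => {1}->; rewrite addNr.
have FD (a b : fock_rep) : act_expr E (a + b) = act_expr E a + act_expr E b.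
  by have := El 1 a b; rewrite !scale1r.
rewrite (big_morph _ FD F0) big1// => i _.
have := El ((v : {ffun 'I_36 -> k^o}) i) (fket (bas_at i)) 0.
rewrite F0 !addr0 => ->.
have pb := mem_bas_at i.
rewrite -(vec1 fket) fock_expr ?supported1// vec_zero ?scaler0//; exact: E0.
Qed.
End Model.

(** * The defining relations of D, checked on the model *)

Definition rel_gr1_expr : expr := [:: (1, [:: OpG (false, z0)]); (-1, [::])].
Definition rel_grM_expr c d : expr :=
  [:: (1, [:: OpG c; OpG d]); (-1, [:: OpG (code_mul c d)])].
Definition rel_deM_expr c d : expr :=
  (1, [:: OpD c; OpD d]) :: if c == d then [:: (-1, [:: OpD c])] else [::].
Definition rel_de1_expr : expr :=
  (-1, [::]) :: [seq (1, [:: OpD c]) | c <- codes].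
Definition rel_degr_expr c d : expr :=
  [:: (1, [:: OpD d; OpG c]);
      (-1, [:: OpG c; OpD (code_mul (code_mul (code_inv c) d) c)])].
Definition rel_sqr_expr (o : z3 -> op) a : expr := [:: (1, [:: o a; o a])].
Definition rel_cyc_expr (o : z3 -> op) a b : expr :=
  let c := z3_third a b in
  [:: (1, [:: o a; o b]); (1, [:: o c; o a]); (1, [:: o b; o c])].
Definition rel_grx_expr c a : expr :=
  [:: (1, [:: OpG c; OpX a]); (- csgn c, [:: OpX (code_conj c a); OpG c])].
Definition rel_de_expr (o : z3 -> op) d a : expr :=
  [:: (1, [:: OpD d; o a]); (-1, [:: o a; OpD (code_mul (true, a) d)])].
Definition rel_ygr_expr c a : expr :=
  [:: (1, [:: OpY a; OpG c]);
      (- csgn c, [:: OpG c; OpY (code_conj (code_inv c) a)])].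
Definition rel_yx_expr a : expr :=
  [:: (1, [:: OpY a; OpX a]); (1, [:: OpX a; OpY a]); (-1, [::]);
      (-1, [:: OpG (true, a); OpD (true, a)]);
      (1, [:: OpG (true, a); OpD (false, z0)])].
Definition rel_yxx_expr a b : expr :=
  [:: (1, [:: OpY b; OpX a]); (1, [:: OpX a; OpY (z3_third a b)]);
      (-1, [:: OpG (true, a); OpD (true, b)]);
      (1, [:: OpG (true, a); OpD (code_mul (true, b) (true, a))])].

Definition all2_codes (P : code -> code -> bool) : bool :=
  all (fun c => all (P c) codes) codes.
Definition all_code_z3 (P : code -> z3 -> bool) : bool :=
  all (fun c => all (P c) z3_all) codes.
Definition all2_z3 (P : z3 -> z3 -> bool) : bool :=
  all (fun a => all (P a) z3_all) z3_all.

Lemma all2_codesP P : all2_codes P -> forall c d, P c d.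
Proof. by move=> /allP H c d; have /allP := H c (mem_codes c); apply; exact: mem_codes. Qed.

Lemma all_code_z3P P : all_code_z3 P -> forall c a, P c a.
Proof. by move=> /allP H c d; have /allP := H c (mem_codes c); apply; exact: mem_z3. Qed.

Lemma all2_z3P P : all2_z3 P -> forall a b, P a b.
Proof. by move=> /allP H c d; have /allP := H c (mem_z3 c); apply; exact: mem_z3. Qed.

Lemma gr1_valid : valid rel_gr1_expr.
Proof. by vm_compute. Qed.

Lemma grM_valid c d : valid (rel_grM_expr c d).
Proof. by move: c d; apply: all2_codesP; vm_compute. Qed.

Lemma deM_valid c d : valid (rel_deM_expr c d).
Proof. by move: c d; apply: all2_codesP; vm_compute. Qed.

Lemma de1_valid : valid rel_de1_expr.
Proof. by vm_compute. Qed.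

Lemma degr_valid c d : valid (rel_degr_expr c d).
Proof. by move: c d; apply: all2_codesP; vm_compute. Qed.

Lemma sqr_valid a : valid (rel_sqr_expr OpX a) && valid (rel_sqr_expr OpY a).
Proof. by case: a; vm_compute. Qed.

Lemma cyc_valid a b : (a != b) ==>
  valid (rel_cyc_expr OpX a b) && valid (rel_cyc_expr OpY a b).
Proof. by move: a b; apply: all2_z3P; vm_compute. Qed.

Lemma grx_valid c a : valid (rel_grx_expr c a).
Proof. by move: c a; apply: all_code_z3P; vm_compute. Qed.

Lemma de_valid c a : valid (rel_de_expr OpX c a) && valid (rel_de_expr OpY c a).
Proof. by move: c a; apply: all_code_z3P; vm_compute. Qed.

Lemma ygr_valid c a : valid (rel_ygr_expr c a).
Proof. by move: c a; apply: all_code_z3P; vm_compute. Qed.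

Lemma yx_valid a : valid (rel_yx_expr a).
Proof. by case: a; vm_compute. Qed.

Lemma yxx_valid a b : (a != b) ==> valid (rel_yxx_expr a b).
Proof. by move: a b; apply: all2_z3P; vm_compute. Qed.

Lemma sgn_encode (k : fieldType) g : sgn k g = (csgn (encode g))%:~R.
Proof. by rewrite /sgn odd_encode /csgn; case: (encode g).1. Qed.

Lemma sum_S3 (V : zmodType) (f : 'S_3 -> V) :
  \sum_g f g = \sum_(c <- codes) f (decode c).
Proof.
rewrite -(big_map decode xpredT); apply: perm_big; apply: uniq_perm.
- exact: index_enum_uniq.
- by rewrite map_inj_uniq//; exact: can_inj decodeK.
- move=> g; rewrite mem_index_enum; apply/esym/mapP.
  by exists (encode g); rewrite ?mem_codes ?encodeK.
Qed.

Lemma zcode_third (a b c : transp) : a != b -> a != c -> b != c ->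
  c = trz (z3_third (zcode a) (zcode b)).
Proof.
rewrite -!(can_eq zcodeK) => ab ac bc; apply: (can_inj zcodeK); rewrite trzK.
by case: (zcode a) (zcode b) (zcode c) ab ac bc => [] [] [].
Qed.

Section ModelRelations.
Variable k : fieldType.
Local Notation F := (fock_rep k).
Implicit Types v : F.

Lemma act_expr_nil v : act_expr [::] v = 0.
Proof. exact: big_nil. Qed.

Lemma act_expr_cons c w E v :
  act_expr ((c, w) :: E) v = c%:~R *: act_word w v + act_expr E v.
Proof. exact: big_cons. Qed.

(** Every relation is the vanishing of a valid expression; the rules [exprE] turn its coded
    generators back into those of [D_rel]. *)
Lemma fock_D_module : D_module F.
Proof.
have exprE := (act_expr_cons, act_expr_nil, @addr0 F, @scale1r _ F, @scaleN1r _ F).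
have GE g : gen_of (OpG (encode g)) = H (Gr g) by rewrite /= encodeK.
have DE g : gen_of (OpD (encode g)) = H (De g) by rewrite /= encodeK.
have XE a : gen_of (OpX (zcode a)) = X a by rewrite /= zcodeK.
have YE a : gen_of (OpY (zcode a)) = Y a by rewrite /= zcodeK.
have wE o w v : act_word (o :: w) v = act (gen_of o) (act_word w v) by [].
have w0 v : act_word [::] v = v by [].
have {}exprE := (exprE, wE, w0, GE, DE, XE, YE).
have third a b c : a != b -> a != c -> b != c ->
    z3_third (zcode a) (zcode b) = zcode c.
  by move=> ab ac bc; rewrite (zcode_third ab ac bc) trzK.
have neq a b : a != b -> zcode a != zcode b by rewrite (can_eq zcodeK).
move=> _ [_ [v|g h v|g h v|v|g h v]|a v|a b c v ab ac bc|a v|a b c v ab ac bc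
  |g a v|g a v|g a v|g a v|a v|a b c v ab ac bc]; red.
- have := fock_valid v gr1_valid.
  by rewrite /rel_gr1_expr -encode1 !exprE.
- have := fock_valid v (grM_valid (encode g) (encode h)).
  by rewrite /rel_grM_expr -encodeM !exprE.
- have := fock_valid v (deM_valid (encode g) (encode h)).
  rewrite /rel_deM_expr (inj_eq encode_inj).
  by case: (g == h); rewrite !exprE // subr0.
- have := fock_valid v de1_valid.
  rewrite /rel_de1_expr act_expr_cons scaleN1r w0 addrC sum_S3 /act_expr big_map.
  by under eq_bigr do rewrite scale1r.
- have := fock_valid v (degr_valid (encode g) (encode h)).
  by rewrite /rel_degr_expr -encodeV -!encodeM !exprE.
- have /andP[/(fock_valid v)] := sqr_valid (zcode a).
  by rewrite /rel_sqr_expr !exprE.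
- have /implyP/(_ (neq _ _ ab))/andP[/(fock_valid v)] := cyc_valid (zcode a) (zcode b).
  by rewrite /rel_cyc_expr (third a b c)// !exprE addrA.
- have /andP[_ /(fock_valid v)] := sqr_valid (zcode a).
  by rewrite /rel_sqr_expr !exprE.
- have /implyP/(_ (neq _ _ ab))/andP[_ /(fock_valid v)] := cyc_valid (zcode a) (zcode b).
  by rewrite /rel_cyc_expr (third a b c)// !exprE addrA.
- have := fock_valid v (grx_valid (encode g) (zcode a)).
  by rewrite /rel_grx_expr -zcode_conj !exprE intrN scaleNr -sgn_encode.
- have /andP[/(fock_valid v) + _] := de_valid (encode g) (zcode a).
  by rewrite /rel_de_expr -encode_transp -encodeM !exprE.
- have /andP[_ /(fock_valid v)] := de_valid (encode g) (zcode a).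
  by rewrite /rel_de_expr -encode_transp -encodeM !exprE.
- have := fock_valid v (ygr_valid (encode g) (zcode a)).
  by rewrite /rel_ygr_expr -encodeV -zcode_conj !exprE intrN scaleNr -sgn_encode.
- have := fock_valid v (yx_valid (zcode a)).
  rewrite /rel_yx_expr -encode1 -encode_transp !exprE => E.
  by apply: etrans E; rewrite actD actN !opprD !opprK -!addrA.
- have /implyP/(_ (neq _ _ ab))/(fock_valid v) := yxx_valid (zcode a) (zcode b).
  rewrite /rel_yxx_expr (third a b c)// -!encode_transp -encodeM !exprE => E.
  by apply: etrans E; rewrite actD actN !opprD !opprK -!addrA.
Qed.
End ModelRelations.

(** * Coordinates on the Verma module of M(sigma,-) *)

(* A basis of M(sigma,-) refining its submodule lattice: entries 0-9 span the
   socle, 10-16 span OPU and 17-23 span VQN modulo the socle, 24 and 25 are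
   |e>^1 and |e>^3, and 26-35 span a complement of the radical. *)
Definition adapted : seq svec := [::
  [:: (1, ([:: z0; z1], z1)); (1, ([:: z0; z2], z2))];
  [:: (1, ([:: z0; z1], z2)); (1, ([:: z0; z2], z0)); (1, ([:: z2; z0], z2)); (1, ([:: z2; z1], z0))];
  [:: (1, ([:: z2; z0], z0)); (1, ([:: z2; z1], z1))];
  [:: (1, ([:: z2; z0; z1], z1)); (1, ([:: z0; z2; z0], z2))];
  [:: (1, ([:: z0; z2; z1], z0)); (1, ([:: z0; z2; z0], z2))];
  [:: (1, ([:: z2; z0; z1], z2)); (1, ([:: z0; z2; z0], z0))];
  [:: (1, ([:: z0; z2; z1], z1)); (1, ([:: z0; z2; z0], z0))];
  [:: (1, ([:: z0; z2; z0; z1], z0))];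
  [:: (1, ([:: z0; z2; z0; z1], z1))];
  [:: (1, ([:: z0; z2; z0; z1], z2))];
  [:: (1, ([:: z2], z0)); (1, ([:: z0], z1)); (1, ([:: z1], z2))];
  [:: (1, ([:: z1], z0)); (1, ([:: z2], z1)); (1, ([:: z0], z2))];
  [:: (1, ([:: z2; z0], z1)); (1, ([:: z2; z1], z2))];
  [:: (1, ([:: z2; z0], z2)); (1, ([:: z2; z1], z0))];
  [:: (1, ([:: z0; z1], z0)); (1, ([:: z0; z2], z1))];
  [:: (1, ([:: z0; z2; z0], z1)); (1, ([:: z2; z0; z1], z0))];
  [:: (1, ([:: z0; z2; z0], z1)); (1, ([:: z0; z2; z1], z2))];
  [:: (1, ([:: z1], z1)); ((-1), ([:: z0], z0))];
  [:: (1, ([:: z1], z1)); ((-1), ([:: z2], z2))];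
  [:: (1, ([:: z0; z1], z1))];
  [:: (1, ([:: z0; z1], z2)); (1, ([:: z2; z0], z2))];
  [:: (1, ([:: z2; z0], z0))];
  [:: (1, ([:: z0; z2; z0], z2))];
  [:: (1, ([:: z0; z2; z0], z0))];
  [:: (1, ([:: z0], z0)); (1, ([:: z1], z1)); (1, ([:: z2], z2))];
  [:: (1, ([:: z2; z0; z1], z0)); ((-1), ([:: z0; z2; z0], z1)); (1, ([:: z0; z2; z1], z2))];
  [:: (1, ([::], z0))];
  [:: (1, ([::], z1))];
  [:: (1, ([::], z2))];
  [:: (1, ([:: z0], z1))];
  [:: (1, ([:: z1], z2))];
  [:: (1, ([:: z0], z2))];
  [:: (1, ([:: z1], z0))];
  [:: (1, ([:: z2; z0], z1))];
  [:: (1, ([:: z2; z0], z2))];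
  [:: (1, ([:: z0; z1], z0))]].

(* Three times the dual basis of [adapted]; the factor 3 clears the denominators
   that come from splitting off the S_3-invariants in degree e. *)
Definition coadapted : seq svec := [::
  [:: (3, ([:: z0; z2], z2))];
  [:: (3, ([:: z0; z2], z0))];
  [:: (3, ([:: z2; z1], z1))];
  [:: (3, ([:: z2; z0; z1], z1))];
  [:: (3, ([:: z0; z2; z1], z0))];
  [:: (3, ([:: z2; z0; z1], z2))];
  [:: (3, ([:: z0; z2; z1], z1))];
  [:: (3, ([:: z0; z2; z0; z1], z0))];
  [:: (3, ([:: z0; z2; z0; z1], z1))];
  [:: (3, ([:: z0; z2; z0; z1], z2))];
  [:: (3, ([:: z2], z0))];
  [:: (3, ([:: z2], z1))];
  [:: (3, ([:: z2; z1], z2))];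
  [:: ((-3), ([:: z0; z2], z0)); (3, ([:: z2; z1], z0))];
  [:: (3, ([:: z0; z2], z1))];
  [:: (2, ([:: z2; z0; z1], z0)); ((-1), ([:: z0; z2; z1], z2)); (1, ([:: z0; z2; z0], z1))];
  [:: ((-1), ([:: z2; z0; z1], z0)); (2, ([:: z0; z2; z1], z2)); (1, ([:: z0; z2; z0], z1))];
  [:: ((-2), ([:: z0], z0)); (1, ([:: z1], z1)); (1, ([:: z2], z2))];
  [:: (1, ([:: z0], z0)); (1, ([:: z1], z1)); ((-2), ([:: z2], z2))];
  [:: (3, ([:: z0; z1], z1)); ((-3), ([:: z0; z2], z2))];
  [:: (3, ([:: z0; z1], z2)); ((-3), ([:: z0; z2], z0))];
  [:: (3, ([:: z2; z0], z0)); ((-3), ([:: z2; z1], z1))];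
  [:: ((-3), ([:: z2; z0; z1], z1)); ((-3), ([:: z0; z2; z1], z0)); (3, ([:: z0; z2; z0], z2))];
  [:: ((-3), ([:: z2; z0; z1], z2)); ((-3), ([:: z0; z2; z1], z1)); (3, ([:: z0; z2; z0], z0))];
  [:: (1, ([:: z0], z0)); (1, ([:: z1], z1)); (1, ([:: z2], z2))];
  [:: (1, ([:: z2; z0; z1], z0)); (1, ([:: z0; z2; z1], z2)); ((-1), ([:: z0; z2; z0], z1))];
  [:: (3, ([::], z0))];
  [:: (3, ([::], z1))];
  [:: (3, ([::], z2))];
  [:: (3, ([:: z0], z1)); ((-3), ([:: z2], z0))];
  [:: (3, ([:: z1], z2)); ((-3), ([:: z2], z0))];
  [:: (3, ([:: z0], z2)); ((-3), ([:: z2], z1))];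
  [:: (3, ([:: z1], z0)); ((-3), ([:: z2], z1))];
  [:: (3, ([:: z2; z0], z1)); ((-3), ([:: z2; z1], z2))];
  [:: ((-3), ([:: z0; z1], z2)); (3, ([:: z0; z2], z0)); (3, ([:: z2; z0], z2)); ((-3), ([:: z2; z1], z0))];
  [:: (3, ([:: z0; z1], z0)); ((-3), ([:: z0; z2], z1))]].

Definition avec (j : nat) : svec := nth [::] adapted j.
Definition covec (j : nat) : svec := nth [::] coadapted j.

Definition pairing (L u : svec) : int :=
  foldr (fun x n => x.1 * coef L x.2 + n) 0 u.

Lemma pairing_adapted :
  all (fun i => all (fun j => pairing (covec i) (avec j) == (if i == j then 3 else 0))
    (iota 0 36)) (iota 0 36).
Proof. by vm_compute. Qed.

(** Three times a monomial is recovered from its pairings with [coadapted]. Together with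
    [pairing_adapted] this makes [adapted] a basis as soon as 3 is invertible. *)
Lemma adapted_expand :
  all (fun p => sv_zero (flatten [seq sv_scale (coef (covec j) p) (avec j) | j <- iota 0 36]
     ++ [:: (-3, p)])) bas.
Proof. by vm_compute. Qed.

Lemma adapted_supported : all supported adapted.
Proof. by vm_compute. Qed.

Lemma avec_supported j : supported (avec j).
Proof.
rewrite /avec; have [j36|j36] := ltnP j (size adapted); last by rewrite nth_default.
exact: (all_nthP _ adapted_supported).
Qed.

Lemma linear_scale (k : fieldType) (U V : lmodType k) (f : U -> V) :
  linear f -> forall c v, f (c *: v) = c *: f v.
Proof.
move=> fl c v; have f0 : f 0 = 0.
  by have := fl (-1) 0 0; rewrite scaler0 addr0 scaleN1r => {1}->; rewrite addNr.
by have := fl c v 0; rewrite f0 !addr0.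
Qed.

Lemma linear_add (k : fieldType) (U V : lmodType k) (f : U -> V) :
  linear f -> forall u v, f (u + v) = f u + f v.
Proof. by move=> fl u v; have := fl 1 u v; rewrite !scale1r. Qed.

Lemma linear_big (k : fieldType) (U V : lmodType k) (f : U -> V) (I : Type)
    (r : seq I) (g : I -> U) :
  linear f -> f (\sum_(i <- r) g i) = \sum_(i <- r) f (g i).
Proof.
move=> fl; elim: r => [|i r IH]; last by rewrite !big_cons linear_add// IH.
by rewrite !big_nil -(scale0r 0) linear_scale// scale0r.
Qed.

Lemma mono_eq (k : fieldType) (B : finType) (deg : B -> 'S_3) p c
    (V : lmodType k) (f g : mono deg p c -> V) :
  linear f -> linear g -> (forall b, f (ket k b) = g (ket k b)) -> f =1 g.
Proof.
move=> fl gl fg v; rewrite [v]ket_expand !linear_big//.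
by apply: eq_bigr => b _; rewrite !linear_scale// fg.
Qed.

Section Basis.
Variables (k : fieldType) (char3 : 3%:R != 0 :> k).
Local Notation M := (verma_sm k).
Local Notation F := (fock_rep k).

Definition vac (b : z3) : M := @vemb k (M_sigma k true) (ket k (trz b)).
Definition sig_mon (p : idx) : M := mon vac p.

Lemma vac_g c b : act (H (Gr (decode c))) (vac b)
  = (csgn c)%:~R *: vac (code_conj c b).
Proof.
by rewrite /vac -vembH mono_GrE vembZ sgn_encode decodeK conj_trz.
Qed.

Lemma vac_d c b : act (H (De (decode c))) (vac b)
  = if (true, b) == c then vac b else 0.
Proof.
rewrite /vac -vembH mono_DeE val_trz (can_eq decodeK).
by case: eqP => _ //; exact: vemb0.
Qed.

Lemma vac_y y b : act (Y (trz y)) (vac b) = 0.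
Proof. exact: vembY. Qed.

Local Notation DM := (@verma_D_module k (M_sigma k true)).

Lemma sig_expr E u : act_expr E (vec sig_mon u) = vec sig_mon (appe E u).
Proof. exact: (vec_expr DM vac_g vac_d vac_y). Qed.

Lemma sig_app o u : act (gen_of o) (vec sig_mon u) = vec sig_mon (app o u).
Proof. exact: (vec_app DM vac_g vac_d vac_y). Qed.

Definition to_fock0 (v : M_sigma k true) : F :=
  \sum_a ((v : {ffun transp -> k^o}) a : k) *: fket k ([::], zcode a).

Lemma to_fock0_linear : linear to_fock0.
Proof.
move=> c u v; rewrite /to_fock0 scaler_sumr -big_split; apply: eq_bigr => a _ /=.
by rewrite !ffunE scalerDl scalerA.
Qed.

Lemma to_fock0_ket a : to_fock0 (ket k a) = fket k ([::], zcode a).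
Proof.
rewrite /to_fock0 (bigD1 a)//= big1 => [|b ba]; rewrite ffunE.
  by rewrite eqxx scale1r addr0.
by rewrite (negPf ba) scale0r.
Qed.

(** The universal property, applied to the vacuum vectors of the model; its conditions are linear
    and hence tested on kets. *)
Lemma to_fock_exists : exists f : M -> F, is_hom f /\
  forall b, f (vac b) = fket k ([::], b).
Proof.
have v0 b : ([::], b) \in bas by case: b.
have phiH s m : to_fock0 (act s m) = act (H s) (to_fock0 m).
  move: m; apply: mono_eq => [c u v|c u v|a].
  - by rewrite (act_linear s c u v) to_fock0_linear.
  - by rewrite to_fock0_linear (act_linear (H s) c).
  rewrite to_fock0_ket -(op_ofK (H s)) (fock_act1 k (op_of (H s)))//.
  case: s => g; rewrite ?mono_GrE ?mono_DeE /=.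
    rewrite (linear_scale to_fock0_linear) to_fock0_ket zcode_conj sgn_encode.
    by rewrite vec_cons vec_nil addr0.
  rewrite /dop /idx_deg /= -encode_transp (inj_eq encode_inj).
  case: eqP => _; rewrite ?vec1 ?vec_nil ?to_fock0_ket//.
  by rewrite -[0](scale0r 0) (linear_scale to_fock0_linear) scale0r.
have phiY y m : act (Y y) (to_fock0 m) = 0.
  move: m; apply: mono_eq => [c u v|c u v|a].
  - by rewrite to_fock0_linear (act_linear (Y y) c).
  - by rewrite scaler0 addr0.
  by rewrite to_fock0_ket -(op_ofK (Y y)) (fock_act1 k (op_of (Y y))) ?vec_nil.
have [f [[fh fm] _]] :=
  verma_universal (@fock_D_module k) to_fock0_linear phiH phiY.
by exists f; split=> // b; rewrite fm to_fock0_ket trzK.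
Qed.
End Basis.

Section Coordinates.
Variables (k : fieldType) (char3 : 3%:R != 0 :> k).
Local Notation M := (verma_sm k).
Local Notation F := (fock_rep k).

Definition to_fock : M -> F := projT1 (cid (to_fock_exists k)).

Lemma to_fock_hom : is_hom to_fock.
Proof. by rewrite /to_fock; case: cid => f []. Qed.

Lemma to_fock_vac b : to_fock (vac k b) = fket k ([::], b).
Proof. by rewrite /to_fock; case: cid => f []. Qed.

Lemma to_fock_mon p : p \in bas -> to_fock (sig_mon k p) = fket k p.
Proof.
move=> pb; have c0 : ([::], p.2) \in bas by case: p.2.
have -> : to_fock (sig_mon k p) =
    vec (fket k) (appw [seq OpX a | a <- p.1] [:: (1, ([::], p.2))]).
  rewrite -fock_word ?supported1// vec1 -to_fock_vac /sig_mon /mon.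
  elim: p.1 => //= a w <-; exact: (hom_act _ _ to_fock_hom).
(* Building a basis monomial letter by letter from the vacuum returns that monomial. *)
have check : all (fun p => sv_zero (appw [seq OpX a | a <- p.1]
    [:: (1, ([::], p.2))] ++ [:: (-1, p)])) bas by vm_compute.
have := vec_zero (fket k) (allP check p pb).
rewrite vec_cat vec_cons vec_nil addr0 scaleN1r => /eqP.
by rewrite subr_eq0 => /eqP.
Qed.

Definition of_fock (n : F) : M :=
  \sum_i ((n : {ffun 'I_36 -> k^o}) i : k) *: sig_mon k (bas_at i).

Lemma of_fock_linear : linear of_fock.
Proof.
move=> c u v; rewrite /of_fock scaler_sumr -big_split; apply: eq_bigr => a _ /=.
by rewrite !ffunE scalerDl scalerA.
Qed.

Lemma of_fock_ket p : p \in bas -> of_fock (fket k p) = sig_mon k p.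
Proof.
move=> /bas_atP[i ->]; rewrite /of_fock (bigD1 i)//= big1 => [|j ji]; rewrite ffunE.
  by rewrite eqxx scale1r addr0.
by rewrite (inj_eq bas_at_inj) (negPf ji) scale0r.
Qed.

Lemma of_fock_vec u : supported u -> of_fock (vec (fket k) u) = vec (sig_mon k) u.
Proof.
move=> /allP us; rewrite (linear_big _ _ of_fock_linear) /vec big_seq [RHS]big_seq.
apply: eq_bigr => x xu; rewrite (linear_scale of_fock_linear) of_fock_ket//.
exact: us.
Qed.

(** The same integer matrices [op1] describe the generators on both sides. *)
Lemma of_fock_act s n : of_fock (act s n) = act s (of_fock n).
Proof.
rewrite -(op_ofK s) [n in LHS]fock_expand act_sum (linear_big _ _ of_fock_linear).
rewrite act_sum; apply: eq_bigr => i _.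
rewrite !actZ (linear_scale of_fock_linear) fock_act1 ?mem_bas_at//.
rewrite of_fock_vec; last by apply: op1_supported; exact: mem_bas_at.
by rewrite -(vec1 (sig_mon k)) sig_app /app /sv_lin /= cats0 vec_scale scale1r.
Qed.

(** The composite is D-linear and fixes the vacuum vectors, which generate. This is the spanning
    half of the monomial basis; [to_fock_mon] is the independence half. *)
Lemma to_fockK : cancel to_fock of_fock.
Proof.
apply: verma_ind => [|m].
  split=> [|c u v Eu Ev|s v Ev] /=.
  - by rewrite (hom0 to_fock_hom) -(scale0r 0) (linear_scale of_fock_linear) scale0r.
  - rewrite (homD _ _ to_fock_hom) (homZ _ _ to_fock_hom).
    by rewrite (linear_add of_fock_linear) (linear_scale of_fock_linear) Eu Ev.
  - by rewrite (hom_act _ _ to_fock_hom) of_fock_act Ev.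
move: m; apply: mono_eq => [c u v|c u v|a].
- rewrite (@vemb_linear k (M_sigma k true)) (homD _ _ to_fock_hom).
  by rewrite (homZ _ _ to_fock_hom) of_fock_linear.
- exact: vemb_linear.
have v0 : ([::], zcode a) \in bas by case: (zcode a).
by rewrite -[a]zcodeK -/(vac k _) to_fock_vac of_fock_ket.
Qed.

(** The factor 1/3 undoes the scaling of [coadapted]. *)
Definition acf (j : nat) (v : M) : k :=
  3%:R^-1 * \sum_i (coef (covec j) (bas_at i))%:~R * (to_fock v : {ffun 'I_36 -> k^o}) i.

Lemma acfP j c u v : acf j (c *: u + v) = c * acf j u + acf j v.
Proof.
rewrite /acf (homD _ _ to_fock_hom) (homZ _ _ to_fock_hom) mulrCA -mulrDr.
congr (_ * _); rewrite mulr_sumr -big_split; apply: eq_bigr => i _ /=.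
by rewrite !ffunE mulrDr mulrCA.
Qed.

Lemma acf_linear j : linear (acf j : M -> k^o).
Proof. by move=> c u v; exact: acfP. Qed.

Definition avm (j : nat) : M := vec (sig_mon k) (avec j).

Lemma acf_vec j u : supported u ->
  acf j (vec (sig_mon k) u) = 3%:R^-1 * (pairing (covec j) u)%:~R.
Proof.
move=> us; rewrite /acf; congr (_ * _).
elim: u us => [_|[c p] u IH /= /andP[pb us]].
  by rewrite vec_nil (hom0 to_fock_hom) big1// => i _; rewrite ffunE mulr0.
rewrite vec_cons (homD _ _ to_fock_hom) (homZ _ _ to_fock_hom) to_fock_mon//.
rewrite intrD -IH// intrM.
have [i ->] := bas_atP pb.
under eq_bigr => l _ do rewrite ffunE mulrDr.
rewrite big_split /=; congr (_ + _).
rewrite (bigD1 i)//= big1 => [|l li]; rewrite !ffunE (inj_eq bas_at_inj).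
  by rewrite eqxx [_ *: _]mulr1 addr0 mulrC.
by rewrite (negPf li) [_ *: _]mulr0 mulr0.
Qed.

Lemma acf_avm i j : (i < 36)%N -> (j < 36)%N -> acf i (avm j) = (i == j)%:R.
Proof.
move=> i36 j36; rewrite acf_vec ?avec_supported//.
have := allP pairing_adapted i; rewrite mem_iota => /(_ i36)/allP/(_ j).
rewrite mem_iota => /(_ j36)/eqP ->.
by case: eqP => _; rewrite ?mulr0// mulVf.
Qed.

Lemma avm_expand v : v = \sum_(j < 36) acf j v *: avm j.
Proof.
pose g (v : M) := \sum_(j < 36) acf j v *: avm j.
have gl : linear g.
  move=> c a b; rewrite /g scaler_sumr -big_split; apply: eq_bigr => j _ /=.
  by rewrite acfP scalerDl scalerA.
rewrite -[LHS]to_fockK -/(g v) -[in RHS](to_fockK v) /of_fock !(linear_big _ _ gl).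
apply: eq_bigr => i _; rewrite (linear_scale gl); congr (_ *: _).
set p := bas_at i; have pb : p \in bas by exact: mem_bas_at.
have := vec_zero (sig_mon k) (allP adapted_expand p pb).
rewrite vec_cat [vec _ [:: _]]vec_cons vec_nil addr0 => /eqP; rewrite intrN scaleNr subr_eq0 => /eqP E.
have {}E : 3%:R *: sig_mon k p = vec (sig_mon k) (flatten
    [seq sv_scale (coef (covec j) p) (avec j) | j <- index_iota 0 36]) by rewrite E.
apply: (scalerI char3); rewrite E /g scaler_sumr.
rewrite -(big_mkord xpredT (fun j => 3%:R *: (acf j (sig_mon k p) *: avm j))).
elim: (index_iota 0 36) => [|j r IH].
  by rewrite [flatten _]/= vec_nil big_nil.
rewrite big_cons -IH [flatten _]/= vec_cat vec_scale scalerA; congr (_ *: _ + _).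
rewrite -(vec1 (sig_mon k)) acf_vec ?supported1// mulrA mulfV// mul1r.
by rewrite /pairing /= mul1r addr0.
Qed.

End Coordinates.

(* For 10 <= i < 24, [isolate i] acts on X/S as a rank one operator that maps
   entry i of [adapted] to a multiple of entry 10 (a generator of OPU) if i < 17
   and of entry 17 (a generator of VQN) otherwise. *)
Definition isolating : seq expr := [::
  [:: (-1, [:: OpY z0; OpY z1; OpX z0; OpX z2])];
  [:: (1, [:: OpY z0; OpY z1; OpX z0; OpX z1])];
  [:: (1, [:: OpY z2])];
  [:: (-1, [:: OpY z0])];
  [:: (-1, [:: OpY z1])];
  [:: (1, [:: OpY z0; OpY z1]); (-1, [:: OpY z1; OpY z2])];
  [:: (-1, [:: OpY z0; OpY z1]); (1, [:: OpY z2; OpY z0])];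
  [:: (1, [:: OpY z2; OpY z0; OpX z0; OpX z2]); (-1, [:: OpY z2; OpY z0; OpX z2; OpX z1])];
  [:: (1, [:: OpY z2; OpY z0; OpX z2; OpX z1]); (-1, [:: OpY z2; OpY z0; OpX z1; OpX z0])];
  [:: (-1, [:: OpG (false, z2); OpY z0])];
  [:: (1, [:: OpG (false, z1); OpY z1])];
  [:: (-1, [:: OpY z2])];
  [:: (1, [:: OpY z2; OpY z1])];
  [:: (-1, [:: OpY z2; OpY z0])]].

(* Operators that map the top vector of the socle, resp. entry 10 or 17 modulo
   the socle, to the entries of [adapted]. *)
Definition generating : seq expr := [::
  [:: (-1, [:: OpG (false, z1); OpY z0; OpY z1])];
  [:: (1, [:: OpG (false, z2); OpY z0; OpY z1])];
  [:: (-1, [:: OpY z0; OpY z1])];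
  [:: (-1, [:: OpG (true, z1); OpY z1])];
  [:: (1, [:: OpG (true, z0); OpY z1])];
  [:: (1, [:: OpG (false, z2); OpY z1])];
  [:: (-1, [:: OpY z1])];
  [:: (1, [::])];
  [:: (1, [:: OpG (false, z1)])];
  [:: (1, [:: OpG (false, z2)])];
  [:: (1, [::])];
  [:: (1, [:: OpG (true, z0)])];
  [:: (1, [:: OpG (false, z2); OpX z0])];
  [:: (-1, [:: OpX z0])];
  [:: (-1, [:: OpG (false, z1); OpX z0])];
  [:: (-1, [:: OpG (false, z2); OpX z0; OpX z2])];
  [:: (1, [:: OpX z0; OpX z2])];
  [:: (1, [::])];
  [:: (-1, [:: OpG (false, z1)])];
  [:: (1, [:: OpX z0])];
  [:: (-1, [:: OpG (false, z1); OpX z0])];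
  [:: (1, [:: OpG (false, z2); OpX z0])];
  [:: (-1, [:: OpX z0; OpX z1])];
  [:: (-1, [:: OpG (true, z0); OpX z0; OpX z1])]].

(* The components in degree 0 of the vectors [lower i v] are the coordinates of
   [v] along the entries 26-35 of [adapted]. *)
Definition lowering : seq (nat * expr) := [::
  (26, [:: (1, [::])]);
  (27, [:: (1, [::])]);
  (28, [:: (1, [::])]);
  (27, [:: (1, [:: OpY z0])]);
  (26, [:: (-1, [:: OpY z2])]);
  (27, [:: (-1, [:: OpY z2])]);
  (26, [:: (1, [:: OpY z1])]);
  (28, [:: (1, [:: OpY z0; OpY z1])]);
  (28, [:: (1, [:: OpY z0; OpY z2])]);
  (27, [:: (1, [:: OpY z0; OpY z1])])].

(* The basis dual to [words] for the Frobenius pairing of the Nichols algebra. *)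
Definition dual_monomials : seq expr := [::
  [:: (1, [:: OpX z0; OpX z2; OpX z0; OpX z1])];
  [:: (-1, [:: OpX z2; OpX z0; OpX z1])];
  [:: (1, [:: OpX z0; OpX z2; OpX z0])];
  [:: (-1, [:: OpX z0; OpX z2; OpX z1])];
  [:: (1, [:: OpX z0; OpX z2])];
  [:: (-1, [:: OpX z1; OpX z2])];
  [:: (-1, [:: OpX z1; OpX z0])];
  [:: (1, [:: OpX z2; OpX z0])];
  [:: (1, [:: OpX z0])];
  [:: (1, [:: OpX z2])];
  [:: (-1, [:: OpX z1])];
  [:: (1, [::])]].

Definition expr_after (E : expr) (o : op) : expr := [seq (x.1, rcons x.2 o) | x <- E].
(** Each entry of [adapted] is homogeneous, so its first monomial gives the degree. *)
Definition avec_deg (j : nat) : code := idx_deg (nth (0, ([::], z0)) (avec j) 0).2.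

(** Congruence modulo the span of the entries of [adapted] before [n]; [eq_from 10] is congruence
    modulo the socle. *)
Definition eq_from (n : nat) (u v : svec) : bool :=
  all (fun i => pairing (covec i) u == pairing (covec i) v) (iota n (36 - n)).

Definition isolate (i : nat) : expr :=
  expr_after (nth [::] isolating (i - 10)) (OpD (avec_deg i)).
Definition lower (i : nat) : expr :=
  expr_after (nth (0%N, [::]) lowering (i - 26)).2 (OpD (avec_deg i)).
(** For the monomial x_w |b>: multiply by the dual of x_w to reach the top, project to degree b,
    which removes the other kets since the top monomial has degree e, and conjugate by tau^-b, which
    carries |b> to |12>. *)
Definition raise (i : nat) : expr :=
  let p := nth ([::], z0) bas i in
  [seq (x.1, [:: OpG (false, z3_opp p.2), OpD (true, p.2) & x.2])
    | x <- nth [::] dual_monomials (index p.1 words)].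
(** Six times the projector onto the S_3-invariants of degree e. *)
Definition symmetrize : expr := [seq (1, [:: OpG c; OpD (false, z0)]) | c <- codes].

Lemma generating_socle : all (fun j =>
  eq_from 0 (appe (nth [::] generating j) (avec 7)) (avec j)) (iota 0 10).
Proof. by vm_compute. Qed.

Lemma generating_quotient : all (fun j =>
  eq_from 10 (appe (nth [::] generating j) (avec (if j < 17 then 10 else 17)%N)) (avec j))
  (iota 10 14).
Proof. by vm_compute. Qed.

Lemma isolate_adapted : all (fun i => all (fun j =>
    eq_from 10 (appe (isolate i) (avec j))
      (if i == j then sv_scale (if (15 <= i <= 18)%N then 3 else 1)
                        (avec (if i < 17 then 10 else 17)%N) else [::]))
  (iota 0 26)) (iota 10 14).
Proof. by vm_compute. Qed.

Lemma symmetrize_adapted : all (fun j =>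
    eq_from 10 (appe symmetrize (avec j)) (if (24 <= j)%N then sv_scale 6 (avec j) else [::]))
  (iota 0 26).
Proof. by vm_compute. Qed.

Lemma lower_adapted : all (fun i => all (fun j =>
    pairing (covec (nth (0%N, [::]) lowering (i - 26)).1) (appe (lower i) (avec j))
      == (if i == j then 3 else 0)) (iota 0 36)) (iota 26 10).
Proof. by vm_compute. Qed.

(** Only j >= i is claimed: [bas] is sorted by length and the dual monomial kills longer words by
    degree, whereas shorter words may survive. *)
Lemma raise_bas : all (fun i => all (fun j =>
    eq_from 0 (appe (raise i) [:: (1, nth ([::], z0) bas j)])
      (if i == j then avec 7 else [::])) (iota i (36 - i))) (iota 0 36).
Proof. by vm_compute. Qed.

Lemma vacuum_x : all (fun a => all (fun i => all (fun j =>
    pairing (covec i) (appe [:: (1, [:: OpX a])] (avec j)) == 0)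
  (iota 0 36)) (iota 26 3)) z3_all.
Proof. by vm_compute. Qed.

(** Says that the vectors whose coordinates in [I] vanish are stable under every generator: no entry
    outside [I] acquires a coordinate in [I]. *)
Definition closed_on (I : pred nat) : bool :=
  all (fun o => all (fun j => I j || all (fun i => I i ==>
    (pairing (covec i) (app o (avec j)) == 0)) (iota 0 36)) (iota 0 36)) all_ops.

Definition ge_pred (n : nat) : pred nat := fun j => (n <= j)%N.
Definition vqn_pred : pred nat := fun j => (10 <= j < 17)%N || (24 <= j)%N.

(** These are the dimensions in the composition series: 10 for S, 17 for OPU, 24 for OPU + VQN, 25
    and 26 after adding the trivial lines, 26 being the radical. *)
Lemma ge_closed : all (fun n => closed_on (ge_pred n)) [:: 0; 10; 17; 24; 25; 26; 36]%N.
Proof. by vm_compute. Qed.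

Lemma vqn_closed : closed_on vqn_pred.
Proof. by vm_compute. Qed.

(** * Submodules cut out by coordinates *)

Section CoordinateSubmodules.
Variables (k : fieldType) (char3 : 3%:R != 0 :> k) (char2 : 2%:R != 0 :> k).
Local Notation M := (verma_sm k).
Local Notation acf := (@acf k).
Local Notation avm := (@avm k).

Definition coord_sub (I : pred nat) : set M :=
  [set v | forall j, (j < 36)%N -> I j -> acf j v = 0].
Definition fil (n : nat) : set M := coord_sub (ge_pred n).

Lemma acfZ j c v : acf j (c *: v) = c * acf j v.
Proof. exact: (linear_scale (@acf_linear k j)). Qed.

Lemma acfD j u v : acf j (u + v) = acf j u + acf j v.
Proof. exact: (linear_add (@acf_linear k j)). Qed.

Lemma acf0 j : acf j 0 = 0.
Proof. by rewrite -(scale0r 0) acfZ mul0r. Qed.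

Lemma acfB j u v : acf j (u - v) = acf j u - acf j v.
Proof. by rewrite acfD -scaleN1r acfZ mulN1r. Qed.

Lemma acf_sum j (I : Type) (r : seq I) (P : pred I) (f : I -> M) :
  acf j (\sum_(i <- r | P i) f i) = \sum_(i <- r | P i) acf j (f i).
Proof. exact: (big_morph _ (acfD j) (acf0 j)). Qed.

Lemma appe_supported E u : supported u -> supported (appe E u).
Proof.
move=> us; elim: E => //= x E IH; rewrite /supported all_cat [all _ (flatten _)]IH.
by rewrite andbT all_map; exact: appw_supported.
Qed.

Lemma acf_act_expr i E v : acf i (act_expr E v) =
  \sum_(j < 36) acf j v * (3%:R^-1 * (pairing (covec i) (appe E (avec j)))%:~R).
Proof.
rewrite [v in LHS](avm_expand char3) (linear_big _ _ (act_expr_linear E)) acf_sum.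
apply: eq_bigr => j _; rewrite (linear_scale (act_expr_linear E)) acfZ sig_expr.
by rewrite acf_vec//; apply/appe_supported/avec_supported.
Qed.

Lemma coord_sub_submod I : closed_on I -> is_submod (coord_sub I).
Proof.
move=> CI; split=> [j _ _|c u v Hu Hv j j36 Ij|s v Hv j j36 Ij].
- exact: acf0.
- by rewrite acfP Hu// Hv// mulr0 addr0.
have -> : act s v = act_expr [:: (1, [:: op_of s])] v.
  by rewrite /act_expr big_seq1 scale1r /act_word /= op_ofK.
rewrite acf_act_expr big1// => i _.
have [Ii|nIi] := boolP (I i); first by rewrite Hv// mul0r.
have /allP Ci := all_opsP CI (op_of s).
have := Ci i; rewrite mem_iota ltn_ord (negPf nIi) => /(_ isT)/allP Cij.
have := Cij j; rewrite mem_iota j36 Ij => /(_ isT)/eqP E.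
have -> : appe [:: (1, [:: op_of s])] (avec i) = sv_scale 1 (app (op_of s) (avec i)).
  by rewrite /appe /= cats0.
have -> : sv_scale 1 (app (op_of s) (avec i)) = app (op_of s) (avec i).
  by rewrite /sv_scale -[RHS]map_id; apply: eq_map => -[c p]; rewrite /= mul1r.
by rewrite E !mulr0.
Qed.

Lemma coord_sub_expand I v : coord_sub I v ->
  v = \sum_(j < 36 | ~~ I j) acf j v *: avm j.
Proof.
move=> Iv; rewrite {1}[v](avm_expand char3) [RHS]big_mkcond; apply: eq_bigr => j _.
by case: ifP => // /negbFE Ij; rewrite Iv// scale0r.
Qed.

Lemma coord_sub_avm I j : (j < 36)%N -> ~~ I j -> coord_sub I (avm j).
Proof.
move=> j36 nIj i i36 Ii; rewrite acf_avm//.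
by have [ij|//] := eqVneq i j; rewrite -ij Ii in nIj.
Qed.

Lemma coord_sub_gen I (U : set M) : is_submod U ->
  (forall j, (j < 36)%N -> ~~ I j -> U (avm j)) -> coord_sub I `<=` U.
Proof.
move=> HU UI v /coord_sub_expand ->; apply: submod_sum => // j nIj.
by apply: submodZ => //; exact: UI.
Qed.

End CoordinateSubmodules.

(** * The submodule lattice *)

Section SimpleWeights.
Variable k : fieldType.

(** A nonzero vector yields some ket by the first hypothesis, and the group moves that ket to all
    others up to nonzero scalars. *)
Lemma mono_simple (B : finType) (deg : B -> 'S_3) p c (b0 : B) :
  (forall (U : set (mono deg p c)) v b, is_submod U -> U v ->
     (v : {ffun B -> k^o}) b != 0 -> U (ket k b)) ->
  (forall b b', exists2 g, p g b = b' & c g b != 0) ->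
  simple (mono deg p c).
Proof.
move=> proj trans; split.
  exists (ket k b0) => /ffunP/(_ b0); rewrite !ffunE eqxx => /eqP.
  by rewrite oner_eq0.
move=> U HU; have [E|nE] := pselect (exists v, U v /\ v <> 0); [right|left].
  case: E => v [Uv v0].
  have [b vb] : exists b, (v : {ffun B -> k^o}) b != 0.
    apply/existsP; apply: contraT; rewrite negb_exists => /forallP c0.
    by case: v0; apply/ffunP => b; rewrite ffunE; apply/eqP; rewrite -[_ == _]negbK.
  apply/seteqP; split=> // w _; rewrite [w]ket_expand.
  apply: (submod_sum _ HU) => b' _; apply: (submodZ _ HU).
  have [g <- cg] := trans b b'; apply: (submod_unscale HU cg).
  by rewrite -mono_GrE; apply: (submod_act _ HU); exact: proj Uv vb.
apply/seteqP; split=> v; last by move=> ->; exact: (submod0 HU).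
by move=> Uv; apply: contrapT => v0; apply: nE; exists v.
Qed.

Lemma mono_proj (B : finType) (deg : B -> 'S_3) p c (U : set (mono deg p c)) v b :
  injective deg -> is_submod U -> U v -> (v : {ffun B -> k^o}) b != 0 -> U (ket k b).
Proof.
move=> deg_inj HU Uv vb; apply: (submod_unscale HU vb).
suff -> : (v : {ffun B -> k^o}) b *: ket k b = act (De (deg b)) v by exact: submod_act.
apply/ffunP => b'; rewrite !ffunE (inj_eq deg_inj).
by case: eqP => [->|_]; rewrite ?[_ *: _]mulr1 ?[_ *: _]mulr0.
Qed.

Lemma sgn_neq0 g : sgn k g != 0.
Proof. by rewrite signr_eq0. Qed.

Lemma decode_conj (a b : transp) : exists g, conj g a = b.
Proof.
rewrite -(zcodeK a) -(zcodeK b).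
suff [c <-] : exists c, code_conj c (zcode a) = zcode b.
  by exists (decode c); rewrite conj_trz.
(* Conjugation by tau^t sends sigma tau^a to sigma tau^(a - 2 t) = sigma tau^(a + t), so t = b -
   a. *)
by exists (false, z3_opp (z3_add (zcode a) (z3_opp (zcode b))));
  case: (zcode a) (zcode b) => [] [].
Qed.

Lemma M_sigma_simple s : simple (M_sigma k s).
Proof.
apply: (mono_simple t12) => [U v b|a b]; first by apply: mono_proj; exact: val_inj.
have [g gab] := decode_conj a b; exists g => //.
by case: s; [exact: sgn_neq0|exact: oner_neq0].
Qed.

Lemma M_e_simple s : simple (M_e k s).
Proof.
apply: (mono_simple tt) => [U v b|a b]; first by apply: mono_proj => -[] [].
by exists 1%g; [case: a b => [] []|case: s; [exact: sgn_neq0|exact: oner_neq0]].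
Qed.

Variables (zeta : k) (zetaP : 3.-primitive_root zeta).

Lemma zeta3 : zeta ^+ 3 = 1.
Proof. exact: prim_expr_order. Qed.

Lemma zeta_neq0 : zeta != 0.
Proof. by apply: contra_eqN zeta3 => /eqP ->; rewrite expr0n eq_sym oner_eq0. Qed.

Lemma zeta_neq1 : zeta != 1.
Proof. by rewrite -[zeta]expr1 -(prim_order_dvd zetaP). Qed.

Lemma rot_coef_neq0 l g b : rot_coef zeta l g b != 0.
Proof. by rewrite /rot_coef; case: b; rewrite expf_neq0// ?invr_eq0 zeta_neq0. Qed.

Lemma rot_trans l (b b' : bool) :
  exists2 g, rot_perm g b = b' & rot_coef zeta l g b != 0.
Proof.
exists (if b (+) b' then sigma else 1%g); last exact: rot_coef_neq0.
by rewrite /rot_perm; case: b b' => [] []; rewrite /= ?odd_perm1 ?sigma_odd.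
Qed.

Lemma M_tau_simple l : simple (M_tau zeta l).
Proof.
apply: (mono_simple true) => [U v b|]; last exact: rot_trans.
have tauN : tau <> tau^-1%g.
  move=> E; have : encode tau = encode tau^-1%g by rewrite -E.
  by rewrite encodeV -[tau]/(decode (false, z1)) decodeK.
by apply: mono_proj => -[] [] //= E; case: tauN.
Qed.

Lemma tau_exp_tau : tau_exp tau = 1%N.
Proof. by rewrite /tau_exp tau_odd tauE. Qed.

Lemma zetaV_neq b : (if b then zeta else zeta^-1) != (if ~~ b then zeta else zeta^-1).
Proof.
suff E : zeta != zeta^-1 by case: b => //=; rewrite eq_sym.
apply: contra zeta_neq1 => /eqP E.
have z2 : zeta * zeta = 1 by rewrite {2}E mulfV// zeta_neq0.
by rewrite -zeta3 exprS expr2 z2 mulr1.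
Qed.

(** Both kets have degree e and no delta separates them; the distinct eigenvalues of tau do. *)
Lemma M_rho_simple : simple (M_rho zeta).
Proof.
apply: (mono_simple true) => [U v b HU Uv vb|]; last exact: rot_trans.
pose ev b := if b then zeta else zeta^-1.
have evb : v b * (ev b - ev (~~ b)) != 0 by rewrite mulf_neq0// subr_eq0 zetaV_neq.
apply: (submod_unscale HU evb).
suff -> : (v b * (ev b - ev (~~ b))) *: ket k b = act (Gr tau) v - ev (~~ b) *: v.
  by apply: submodB => //; [exact: submod_act|exact: submodZ].
have tau_ket c : act (Gr tau) (ket k c : M_rho zeta) = ev c *: ket k c.
  by rewrite mono_GrE /rot_coef /rot_perm tau_exp_tau tau_odd addbF.
have vE : v = v b *: ket k b + v (~~ b) *: ket k (~~ b).
  by rewrite {1}[v]ket_expand big_bool; case: (b) => //=; rewrite addrC.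
move: (v b) (v (~~ b)) vE => x y ->; rewrite actD !actZ !tau_ket scalerDr !scalerA.
by rewrite mulrBr scalerBl (mulrC y) (mulrC (ev (~~ b)) x) opprD addrACA subrr addr0.
Qed.

End SimpleWeights.

(** * The minimal submodule and the bound on proper submodules *)

Section SocleAndRadical.
Variables (k : fieldType) (char3 : 3%:R != 0 :> k) (char2 : 2%:R != 0 :> k).
Local Notation M := (verma_sm k).
Local Notation acf := (@acf k).
Local Notation avm := (@avm k).
Local Notation fil := (@fil k).
Implicit Types U : set M.

Lemma iota_all (P : pred nat) m n i : all P (iota m n) -> (m <= i < m + n)%N -> P i.
Proof. by move=> /allP Pmn im; apply: Pmn; rewrite mem_iota. Qed.

Lemma eq_from_fil n u v : supported u -> supported v -> eq_from n u v ->
  fil n (vec (sig_mon k) u - vec (sig_mon k) v).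
Proof.
move=> us vs uv i i36 ni; rewrite acfB !acf_vec//.
have /eqP -> : pairing (covec i) u == pairing (covec i) v.
  apply: (iota_all uv); rewrite subnKC ?i36 ?andbT//.
  by apply: leq_trans (ltnW i36); exact: ni.
by rewrite subrr.
Qed.

Lemma fil0 v : fil 0 v -> v = 0.
Proof. by move=> v0; rewrite [v](avm_expand char3) big1// => i _; rewrite v0// scale0r. Qed.

Lemma fil_mono m n : (m <= n)%N -> fil m `<=` fil n.
Proof. by move=> mn v mv i i36 ni; apply: mv => //; exact: leq_trans ni. Qed.

Lemma fil_submod n : n \in [:: 0; 10; 17; 24; 25; 26; 36]%N -> is_submod (fil n).
Proof. by move=> n_in; apply: coord_sub_submod => //; exact: (allP ge_closed). Qed.

Lemma submod_eq_from U n u v : is_submod U -> fil n `<=` U ->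
  supported u -> supported v -> eq_from n u v ->
  U (vec (sig_mon k) u) -> U (vec (sig_mon k) v).
Proof.
move=> HU nU us vs uv Uu; rewrite -[vec _ v](subKr (vec (sig_mon k) u)).
by apply: submodB => //; apply: nU; exact: eq_from_fil.
Qed.

Lemma submod_generated U E n j l : is_submod U -> fil n `<=` U ->
  eq_from n (appe E (avec l)) (avec j) -> U (avm l) -> U (avm j).
Proof.
move=> HU nU Elj Ul; apply: (submod_eq_from HU nU) Elj _.
- exact/appe_supported/avec_supported.
- exact: avec_supported.
- by rewrite -sig_expr; exact: act_expr_submod.
Qed.

Lemma fil0_sub U : is_submod U -> fil 0 `<=` U.
Proof. by move=> HU v /fil0 ->; exact: submod0. Qed.

Lemma socle_generated U : is_submod U -> U (avm 7) -> fil 10 `<=` U.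
Proof.
move=> HU U7; apply: coord_sub_gen => // j _; rewrite -ltnNge => j10.
exact: (submod_generated HU (fil0_sub HU) (iota_all generating_socle (i := j) j10) U7).
Qed.

(** Hence [fil 10] is contained in every nonzero submodule: [v] is raised to the top vector, entry
    7, which generates [fil 10]. *)
Lemma socle_minimal U v : is_submod U -> U v -> v <> 0 -> fil 10 `<=` U.
Proof.
move=> HU Uv v0; apply: socle_generated => //.
pose c := (to_fock v : {ffun 'I_36 -> k^o}).
have vE : v = \sum_(i : 'I_36) (c i : k) *: sig_mon k (bas_at i).
  by rewrite -[LHS]to_fockK.
have [i0 ci0] : exists i, c i != 0.
  apply/existsP; apply: contraT; rewrite negb_exists => /forallP c0.
  by case: v0; rewrite vE big1// => i _; have /negPn/eqP -> := c0 i; rewrite scale0r.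
(* With [i] the first monomial present in [v], all others come later and are killed by [raise i]. *)
have [i ci i_min] := arg_minnP (P := fun i => c i != 0) (fun i => val i) ci0.
apply: (submod_unscale HU ci).
suff -> : c i *: avm 7 = act_expr (raise i) v by exact: act_expr_submod.
rewrite vE (linear_big _ _ (act_expr_linear (raise i))) (bigD1 i)//= big1 => [|j ji].
  rewrite addr0 (linear_scale (act_expr_linear _)); congr (_ *: _).
  rewrite -(vec1 (sig_mon k)) sig_expr; apply/esym/eqP; rewrite -subr_eq0; apply/eqP.
  apply: fil0; apply: eq_from_fil.
  - exact/appe_supported/supported1/mem_bas_at.
  - exact: avec_supported.
  - have Ri := iota_all raise_bas (i := i) (ltn_ord i).
    have := iota_all Ri (i := i); rewrite eqxx; apply.
    by rewrite leqnn subnKC ?ltn_ord// ltnW.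
have [->|cj] := eqVneq (c j) 0; first by rewrite (linear_scale (act_expr_linear _)) scale0r.
rewrite (linear_scale (act_expr_linear _)) -(vec1 (sig_mon k)) sig_expr.
rewrite (_ : vec _ _ = 0) ?scaler0//.
set u := appe _ _; suff: fil 0 (vec (sig_mon k) u - vec (sig_mon k) [::]).
  by rewrite vec_nil subr0 => /fil0.
apply: eq_from_fil => //.
  exact/appe_supported/supported1/mem_bas_at.
have Ri := iota_all raise_bas (i := i) (ltn_ord i).
have ij : (i == j :> nat) = false by rewrite eq_sym; exact: negPf ji.
have := iota_all Ri (i := j); rewrite ij; apply.
by rewrite i_min// subnKC ?ltn_ord// ltnW.
Qed.

Lemma fil10_neq0 : avm 7 <> 0.
Proof.
move=> E; have := acf_avm char3 (i := 7) (j := 7) isT isT.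
by rewrite E acf0 => /eqP; rewrite eq_sym oner_eq0.
Qed.

Lemma xspan_vacuum v i : (26 <= i < 29)%N -> xspan v -> acf i v = 0.
Proof.
move=> i_range; elim=> [|a u w _ IH]; first exact: acf0.
rewrite acfD IH addr0.
have -> : act (X a) u = act_expr [:: (1, [:: OpX (zcode a)])] u.
  by rewrite /act_expr big_seq1 scale1r /act_word /= zcodeK.
rewrite acf_act_expr// big1// => j _.
have := allP vacuum_x _ (mem_z3 (zcode a)) => /iota_all/(_ i_range)/iota_all.
by move=> /(_ _ (ltn_ord j))/eqP ->; rewrite !mulr0.
Qed.

(** Each coordinate of [u] from 26 on is a degree 0 coordinate of [lower i] applied to [u]. That
    vector is again in [U], hence in the span of the images of the x's, where degree 0 coordinates
    vanish. *)
Lemma proper_fil U : is_submod U -> U <> setT -> U `<=` fil 26.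
Proof.
move=> HU UT u Uu i i36 i26.
have := iota_all lower_adapted (i := i) => /(_ _)/iota_all L.
set i' := (nth (0%N, [::]) lowering (i - 26)).1 in L.
have i'_range : (26 <= i' < 29)%N.
  have: all (fun x => 26 <= x.1 < 29)%N lowering by [].
  by move/(all_nthP (0%N, [::])); apply; rewrite ltn_subLR.
have <- : acf i' (act_expr (lower i) u) = acf i u.
  have ir : (26 <= i < 26 + 10)%N by rewrite i36 andbT; exact: i26.
  rewrite acf_act_expr// (bigD1 (Ordinal i36))//= big1 => [|j ji].
    by have /eqP -> := L i ir i36; rewrite eqxx mulVf// mulr1 addr0.
  have ij : (i == j :> nat) = false by rewrite eq_sym; exact: negPf ji.
  by have /eqP -> := L j ir (ltn_ord j); rewrite ij !mulr0.
have PX := proper_xspan (M_sigma_simple k true) HU UT.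
by apply: xspan_vacuum => //; apply: PX; exact: act_expr_submod.
Qed.

End SocleAndRadical.

Section Isolation.
Variables (k : fieldType) (char3 : 3%:R != 0 :> k) (char2 : 2%:R != 0 :> k).
Local Notation M := (verma_sm k).
Local Notation acf := (@acf k).
Local Notation avm := (@avm k).
Local Notation fil := (@fil k).
Implicit Types U : set M.

(** If [E] sends each entry j < N to [t j] modulo [fil n], then E u agrees modulo [fil n], hence
    modulo [U], with the displayed combination. *)
Lemma expr_mod U N n E (t : nat -> svec) u : is_submod U -> fil n `<=` U ->
  fil N u -> U u -> (N <= 36)%N -> (forall j, (j < N)%N -> supported (t j)) ->
  (forall j, (j < N)%N -> eq_from n (appe E (avec j)) (t j)) ->
  U (\sum_(j < N) acf j u *: vec (sig_mon k) (t j)).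
Proof.
move=> HU nU Nu Uu N36 ts Et.
have UE : U (act_expr E u) by exact: act_expr_submod.
rewrite -[X in U X](subKr (act_expr E u)); apply: submodB => //.
have -> : act_expr E u = \sum_(j < N) acf j u *: vec (sig_mon k) (appe E (avec j)).
  rewrite {1}[u](avm_expand char3) (linear_big _ _ (act_expr_linear E)).
  rewrite (big_ord_widen _ (fun j => acf j u *: vec (sig_mon k) (appe E (avec j))) N36).
  rewrite [RHS]big_mkcond; apply: eq_bigr => j _.
  rewrite (linear_scale (act_expr_linear E)) sig_expr.
  by case: ltnP => // Nj; rewrite Nu// scale0r.
rewrite -sumrB; apply: submod_sum => // j _; rewrite -scalerBr; apply: submodZ => //.
apply: nU; apply: eq_from_fil => //; last exact: Et.
- exact/appe_supported/avec_supported.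
- exact: ts.
Qed.

Lemma isolate_in U u i : is_submod U -> fil 10 `<=` U -> fil 26 u -> U u ->
  (10 <= i < 24)%N -> acf i u != 0 -> U (avm (if i < 17 then 10 else 17)%N).
Proof.
move=> HU sU u26 Uu i_range ui; have i26 : (i < 26)%N.
  by case/andP: i_range => _ /leq_trans; apply.
(* Entries 15 to 18 are those of degree e; their isolating expressions produce three times the
   target. *)
pose n : int := if (15 <= i <= 18)%N then 3 else 1.
pose w := sv_scale n (avec (if i < 17 then 10 else 17)%N).
have ws : supported w.
  by rewrite /w /supported all_map; exact: avec_supported.
have n0 : n%:~R != 0 :> k by rewrite /n; case: ifP; rewrite ?oner_eq0.
pose t j := if i == j then w else [::].
have := @expr_mod U 26 10 (isolate i) t u HU sU u26 Uu isT.
rewrite (bigD1 (Ordinal i26))//= big1 => [|j ji]; last first.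
  rewrite /t (_ : (i == j :> nat) = false) ?vec_nil ?scaler0//.
  by rewrite eq_sym; exact: negPf ji.
rewrite /t eqxx addr0 /w vec_scale => H.
apply: (submod_unscale HU n0); apply: (submod_unscale HU ui); apply: H.
  by move=> j _; case: eqP.
move=> j j26; have Hi := iota_all isolate_adapted (i := i) i_range.
exact: (iota_all Hi (i := j) j26).
Qed.

Lemma symmetrize_in U u : is_submod U -> fil 10 `<=` U -> fil 26 u -> U u ->
  U (acf 24 u *: avm 24 + acf 25 u *: avm 25).
Proof.
move=> HU sU u26 Uu.
pose t j := if (24 <= j)%N then sv_scale 6 (avec j) else [::].
have := @expr_mod U 26 10 symmetrize t u HU sU u26 Uu isT.
rewrite 2!big_ord_recr /= big1 => [|j _]; last first.
  rewrite /t (_ : (24 <= j)%N = false) ?vec_nil ?scaler0//.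
  by apply/negbTE; rewrite -ltnNge; exact: ltn_ord.
rewrite add0r -[t 24]/(sv_scale 6 (avec 24)) -[t 25]/(sv_scale 6 (avec 25)).
rewrite !vec_scale !scalerA ![_ * 6%:~R]mulrC -!scalerA -scalerDr => H.
have n6 : 6%:~R != 0 :> k by rewrite (intrM _ 2 3) mulf_neq0.
apply: (submod_unscale HU n6); apply: H => j j26.
  by rewrite /t; case: ifP => // _; rewrite /supported all_map; exact: avec_supported.
exact: (iota_all symmetrize_adapted).
Qed.

Lemma quotient_generated U j : is_submod U -> fil 10 `<=` U ->
  (10 <= j < 24)%N -> U (avm (if j < 17 then 10 else 17)%N) -> U (avm j).
Proof.
move=> HU sU jr; apply: (submod_generated HU sU).
exact: (iota_all generating_quotient (i := j) jr).
Qed.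

Lemma isolate_gen U u i j : is_submod U -> fil 10 `<=` U -> fil 26 u -> U u ->
  (10 <= i < 24)%N -> acf i u != 0 -> (10 <= j < 24)%N -> (i < 17)%N = (j < 17)%N ->
  U (avm j).
Proof.
move=> HU sU u26 Uu ir ui jr ij; apply: quotient_generated => //.
by rewrite -ij; exact: isolate_in ui.
Qed.

Lemma fil_notin i n : (i < 36)%N -> (n <= i)%N -> ~ fil n (avm i).
Proof.
move=> i36 ni H; have := H i i36 ni; rewrite acf_avm// eqxx => /eqP.
by rewrite oner_eq0.
Qed.

Lemma fil_avm i n : (i < 36)%N -> (i < n)%N -> fil n (avm i).
Proof. by move=> i36 ni; apply: coord_sub_avm => //; rewrite /ge_pred -ltnNge. Qed.

Lemma subrep_simple (A : Type) (N : rep k A) (U : submod N) :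
  (exists2 v, sset U v & v <> 0) ->
  (forall (Z : set N) z, is_submod Z -> Z z -> z <> 0 -> sset U `<=` Z) ->
  simple (subrep U).
Proof.
move=> [v Uv v0] Umin; split.
  have Uv' : v \in smem U by exact/asboolP.
  by exists (exist _ v Uv') => /(congr1 val).
move=> Z HZ; have [E|nE] := pselect (exists z, Z z /\ z <> 0); [right|left].
  case: E => z [Zz z0]; apply/seteqP; split=> // w _.
  have HvZ : is_submod ((val : subrep U -> N) @` Z).
    by apply: image_submod => //; exact: val_hom.
  have z0' : val z <> 0 by move=> E; apply: z0; exact: val_inj.
  have zZ : ((val : subrep U -> N) @` Z) (val z) by exists z.
  have Uw : sset U (val w) by apply/asboolP; exact: (valP w).
  have [y Zy yw] := Umin _ _ HvZ zZ z0' _ Uw.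
  by rewrite -(val_inj yw).
apply/seteqP; split=> z; last by move=> ->; exact: (submod0 HZ).
by move=> Zz; apply: contrapT => z0; apply: nE; exists z.
Qed.

(** [fil 10] is simple by minimality, and a simple submodule contains it, hence equals it. *)
Lemma socleE : S_sm (k := k) = fil 10.
Proof.
have H10 : is_submod (fil 10) by exact: fil_submod.
have simple10 : simple (subrep (Submod H10)).
  apply: subrep_simple => [|Z z HZ Zz z0] /=.
    by exists (avm 7); [exact: fil_avm|exact: fil10_neq0].
  exact: socle_minimal Zz z0.
apply/seteqP; split=> v; last first.
  move=> v10; exists [:: v]; rewrite big_seq1; split=> // u; rewrite inE => /eqP ->.
  by exists (fil 10) => //; exists (Submod H10).
move=> [s [Hs ->]]; rewrite big_seq; apply: submod_sum => // u us.
have [_ [U [[u0 u0N] U_simple] <-] Uu] := Hs u us.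
have HZ : is_submod [set w : subrep U | fil 10 (val w)] by exact: (meet_submod (Submod H10) U).
have sU : fil 10 `<=` sset U.
  apply: (@socle_minimal _ char3 _ (val u0)); first exact: ssetP.
    by apply/asboolP; exact: (valP u0).
  by move=> E; apply: u0N; exact: val_inj.
have Uu' : u \in smem U by exact/asboolP.
have [Z0|ZT] := U_simple _ HZ.
  have U7 : avm 7 \in smem U by apply/asboolP/sU/fil_avm.
  have : [set w : subrep U | fil 10 (val w)] (exist _ (avm 7) U7) by exact: fil_avm.
  by rewrite Z0 => /(congr1 val) /fil10_neq0.
have : [set w : subrep U | fil 10 (val w)] (exist _ u Uu') by rewrite ZT.
by [].
Qed.

End Isolation.

(** * The listed submodules in coordinates *)

Definition sv_q : svec := [:: (1, ([:: z0; z1], z1)); (-1, ([:: z0; z2], z2))].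
Definition sv_n0 : svec :=
  [:: (1, ([:: z2; z0; z1], z1)); (1, ([:: z0; z2; z1], z0)); (-1, ([:: z0; z2; z0], z2))].
Definition sv_p : svec :=
  [:: (-2, ([:: z2; z0], z1)); (-1, ([:: z0; z1], z1));
      (-2, ([:: z2; z1], z2)); (-1, ([:: z0; z2], z2))].
Definition sv_o0 : svec := [:: (1, ([:: z2], z0)); (1, ([:: z0], z1)); (1, ([:: z1], z2))].

(** An entry (u, g, n, j) records that g u is n times entry j of [adapted] modulo the socle. Each n
    is a unit once 2 and 3 are. *)
Definition weight_translates : seq (svec * code * int * nat) :=
  [:: (sv_o0, (false, z0), 1, 10%N); (sv_o0, (true, z0), 1, 11%N);
      (sv_p, (false, z0), -2, 12%N); (sv_p, (false, z1), 2, 13%N); (sv_p, (false, z2), 2, 14%N);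
      (sv_q, (false, z0), 2, 19%N); (sv_q, (false, z1), -2, 20%N); (sv_q, (false, z2), 2, 21%N);
      (sv_n0, (false, z0), -3, 22%N); (sv_n0, (true, z0), -3, 23%N)].

Lemma weight_translates_ok : all (fun x =>
  eq_from 10 (app (OpG x.1.1.2) x.1.1.1) (sv_scale x.1.2 (avec x.2))) weight_translates.
Proof. by vm_compute. Qed.

Definition in_coord (I : pred nat) (u : svec) : bool :=
  supported u && all (fun i => I i ==> (pairing (covec i) u == 0)) (iota 0 36).

Lemma weights_in_coord :
  [&& in_coord (ge_pred 17) sv_o0, in_coord (ge_pred 17) sv_p,
      in_coord vqn_pred sv_q & in_coord vqn_pred sv_n0].
Proof. by vm_compute. Qed.

(** For both pairs (x, y): sigma x = x - y and sigma y = - y, the situation of [zeta_conj]. *)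
Lemma sigma_reflection : all (fun x =>
    sv_zero (app (OpG (true, z0)) (avec x.1) ++ sv_scale (-1) (avec x.1) ++ avec x.2) &&
    sv_zero (app (OpG (true, z0)) (avec x.2) ++ avec x.2))
  [:: (15, 16); (17, 18)]%N.
Proof. by vm_compute. Qed.

(* The scalar by which a generator acts on the trivial weight [M_e false]. *)
Definition trivial_char (o : op) : int :=
  match o with OpG _ | OpD (false, z0) => 1 | _ => 0 end.

Lemma trivial_weights : all (fun o => all (fun j =>
    eq_from 10 (app o (avec j)) (sv_scale (trivial_char o) (avec j))) [:: 24; 25]%N) all_ops.
Proof. by vm_compute. Qed.

Section ListedWeights.
Variables (k : fieldType) (char3 : 3%:R != 0 :> k) (char2 : 2%:R != 0 :> k).
Variables (zeta : k) (zetaP : 3.-primitive_root zeta).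
Local Notation M := (verma_sm k).
Local Notation acf := (@acf k).
Local Notation avm := (@avm k).
Local Notation fil := (@fil k).
Local Notation HM := (restrict H M).
Implicit Types U R : set M.

Lemma restrict_submod U : is_submod U -> @is_submod k ggen HM U.
Proof. by case=> U0 UD Ua; split=> // s v; exact: Ua. Qed.

Lemma DS3_gen_submod (w : M) : @is_submod k ggen HM (DS3_gen w).
Proof. exact: gen_subP. Qed.

Lemma DS3_gen_self (w : M) : DS3_gen w w.
Proof. by move=> U _; apply. Qed.

Lemma DS3_gen_sub (w : M) U : is_submod U -> U w -> DS3_gen w `<=` U.
Proof. by move=> HU Uw v; apply; [exact: restrict_submod|move=> _ ->]. Qed.

Lemma vec_cons1 (e : idx -> M) p u : vec e ((1, p) :: u) = e p + vec e u.
Proof. by rewrite vec_cons scale1r. Qed.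

Lemma vec_consN1 (e : idx -> M) p u : vec e ((-1, p) :: u) = - e p + vec e u.
Proof. by rewrite vec_cons scaleN1r. Qed.

Lemma vec_consN2 (e : idx -> M) p u : vec e ((-2, p) :: u) = - (2%:R *: e p) + vec e u.
Proof. by rewrite vec_cons -scaleNr. Qed.

Lemma vec1N (e : idx -> M) p : vec e [:: (-1, p)] = - e p.
Proof. by rewrite vec_consN1 vec_nil addr0. Qed.

Definition vec_consE := (vec1, vec1N, vec_cons1, vec_consN1, vec_consN2).

Lemma vec_qE : vec_q k = vec (sig_mon k) sv_q.
Proof. by rewrite /sv_q !vec_consE. Qed.

Lemma vec_n0E : vec_n0 k = vec (sig_mon k) sv_n0.
Proof. by rewrite /sv_n0 !vec_consE [RHS]addrA. Qed.

Lemma vec_o0E : vec_o0 k = vec (sig_mon k) sv_o0.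
Proof. by rewrite /sv_o0 !vec_consE [RHS]addrA. Qed.

Lemma vec_pE : vec_p k = vec (sig_mon k) sv_p.
Proof.
have E (V : zmodType) (a b c d : V) : - (a + b) - (c + d) = - a + (- b + (- c - d)).
  by rewrite !opprD !addrA.
by rewrite /sv_p !vec_consE; exact: E.
Qed.

Lemma vec_e1E : vec_e1 k = avm 24.
Proof. by rewrite /avm [avec _]/= !vec_consE [RHS]addrA. Qed.

Lemma vec_e3E : vec_e3 k = avm 25.
Proof. by rewrite /avm [avec _]/= !vec_consE [RHS]addrA. Qed.

Lemma zetaV : zeta^-1 = zeta * zeta.
Proof. by apply: (mulfI (zeta_neq0 zetaP)); rewrite mulfV ?zeta_neq0// -(zeta3 zetaP). Qed.

Lemma zeta_sum : 1 + zeta + zeta * zeta = 0.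
Proof.
have z1 : zeta - 1 != 0 by rewrite subr_eq0 zeta_neq1.
apply: (mulfI z1); rewrite mulr0 -[RHS](subrr 1) -[X in _ = X - _](zeta3 zetaP).
ring.
Qed.

(** For w = x + zeta y one has w - sigma w = (1 + 2 zeta) y, and 1 + 2 zeta = zeta (1 - zeta) is
    nonzero. So the vector with zeta generates both its integral parts. *)
Lemma zeta_conj (R : set M) (x y : M) : @is_submod k ggen HM R ->
  act (H (Gr sigma)) x = x - y -> act (H (Gr sigma)) y = - y ->
  R (x + zeta *: y) -> R x /\ R y.
Proof.
move=> HR sx sy Rw; set w := x + zeta *: y in Rw.
have Rsw : R (act (H (Gr sigma)) w) by exact: (submod_act (Gr sigma) HR).
have wsw : w - act (H (Gr sigma)) w = (zeta * (1 - zeta)) *: y.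
  have -> : zeta * (1 - zeta) = 1 + zeta + zeta.
    by apply/eqP; rewrite -subr_eq0 -[X in _ == X]oppr0 -zeta_sum; apply/eqP; ring.
  rewrite /w actD actZ sx sy scalerN !opprB !scalerDl scale1r.
  by rewrite -[LHS]addrA addrC -!addrA addNr addr0 addrA addrC addrA.
have c0 : zeta * (1 - zeta) != 0.
  apply: mulf_neq0; first exact: zeta_neq0 zetaP.
  by rewrite subr_eq0 eq_sym; exact: zeta_neq1 zetaP.
have Ry : R y.
  by apply: (submod_unscale HR c0); rewrite -wsw; exact: (submodB HR).
split=> //; rewrite -[x](addrK (zeta *: y)).
by apply: (submodB HR) => //; exact: (submodZ _ HR).
Qed.

(** Integral parts with respect to 1 and zeta, by zeta^-1 = - (1 + zeta). *)
Lemma vec_uE : vec_u zeta = avm 15 + zeta *: avm 16.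
Proof.
have E (V : lmodType k) (a b c : V) :
    - (zeta^-1 *: a) + zeta *: b + c = a + c + zeta *: (a + b).
  have -> : zeta^-1 = - (1 + zeta).
    by rewrite zetaV; apply/eqP; rewrite -addr_eq0 addrC zeta_sum.
  rewrite scaleNr opprK scalerDl scale1r scalerDr -!addrA; congr (_ + _).
  by rewrite [RHS]addrC -addrA.
by rewrite /avm [avec 15]/= [avec 16]/= !vec_consE; exact: E.
Qed.

Lemma vec_vE : vec_v zeta = - (avm 17 + zeta *: avm 18).
Proof.
have E (V : lmodType k) (a b c : V) :
    zeta^-1 *: a + zeta *: b + c = - ((a - c) + zeta *: (a - b)).
  have -> : zeta^-1 = - (1 + zeta).
    by rewrite zetaV; apply/eqP; rewrite -addr_eq0 addrC zeta_sum.
  rewrite scaleNr scalerDl scale1r scalerBr !opprD !opprK.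
  by rewrite -!addrA; congr (_ + _); rewrite [RHS]addrC -addrA.
by rewrite /avm [avec 17]/= [avec 18]/= !vec_consE; exact: E.
Qed.

End ListedWeights.

Section ListedSubmodules.
Variables (k : fieldType) (char3 : 3%:R != 0 :> k) (char2 : 2%:R != 0 :> k).
Variables (zeta : k) (zetaP : 3.-primitive_root zeta).
Local Notation M := (verma_sm k).
Local Notation acf := (@acf k).
Local Notation avm := (@avm k).
Local Notation fil := (@fil k).
Local Notation HM := (restrict H M).
Implicit Types U R : set M.

Lemma weight_translate R src : @is_submod k ggen HM R -> fil 10 `<=` R ->
  R (vec (sig_mon k) src) -> forall c n j, (src, c, n, j) \in weight_translates ->
  R (avm j).
Proof.
move=> HR sR Rsrc c n j x_in.
have src_supp : supported src.
  have: all (fun x => supported x.1.1.1) weight_translates by vm_compute.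
  by move/allP/(_ _ x_in).
have n0 : n%:~R != 0 :> k.
  have: all (fun x => x.1.2 \in [:: 1; 2; -2; -3]) weight_translates by vm_compute.
  move=> /allP/(_ _ x_in); rewrite !inE => /or4P[] /eqP /= ->.
  - exact: oner_neq0.
  - exact: char2.
  - by rewrite intrN oppr_eq0.
  - by rewrite intrN oppr_eq0.
apply: (submod_unscale HR n0).
have E : eq_from 10 (app (OpG c) src) (sv_scale n (avec j)).
  exact: (allP weight_translates_ok _ x_in).
have F := eq_from_fil k (app_supported (OpG c) src_supp) _ E.
rewrite -vec_scale -[vec _ _](subKr (vec (sig_mon k) (app (OpG c) src))).
apply: (submodB HR).
  by rewrite -sig_app; exact: (submod_act (Gr (decode c)) HR).
by apply/sR/F; rewrite /supported all_map; exact: avec_supported.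
Qed.

Lemma in_coordP I u : in_coord I u -> coord_sub I (vec (sig_mon k) u).
Proof.
move=> /andP[us uI] j j36 Ij; rewrite acf_vec//.
have /implyP/(_ Ij)/eqP -> := allP uI j (etrans (mem_iota 0 36 j) j36).
by rewrite mulr0.
Qed.

Lemma sigma_avm i j : (i, j) \in [:: (15, 16); (17, 18)]%N ->
  act (H (Gr sigma)) (avm i) = avm i - avm j /\
  act (H (Gr sigma)) (avm j) = - avm j.
Proof.
move=> /(allP sigma_reflection)/andP[Ei Ej].
rewrite [(i, j).1]/= [(i, j).2]/= in Ei Ej.
have sE u : act (H (Gr sigma)) (vec (sig_mon k) u) =
    vec (sig_mon k) (app (OpG (true, z0)) u) by exact: (sig_app k (OpG (true, z0))).
rewrite /avm !sE.
have := vec_zero (sig_mon k) Ej; have := vec_zero (sig_mon k) Ei.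
rewrite !vec_cat vec_scale scaleN1r => /eqP Hi /eqP Hj; split; apply/eqP.
  by move: Hi; rewrite addr_eq0 opprD opprK.
by move: Hj; rewrite addr_eq0.
Qed.

Lemma opu_submod : is_submod (fil 17).
Proof. exact: fil_submod. Qed.

Lemma vqn_submod : is_submod (@coord_sub k vqn_pred).
Proof. exact: (coord_sub_submod char3 vqn_closed). Qed.

Lemma fil10_vqn : fil 10 `<=` @coord_sub k vqn_pred.
Proof.
move=> v v10 j j36 Ij; apply: v10 => //; rewrite /ge_pred.
by case/orP: Ij => [/andP[]//|j24]; exact: leq_trans j24.
Qed.

Lemma DS3_sum (a b c : M) :
  let R := add_set (add_set (add_set (fil 10) (DS3_gen a)) (DS3_gen b)) (DS3_gen c) in
  @is_submod k ggen HM R /\ fil 10 `<=` R /\ [/\ R a, R b & R c].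
Proof.
have addl U w : U `<=` add_set U (DS3_gen w).
  exact: (@add_setl k ggen HM _ _ (DS3_gen_submod w)).
have addr U w : @is_submod k ggen HM U -> add_set U (DS3_gen w) w.
  by move=> HU; apply: (@add_setr k ggen HM _ _ HU); exact: DS3_gen_self.
have HS : @is_submod k ggen HM (fil 10) by apply/restrict_submod/fil_submod.
have H1 := @add_set_submod k ggen HM _ _ HS (DS3_gen_submod a).
have H2 := @add_set_submod k ggen HM _ _ H1 (DS3_gen_submod b).
have H3 := @add_set_submod k ggen HM _ _ H2 (DS3_gen_submod c).
split=> //; split; last split.
- by move=> v v10; exact/(addl _ c)/(addl _ b)/(addl _ a).
- exact/(addl _ c)/(addl _ b)/addr.
- exact/(addl _ c)/addr.
- exact/addr.
Qed.

(** OPU is defined as a sum of D(S_3)-submodules; stability under the x's and y's comes from this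
    equality. From right to left, translates of the three generators reach entries 10 to 16. *)
Lemma OPUE : OPU zeta = fil 17.
Proof.
have [o17 p17 _ _] := and4P weights_in_coord.
have w17 u : in_coord (ge_pred 17) u -> DS3_gen (vec (sig_mon k) u) `<=` fil 17.
  by move=> /in_coordP u17; apply: DS3_gen_sub => //; exact: opu_submod.
rewrite /OPU socleE// vec_pE vec_o0E; apply/seteqP; split.
  move=> _ [_ [w [[_ [b [[s [a [s10 ua ->]]] pb ->]]] ow ->]]].
  have a17 : fil 17 a.
    apply: (DS3_gen_sub opu_submod _ ua); rewrite vec_uE//.
    apply: (submodD opu_submod); first exact: fil_avm.
    by apply: (submodZ _ opu_submod); exact: fil_avm.
  apply: (submodD opu_submod); last exact: w17 ow.
  apply: (submodD opu_submod); last exact: w17 pb.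
  by apply: (submodD opu_submod) => //; exact: fil_mono s10.
set R := add_set _ _.
have [HR [sR [Ru Rp Ro]]] := DS3_sum (vec_u zeta) (vec (sig_mon k) sv_p)
  (vec (sig_mon k) sv_o0).
have [sx sy] := sigma_avm (i := 15%N) (j := 16%N) isT.
have Ru' : R (avm 15 + zeta *: avm 16) by rewrite -(vec_uE zetaP).
have [R15 R16] := zeta_conj zetaP HR sx sy Ru'.
have R10 := weight_translate HR sR Ro (c := (false, z0)) (n := 1) (j := 10%N) isT.
have R11 := weight_translate HR sR Ro (c := (true, z0)) (n := 1) (j := 11%N) isT.
have R12 := weight_translate HR sR Rp (c := (false, z0)) (n := -2) (j := 12%N) isT.
have R13 := weight_translate HR sR Rp (c := (false, z1)) (n := 2) (j := 13%N) isT.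
have R14 := weight_translate HR sR Rp (c := (false, z2)) (n := 2) (j := 14%N) isT.
move=> v v17; rewrite (coord_sub_expand char3 v17); apply: (submod_sum _ HR) => j.
rewrite -ltnNge => j17; apply: (submodZ _ HR).
case: (ltnP j 10) => [j10|j10]; first by apply: sR; exact: fil_avm.
have : val j \in iota 10 7 by rewrite mem_iota j10.
by rewrite !inE; do 6 (case/orP=> [/eqP -> //|]); move=> /eqP ->.
Qed.

Lemma VQNE : VQN zeta = @coord_sub k vqn_pred.
Proof.
have [_ _ q17 n17] := and4P weights_in_coord.
have Hv := vqn_submod.
have v_avm j : (17 <= j < 24)%N -> @coord_sub k vqn_pred (avm j).
  move=> /andP[j17 j24]; apply: coord_sub_avm => //; first exact: ltn_trans j24 _.
  by apply/negP => /orP[/andP[_]|]; [rewrite ltnNge j17|rewrite leqNgt j24].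
have w17 u : in_coord vqn_pred u -> DS3_gen (vec (sig_mon k) u) `<=` @coord_sub k vqn_pred.
  by move=> /in_coordP u17; apply: DS3_gen_sub.
rewrite /VQN socleE// vec_qE vec_n0E; apply/seteqP; split.
  move=> _ [_ [w [[_ [b [[s [a [s10 va ->]]] qb ->]]] nw ->]]].
  have a17 : @coord_sub k vqn_pred a.
    apply: (DS3_gen_sub Hv _ va); rewrite vec_vE// -scaleN1r.
    apply: (submodZ _ Hv); apply: (submodD Hv); first exact: v_avm.
    by apply: (submodZ _ Hv); exact: v_avm.
  apply: (submodD Hv); last exact: w17 nw.
  apply: (submodD Hv); last exact: w17 qb.
  by apply: (submodD Hv) => //; exact: fil10_vqn.
set R := add_set _ _.
have [HR [sR [Rv Rq Rn]]] := DS3_sum (vec_v zeta) (vec (sig_mon k) sv_q)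
  (vec (sig_mon k) sv_n0).
have [sx sy] := sigma_avm (i := 17%N) (j := 18%N) isT.
have Rv' : R (avm 17 + zeta *: avm 18).
  by rewrite -[_ + _]opprK -(vec_vE zetaP) -scaleN1r; exact: (submodZ _ HR).
have [R17 R18] := zeta_conj zetaP HR sx sy Rv'.
have R19 := weight_translate HR sR Rq (c := (false, z0)) (n := 2) (j := 19%N) isT.
have R20 := weight_translate HR sR Rq (c := (false, z1)) (n := -2) (j := 20%N) isT.
have R21 := weight_translate HR sR Rq (c := (false, z2)) (n := 2) (j := 21%N) isT.
have R22 := weight_translate HR sR Rn (c := (false, z0)) (n := -3) (j := 22%N) isT.
have R23 := weight_translate HR sR Rn (c := (true, z0)) (n := -3) (j := 23%N) isT.
move=> v v17; rewrite (coord_sub_expand char3 v17); apply: (submod_sum _ HR) => j.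
rewrite /vqn_pred negb_or -ltnNge => /andP[j17 j24]; apply: (submodZ _ HR).
case: (ltnP j 10) => [j10|j10]; first by apply: sR; exact: fil_avm.
rewrite j10 /= -leqNgt in j17.
have : val j \in iota 17 7 by rewrite mem_iota j17.
by rewrite !inE; do 6 (case/orP=> [/eqP -> //|]); move=> /eqP ->.
Qed.

End ListedSubmodules.

(** * Classification of the proper submodules *)

Section Classification.
Variables (k : fieldType) (char3 : 3%:R != 0 :> k) (char2 : 2%:R != 0 :> k).
Variables (zeta : k) (zetaP : 3.-primitive_root zeta).
Local Notation M := (verma_sm k).
Local Notation acf := (@acf k).
Local Notation avm := (@avm k).
Local Notation fil := (@fil k).
Implicit Types U : set M.

Lemma T_smP l m (v : M) : T_sm l m v <->
  exists c s, fil 10 s /\ v = c *: (l *: avm 24 + m *: avm 25) + s.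
Proof.
rewrite /T_sm socleE// vec_e1E vec_e3E; split.
  by move=> [_ [s [[c ->] s10 ->]]]; exists c, s.
by move=> [c [s [s10 ->]]]; eexists; exists s; split=> //; exists c.
Qed.

Lemma act_trivial_weight s j : j \in [:: 24; 25]%N ->
  fil 10 (act s (avm j) - (trivial_char (op_of s))%:~R *: avm j).
Proof.
move=> jT; rewrite -{1}(op_ofK s) sig_app -vec_scale.
apply: eq_from_fil; first exact/app_supported/avec_supported.
  by rewrite /supported all_map; exact: avec_supported.
exact: (allP (all_opsP trivial_weights (op_of s)) j jT).
Qed.

(** Modulo the socle every generator acts on both |e>^1 and |e>^3 by the same scalar [trivial_char],
    hence on each combination. *)
Lemma T_sm_submod l m : is_submod (@T_sm k l m).
Proof.
have HS : is_submod (fil 10) by exact: fil_submod.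
split=> [|a u v|s v]; rewrite !T_smP.
- by exists 0, 0; rewrite scale0r addr0; split=> //; exact: submod0.
- move=> [c [x [x10 ->]]] [d [y [y10 ->]]]; exists (a * c + d), (a *: x + y).
  by rewrite scalerDr scalerA scalerDl addrACA; split=> //; case: HS => _ + _; apply.
move=> [c [x [x10 ->]]]; set t := (trivial_char (op_of s))%:~R : k.
exists (c * t), (c *: (l *: (act s (avm 24) - t *: avm 24)
  + m *: (act s (avm 25) - t *: avm 25)) + act s x); split.
  apply: (submodD HS); last exact: (submod_act _ HS).
  apply: (submodZ _ HS); apply: (submodD HS); apply: (submodZ _ HS).
    exact: act_trivial_weight.
  exact: act_trivial_weight.
rewrite actD actZ actD !actZ addrA; congr (_ + _).
rewrite -scalerA -scalerDr; congr (_ *: _).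
rewrite scalerDr !scalerBr !scalerA (mulrC t l) (mulrC t m).
by rewrite addrACA !(addrC (_ *: avm _)) !subrK.
Qed.

Lemma listed_submod U : listed zeta U -> is_submod U.
Proof.
case=> [->|->|->|[l [m ->]]].
- by rewrite socleE//; exact: fil_submod.
- by rewrite OPUE//; exact: fil_submod.
- by rewrite VQNE//; exact: vqn_submod.
- exact: T_sm_submod.
Qed.

Lemma coord_part (v : M) (a b : nat) (U : set M) : is_submod U ->
  (b <= 36)%N ->
  (forall j, (a <= j < b)%N -> U (avm j)) -> U (\sum_(a <= j < b) acf j v *: avm j).
Proof.
move=> HU b36 Uj; rewrite big_nat; apply: (submod_sum _ HU) => j abj.
by apply: (submodZ _ HU); exact: Uj.
Qed.

Lemma avm_split (v : M) : fil 26 v -> v =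
  \sum_(0 <= j < 10) acf j v *: avm j + \sum_(10 <= j < 17) acf j v *: avm j
  + \sum_(17 <= j < 24) acf j v *: avm j + (acf 24 v *: avm 24 + acf 25 v *: avm 25).
Proof.
move=> v26; rewrite {1}[v](avm_expand char3) -(big_mkord xpredT (fun j => acf j v *: avm j)).
have v0 : \sum_(26 <= j < 36) acf j v *: avm j = 0.
  by rewrite big_nat big1// => j /andP[j26 j36]; rewrite v26// scale0r.
rewrite (@big_cat_nat _ _ _ 26)//= v0 addr0.
rewrite (@big_cat_nat _ _ _ 24)//= (@big_cat_nat _ _ _ 17)//= (@big_cat_nat _ _ _ 10)//=.
have -> // : \sum_(24 <= j < 26) acf j v *: avm j = acf 24 v *: avm 24 + acf 25 v *: avm 25.
by rewrite big_ltn// big_ltn// big_geq// addr0.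
Qed.

(** The family consists of all listed submodules inside [U]. A vector of [U] is cut into its socle,
    OPU, VQN and trivial parts; each part lies in a listed submodule that [U] is forced to
    contain. *)
Lemma proper_submod_sum U : is_submod U -> U <> setT ->
  exists F : set (set M), F `<=` listed zeta /\ U = sum_of F.
Proof.
move=> HU UT; exists [set W | listed zeta W /\ W `<=` U]; split=> [W []//|].
apply/seteqP; split=> [u Uu|_ [s [sF ->]]]; last first.
  by rewrite big_seq; apply: (submod_sum _ HU) => w /sF[W [_ WU] /WU].
(* Zero is treated apart as the empty sum: when U = 0 the family is empty, as every listed submodule
   contains the socle. *)
have [->|/eqP u0] := eqVneq u 0.
  by exists [::]; rewrite big_nil.
have sU : fil 10 `<=` U by exact: socle_minimal Uu u0.
have u26 : fil 26 u by exact: (proper_fil char3 HU UT).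
set F := [set W | _].
have FS : F (fil 10) by split=> //; apply: Or41; rewrite socleE.
have HS : is_submod (fil 10) by exact: fil_submod.
(* Common to OPU and VQN: one nonzero coordinate between a and b puts all of [W] into [U]; otherwise
   this part of [u] is 0 and the socle accounts for it. *)
have part a b (W : set M) : (10 <= a)%N -> (b <= 24)%N -> (b <= 17)%N = (a < 17)%N ->
    is_submod W -> listed zeta W ->
    (forall i, (a <= i < b)%N -> W (avm i)) ->
    ((forall j, (a <= j < b)%N -> U (avm j)) -> W `<=` U) ->
    exists2 W', F W' & W' (\sum_(a <= j < b) acf j u *: avm j).
  move=> a10 b24 ab HW lW Wj WU.
  have [[i /andP[iab ui]]|nE] := pselect (exists i, (a <= i < b)%N && (acf i u != 0)).
    have r j : (a <= j < b)%N -> (10 <= j < 24)%N.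
      by case/andP=> aj jb; rewrite (leq_trans a10 aj) (leq_trans jb b24).
    have s17 j : (a <= j < b)%N -> (j < 17)%N = (a < 17)%N.
      case/andP=> aj jb; case: (ltnP a 17) ab => [_|a17] b17.
        exact: leq_trans jb b17.
      by rewrite ltnNge (leq_trans a17 aj).
    have UW j : (a <= j < b)%N -> U (avm j).
      move=> jab; apply: (isolate_gen char3 HU sU u26 Uu (r _ iab) ui (r _ jab)).
      by rewrite !s17.
    exists W; first by split=> //; exact: WU.
    by apply: coord_part => //; exact: leq_trans b24 _.
  exists (fil 10) => //; rewrite big_nat big1; first exact: (submod0 HS).
  move=> j jab; case: (eqVneq (acf j u) 0) => [->|uj]; first exact: scale0r.
  by case: nE; exists j; rewrite jab.
have [W1 F1 W1u] : exists2 W', F W' & W' (\sum_(10 <= j < 17) acf j u *: avm j).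
  apply: (part 10%N 17%N (fil 17)) => //.
  - exact: fil_submod.
  - by apply: Or42; rewrite OPUE.
  - move=> i /andP[_ i17]; apply: fil_avm => //; exact: ltn_trans i17 _.
  move=> Uj; apply: (coord_sub_gen char3 HU) => j j36; rewrite -ltnNge => j17.
  by case: (ltnP j 10) => j10; [apply/sU/fil_avm|apply: Uj; rewrite j10].
have [W2 F2 W2u] : exists2 W', F W' & W' (\sum_(17 <= j < 24) acf j u *: avm j).
  apply: (part 17%N 24%N (@coord_sub k vqn_pred)) => //.
  - exact: vqn_submod.
  - by apply: Or43; rewrite VQNE.
  - move=> i /andP[i17 i24]; apply: coord_sub_avm => //; first exact: ltn_trans i24 _.
    by apply/negP => /orP[/andP[_]|]; [rewrite ltnNge i17|rewrite leqNgt i24].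
  move=> Uj; apply: (coord_sub_gen char3 HU) => j j36.
  rewrite negb_or -ltnNge => /andP[j17 j24].
  case: (ltnP j 10) => j10; first by apply/sU/fil_avm.
  by apply: Uj; rewrite j24 andbT; move: j17; rewrite j10 /= -leqNgt.
have tU := symmetrize_in char3 char2 HU sU u26 Uu.
exists [:: \sum_(0 <= j < 10) acf j u *: avm j; \sum_(10 <= j < 17) acf j u *: avm j;
  \sum_(17 <= j < 24) acf j u *: avm j; acf 24 u *: avm 24 + acf 25 u *: avm 25].
have sum4 (a b c d : M) : \sum_(w <- [:: a; b; c; d]) w = a + b + c + d.
  by rewrite 3!big_cons big_seq1 !addrA.
split; last by rewrite sum4 -avm_split.
move=> w; rewrite !inE => /or4P[] /eqP ->.
- exists (fil 10) => //; apply: coord_part => // j /andP[_ j10].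
  by apply: fil_avm => //; exact: ltn_trans j10 _.
- by exists W1.
- by exists W2.
(* The parameters are the coordinates of [u] on the two lines; only this combination is known to lie
   in [U]. *)
exists (T_sm (acf 24 u) (acf 25 u)).
  split; first by apply: Or44; exists (acf 24 u), (acf 25 u).
  move=> v /T_smP[c [s [s10 ->]]]; apply: (submodD HU); last exact: sU.
  exact: (submodZ _ HU).
by apply/T_smP; exists 1, 0; rewrite scale1r addr0; split=> //; exact: submod0.
Qed.

Lemma maximal_fil26 U : maximal_submod U <-> U = fil 26.
Proof.
have H26 : is_submod (fil 26) by exact: fil_submod.
have T26 : fil 26 <> setT.
  by move=> E; apply: (@fil_notin k char3 26 26) => //; rewrite E.
split=> [[HU UT Umax]|->].
  by have -> := Umax _ H26 T26 (proper_fil char3 HU UT).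
split=> // W HW WT W26; apply/seteqP; split=> //; exact: proper_fil.
Qed.

Lemma radicalE :
  add_set (add_set (add_set (OPU zeta) (VQN zeta)) (T_sm 1 0)) (T_sm 0 1) = fil 26.
Proof.
have Ho : is_submod (OPU zeta) by rewrite OPUE//; exact: fil_submod.
have Hv : is_submod (VQN zeta) by rewrite VQNE//; exact: vqn_submod.
have HT l m := T_sm_submod l m.
have H1 := add_set_submod Ho Hv; have H2 := add_set_submod H1 (HT 1 0).
have H3 := add_set_submod H2 (HT 0 1).
have H26 : is_submod (fil 26) by exact: fil_submod.
have T26 l m : T_sm l m `<=` fil 26.
  move=> v /T_smP[c [s [s10 ->]]]; apply: (submodD H26); last exact: fil_mono s10.
  apply: (submodZ _ H26); apply: (submodD H26);
    by apply: (submodZ _ H26); exact: fil_avm.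
apply/seteqP; split.
  move=> _ [_ [d [[_ [c [[a [b [oa vb ->]]] tc ->]]] td ->]]].
  apply: (submodD H26); last exact: T26 td.
  apply: (submodD H26); last exact: T26 tc.
  apply: (submodD H26).
    by move: oa; rewrite OPUE//; exact: fil_mono.
  move: vb; rewrite VQNE// => vb j j36 j26; apply: vb => //.
  by apply/orP; right; exact: leq_trans j26.
apply: (coord_sub_gen char3 H3) => j j36; rewrite -ltnNge => j26.
have up1 v : add_set (OPU zeta) (VQN zeta) v -> add_set (add_set (add_set
    (OPU zeta) (VQN zeta)) (T_sm 1 0)) (T_sm 0 1) v.
  by move=> Hx; apply: (add_setl (HT 0 1)); exact: (add_setl (HT 1 0)).
case: (ltnP j 17) => [j17|j17].
  by apply/up1/(add_setl Hv); rewrite OPUE//; exact: fil_avm.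
case: (ltnP j 24) => [j24|j24].
  apply/up1/(add_setr Ho); rewrite VQNE//; apply: coord_sub_avm => //.
  by apply/negP => /orP[/andP[_]|]; [rewrite ltnNge j17|rewrite leqNgt j24].
have S0 : fil 10 0 by apply: submod0; exact: fil_submod.
have : j \in [:: 24; 25]%N by rewrite -[[:: _; _]]/(iota 24 2) mem_iota j24.
rewrite !inE => /orP[] /eqP ->.
  apply: (add_setl (HT 0 1)); apply: (add_setr H1); apply/T_smP; exists 1, 0.
  by rewrite !scale1r scale0r !addr0.
apply: (add_setr H2); apply/T_smP; exists 1, 0.
by rewrite !scale1r scale0r addr0 add0r.
Qed.

End Classification.

(** * Composition factors *)

Section WeightHoms.
Variable k : fieldType.

Lemma dsum_hom (A : Type) (M N V : rep k A) (f : M -> V) (g : N -> V) :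
  is_hom f -> is_hom g -> is_hom (fun v : dsum M N => f v.1 + g v.2).
Proof.
move=> fh gh; split=> [c u v|s v] /=.
  rewrite (homD _ _ fh) (homZ _ _ fh) (homD _ _ gh) (homZ _ _ gh).
  by rewrite scalerDr addrACA.
by rewrite (hom_act _ _ fh) (hom_act _ _ gh) actD.
Qed.

Lemma bij_iso (A : Type) (M N : rep k A) (f : M -> N) : is_hom f ->
  (forall m, f m = 0 -> m = 0) -> (forall n, exists m, f m = n) -> rep_iso M N.
Proof.
move=> fh f0 fs; exists f; split=> //.
have f_inj : injective f.
  move=> a b ab; apply/eqP; rewrite -subr_eq0; apply/eqP/f0.
  by rewrite (homB _ _ fh) ab subrr.
exists (fun n => projT1 (cid (fs n))) => [m|n]; last by case: cid.
by apply: f_inj; case: cid.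
Qed.

Definition mono_lift (B : finType) (deg : B -> 'S_3) p c (V : rep k ggen)
  (z : B -> V) (v : mono deg p c) : V :=
  \sum_b ((v : {ffun B -> k^o}) b : k) *: z b.

Section MonoLift.
Variables (B : finType) (deg : B -> 'S_3) (p : 'S_3 -> B -> B) (c : 'S_3 -> B -> k).
Variables (V : rep k ggen) (z : B -> V).
Local Notation lift := (@mono_lift B deg p c V z).

Lemma mono_lift_linear : linear lift.
Proof.
move=> a u v; rewrite /mono_lift scaler_sumr -big_split; apply: eq_bigr => b _ /=.
by rewrite !ffunE scalerDl scalerA.
Qed.

Lemma mono_lift_ket b : lift (ket k b) = z b.
Proof.
rewrite /mono_lift (bigD1 b)//= big1 => [|b' bb']; rewrite ffunE.
  by rewrite eqxx scale1r addr0.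
by rewrite (negPf bb') scale0r.
Qed.

Hypothesis zG : forall g b, act (Gr g) (z b) = c g b *: z (p g b).
Hypothesis zD : forall h b, act (De h) (z b) = if deg b == h then z b else 0.

Lemma mono_lift_hom : is_hom lift.
Proof.
split=> [|s v]; first exact: mono_lift_linear.
move: v; apply: mono_eq => [a u v|a u v|b].
- by rewrite (act_linear s a u v) mono_lift_linear.
- by rewrite mono_lift_linear (act_linear s a).
rewrite mono_lift_ket; case: s => g.
  by rewrite mono_GrE (linear_scale mono_lift_linear) mono_lift_ket zG.
rewrite mono_DeE zD; case: eqP => _; first exact: mono_lift_ket.
by rewrite -(scale0r 0) (linear_scale mono_lift_linear) scale0r.
Qed.

End MonoLift.

Section Rotation.
Variables (zeta : k) (zetaP : 3.-primitive_root zeta).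
Variables (V : rep k ggen) (DV : DS3_module V) (l : nat) (z : V).
Hypothesis z_tau : act (Gr tau) z = zeta ^+ l *: z.

Definition rot_family (b : bool) : V := if b then z else act (Gr sigma) z.

Lemma DS3_grM g h (v : V) : act (Gr g) (act (Gr h) v) = act (Gr (g ** h)) v.
Proof. by apply/eqP; rewrite -subr_eq0; apply/eqP; exact: (DV (rel_grM _ _ _)). Qed.

Lemma DS3_gr1 (v : V) : act (Gr 1%g) v = v.
Proof. by apply/eqP; rewrite -subr_eq0; apply/eqP; exact: (DV (rel_gr1 _)). Qed.

Lemma DS3_degr g h (v : V) :
  act (De h) (act (Gr g) v) = act (Gr g) (act (De (g^-1%g ** h ** g)) v).
Proof. by apply/eqP; rewrite -subr_eq0; apply/eqP; exact: (DV (rel_degr _ _ _)). Qed.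

(** The formula is multiplicative in g, so it is enough to check sigma and tau. *)
Lemma rot_family_G g b :
  act (Gr g) (rot_family b) = rot_coef zeta l g b *: rot_family (rot_perm g b).
Proof.
pose P g := forall b,
  act (Gr g) (rot_family b) = rot_coef zeta l g b *: rot_family (rot_perm g b).
have PM x y : P x -> P y -> P (x ** y).
  move=> Pg Ph a; rewrite -DS3_grM Ph actZ Pg scalerA mulrC.
  by rewrite -(rot_coefM zetaP) -rot_permM.
have P1 : P 1%g by move=> a; rewrite DS3_gr1 rot_coef1 rot_perm1 scale1r.
have ss : sigma ** sigma = 1%g by rewrite -[sigma]/(decode (true, z0)); apply: encode_inj; rewrite encodeM !decodeK encode1.
have ts : tau ** sigma = sigma ** (tau ** tau).
  apply: encode_inj; rewrite (encodeM tau sigma) (encodeM sigma) (encodeM tau tau).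
  by rewrite (decodeK (false, z1) : encode tau = _) (decodeK (true, z0) : encode sigma = _).
have exp_sigma : tau_exp sigma = 0%N by rewrite /tau_exp sigma_odd /= !sigmaE.
have Ps : P sigma.
  move=> a; rewrite /rot_coef exp_sigma muln0 expr0 scale1r /rot_perm sigma_odd.
  by case: a; rewrite //= DS3_grM ss DS3_gr1.
have Pt : P tau.
  move=> a; rewrite /rot_coef tau_exp_tau muln1 /rot_perm tau_odd addbF.
  case: a; first exact: z_tau.
  (* Since tau sigma = sigma tau^2, the vector sigma z has eigenvalue zeta^(2 l) = zeta^(- l). *)
  rewrite /= DS3_grM ts -(DS3_grM sigma) -(DS3_grM tau tau) z_tau actZ z_tau !actZ.
  by rewrite scalerA (zetaV zetaP) exprMn.
have PE : forall h, P h.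
  by apply: S3_ind => //; [exact: PM|exact: PM|apply: (PM) => //; exact: PM].
exact: PE.
Qed.

End Rotation.
End WeightHoms.

Lemma avec_degrees : all (fun j => all (fun c =>
    sv_zero (app (OpD c) (avec j) ++
      (if avec_deg j == c then sv_scale (-1) (avec j) else [::]))) codes) (iota 0 36).
Proof. by vm_compute. Qed.

Definition sv_sub (u v : svec) : svec := u ++ sv_scale (-1) v.

Definition tau_images : seq (nat * svec) :=
  [:: (10, avec 10); (17, sv_scale (-1) (avec 18)); (18, sv_sub (avec 17) (avec 18));
      (29, avec 30); (30, sv_sub (sv_sub (avec 10) (avec 29)) (avec 30))]%N.
Definition sigma_images : seq (nat * svec) :=
  [:: (10, avec 11); (29, avec 31); (30, sv_sub (sv_sub (avec 11) (avec 31)) (avec 32))]%N.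

Lemma tau_action :
  all (fun x => sv_zero (sv_sub (app (OpG (false, z1)) (avec x.1)) x.2)) tau_images.
Proof. by vm_compute. Qed.

Lemma sigma_action :
  all (fun x => sv_zero (sv_sub (app (OpG (true, z0)) (avec x.1)) x.2)) sigma_images.
Proof. by vm_compute. Qed.

(* The translates of a vector of degree [sigma], as a family indexed like the
   basis of [M_sigma]. *)
Definition sig_family (u : svec) (b : z3) : svec := app (OpG (false, b)) u.

Definition sigma_weight (u : svec) : bool :=
  all (fun c => all (fun b =>
      sv_zero (sv_sub (app (OpG c) (sig_family u b))
                 (sv_scale (csgn c) (sig_family u (code_conj c b)))) &&
      sv_zero (sv_sub (app (OpD c) (sig_family u b))
                 (if (true, b) == c then sig_family u b else [::]))) z3_all) codes.

Lemma sigma_weight_socle : sigma_weight (avec 0).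
Proof. by vm_compute. Qed.

(** Above the socle the y's kill these vectors only modulo the socle; on the socle they kill the
    generating weight M(sigma,-) exactly. *)
Lemma lowest_weights : all (fun a =>
    all (fun j => eq_from 10 (app (OpY a) (avec j)) [::]) [:: 10; 11; 17; 18; 24; 25]%N &&
    all (fun b => sv_zero (app (OpY a) (sig_family (avec 0) b))) z3_all) z3_all.
Proof. by vm_compute. Qed.

Section WeightLifts.
Variables (k : fieldType) (zeta : k) (zetaP : 3.-primitive_root zeta).
Variables (V : rep k ggen) (DV : DS3_module V).

Lemma rot_family_D (z : V) d : 
  (forall h, act (De h) z = if d == h then z else 0) ->
  forall h b, act (De h) (rot_family z b) =
    if (if b then d else sigma ** d ** sigma^-1%g) == h then rot_family z b else 0.
Proof.
move=> zD h [] /=; first exact: zD.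
rewrite (DS3_degr DV) zD.
have -> : (d == sigma^-1%g ** h ** sigma) = (sigma ** d ** sigma^-1%g == h).
  by apply/eqP/eqP => [->|<-]; rewrite !mulgA ?mulgV ?mulVg ?mul1g ?mulgK ?mulgKV.
by case: eqP => // _; rewrite act0.
Qed.

Lemma M_tau_lift l (z : V) :
  (forall h, act (De h) z = if tau == h then z else 0) ->
  act (Gr tau) z = zeta ^+ l *: z ->
  is_hom (mono_lift (rot_family z) : M_tau zeta l -> V).
Proof.
move=> zD zT; apply: mono_lift_hom => [g b|h b]; first exact: rot_family_G.
rewrite (rot_family_D zD); case: b => //=.
have -> : sigma ** tau ** sigma^-1%g = tau^-1%g; last by [].
apply: encode_inj; rewrite !encodeV (encodeM (sigma ** tau)) (encodeM sigma) encodeV.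
by rewrite (decodeK (false, z1) : encode tau = _) (decodeK (true, z0) : encode sigma = _).
Qed.

Lemma M_rho_lift (z : V) :
  (forall h, act (De h) z = if 1%g == h then z else 0) ->
  act (Gr tau) z = zeta *: z ->
  is_hom (mono_lift (rot_family z) : M_rho zeta -> V).
Proof.
move=> zD zT; apply: mono_lift_hom => [g b|h b]; first exact: rot_family_G.
by rewrite (rot_family_D zD) mul1g mulVg if_same.
Qed.

End WeightLifts.

Section Factors.
Variables (k : fieldType) (char3 : 3%:R != 0 :> k) (char2 : 2%:R != 0 :> k).
Variables (zeta : k) (zetaP : 3.-primitive_root zeta).
Local Notation M := (verma_sm k).
Local Notation HM := (restrict H M).
Local Notation acf := (@acf k).
Local Notation avm := (@avm k).
Local Notation fil := (@fil k).
Local Notation DM := (@verma_D_module k (M_sigma k true)).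

Lemma HM_DS3 : DS3_module HM.
Proof. by move=> v Dv; apply: DM; exact: rel_DS3. Qed.

Lemma vec_sub u v : vec (sig_mon k) (sv_sub u v) = vec (sig_mon k) u - vec (sig_mon k) v.
Proof. by rewrite vec_cat vec_scale scaleN1r. Qed.

Lemma vec_eq u v : sv_zero (sv_sub u v) -> vec (sig_mon k) u = vec (sig_mon k) v.
Proof. by move=> /(vec_zero (sig_mon k))/eqP; rewrite vec_sub subr_eq0 => /eqP. Qed.

Lemma avm_D j h : (j < 36)%N ->
  act (H (De h)) (avm j) = if decode (avec_deg j) == h then avm j else 0.
Proof.
move=> j36; rewrite -(op_ofK (H (De h))) [gen_of _]/= -/(gen_of (OpD (encode h))) /avm.
rewrite sig_app -(inj_eq encode_inj) decodeK.
have := vec_zero (sig_mon k) (allP (iota_all avec_degrees (i := j) j36) _ (mem_codes (encode h))).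
case: eqP => _; last by rewrite cats0.
by rewrite vec_cat vec_scale scaleN1r => /eqP; rewrite subr_eq0 => /eqP.
Qed.

Lemma act_tau_avm j u : (j, u) \in tau_images ->
  act (H (Gr tau)) (avm j) = vec (sig_mon k) u.
Proof.
move=> ju; have -> : act (H (Gr tau)) (avm j) = vec (sig_mon k) (app (OpG (false, z1)) (avec j)).
  exact: (sig_app k (OpG (false, z1))).
exact/vec_eq/(allP tau_action _ ju).
Qed.

Lemma act_sigma_avm j u : (j, u) \in sigma_images ->
  act (H (Gr sigma)) (avm j) = vec (sig_mon k) u.
Proof.
move=> ju; have -> : act (H (Gr sigma)) (avm j) = vec (sig_mon k) (app (OpG (true, z0)) (avec j)).
  exact: (sig_app k (OpG (true, z0))).
exact/vec_eq/(allP sigma_action _ ju).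
Qed.

Lemma M_sigma_lift u : sigma_weight u ->
  is_hom (mono_lift (V := HM) (fun a => vec (sig_mon k) (sig_family u (zcode a))) :
    M_sigma k true -> HM).
Proof.
move=> uW.
have W c b := allP (allP uW c (mem_codes c)) b (mem_z3 b).
apply: mono_lift_hom => [g a|h a].
  have /andP[/vec_eq E _] := W (encode g) (zcode a).
  rewrite [act _ _](_ : _ = vec (sig_mon k) (app (OpG (encode g)) (sig_family u (zcode a)))).
    by rewrite E vec_scale -sgn_encode zcode_conj.
  by rewrite -sig_app [gen_of _]/= encodeK.
have /andP[_ /vec_eq E] := W (encode h) (zcode a).
rewrite [act _ _](_ : _ = vec (sig_mon k) (app (OpD (encode h)) (sig_family u (zcode a)))).
  rewrite E -encode_transp (inj_eq encode_inj); case: eqP => //.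
  by rewrite vec_nil.
by rewrite -sig_app [gen_of _]/= encodeK.
Qed.

End Factors.

Lemma trivial_weights_exact : all (fun j => all (fun c =>
    sv_zero (sv_sub (app (OpG c) (avec j)) (avec j))) codes) [:: 24; 25]%N.
Proof. by vm_compute. Qed.

Section CompositionFactors.
Variables (k : fieldType) (char3 : 3%:R != 0 :> k) (char2 : 2%:R != 0 :> k).
Variables (zeta : k) (zetaP : 3.-primitive_root zeta).
Local Notation M := (verma_sm k).
Local Notation HM := (restrict H M).
Local Notation acf := (@acf k).
Local Notation avm := (@avm k).
Local Notation fil := (@fil k).
Local Notation DM := (@verma_D_module k (M_sigma k true)).

Lemma lowest_Y a j : j \in [:: 10; 11; 17; 18; 24; 25]%N ->
  fil 10 (act (Y a) (avm j)).
Proof.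
move=> jin; have /andP[/allP/(_ _ jin) E _] := allP lowest_weights _ (mem_z3 (zcode a)).
have -> : act (Y a) (avm j) = vec (sig_mon k) (app (OpY (zcode a)) (avec j)).
  by rewrite -sig_app [gen_of _]/= zcodeK.
rewrite -[vec _ _]subr0 -(vec_nil (sig_mon k)); apply: eq_from_fil => //.
exact/app_supported/avec_supported.
Qed.

(** By y_a g = sgn(g) g y_(g^-1 a g), only one vector of each weight has to be tested against the
    y's. *)
Lemma Y_translate (U : set M) g z : is_submod U -> (forall a, U (act (Y a) z)) ->
  forall a, U (act (Y a) (act (H (Gr g)) z)).
Proof.
move=> HU UY a; have /eqP := DM (rel_ygr g a z); rewrite subr_eq0 => /eqP ->.
by apply: (submodZ _ HU); apply: (submod_act _ HU).
Qed.

Section Factor.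
Variables (a b : nat) (Ha : is_submod (fil a)) (Hb : is_submod (fil b)).
Variables (B : finType) (deg : B -> 'S_3) (p : 'S_3 -> B -> B) (c : 'S_3 -> B -> k).
Variables (z : B -> HM) (b0 : B).
Hypothesis ab : (a <= b)%N.
Hypothesis weight_simple : simple (mono deg p c).
Hypothesis z_hom : is_hom (mono_lift z : mono deg p c -> HM).
Hypothesis zb : forall i, fil b (z i).
Hypothesis zY : forall x i, fil a (@act k gen M (Y x) (z i)).
Hypothesis za : ~ fil a (z b0).
Hypothesis gen_factor : forall (Z : set M) y i, is_submod Z -> fil a `<=` Z ->
  Z `<=` fil b -> Z y -> (a <= i < b)%N -> acf i y != 0 ->
  forall j, (a <= j < b)%N -> Z (avm j).

(** [gen_factor], saying that any vector of [Z] outside [fil a] generates the whole step, gives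
    simplicity; the family [z], killed by the y's modulo [fil a], identifies the factor as a simple
    head. *)
Lemma factor_iso :
  [/\ fil a `<=` fil b, simple (subquo (Submod Ha) (Submod Hb)) &
      rep_iso (subquo (Submod Ha) (Submod Hb)) (simple_head (mono deg p c))].
Proof.
have ab_sub : fil a `<=` fil b by exact: fil_mono.
have S_simple : simple (subquo (Submod Ha) (Submod Hb)).
  apply: subquo_simple => //=; first by exists (z b0).
  move=> Z HZ aZ Zb [y Zy ya].
  have [i [i36 ai yi]] : exists i, [/\ (i < 36)%N, (a <= i)%N & acf i y != 0].
    apply: contrapT => nE; apply: ya => i i36 ai; apply/eqP; apply: contraT => yi.
    by case: nE; exists i.
  have ib : (i < b)%N.
    rewrite ltnNge; apply/negP => bi; move/eqP: yi; apply.
    exact: (Zb y Zy i i36 bi).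
  apply: (coord_sub_gen char3 HZ) => j j36; rewrite -ltnNge => jb.
  case: (ltnP j a) => [ja|aj]; first exact/aZ/fil_avm.
  by apply: (gen_factor HZ aZ Zb Zy (i := i)) => //; rewrite ?ai ?aj.
split=> //.
apply: (subquo_head weight_simple (phi := (mono_lift z : mono deg p c -> M))) => //.
- exact: DM.
- exact: (z_hom.1).
- by move=> s m; exact: (hom_act s m z_hom).
- by move=> m; apply: (submod_sum _ Hb) => i _; exact: (submodZ _ Hb).
- move=> x m; have -> : act (Y x) (mono_lift z m : M) =
      \sum_i ((m : {ffun B -> k^o}) i : k) *: @act k gen M (Y x) (z i).
    by rewrite [LHS]act_sum; apply: eq_bigr => i _; rewrite actZ.
  by apply: (submod_sum _ Ha) => i _; exact: (submodZ _ Ha).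
- by exists (ket k b0); rewrite mono_lift_ket.
Qed.

End Factor.

End CompositionFactors.

Section Chain.
Variables (k : fieldType) (char3 : 3%:R != 0 :> k) (char2 : 2%:R != 0 :> k).
Variables (zeta : k) (zetaP : 3.-primitive_root zeta).
Local Notation M := (verma_sm k).
Local Notation HM := (restrict H M).
Local Notation acf := (@acf k).
Local Notation avm := (@avm k).
Local Notation fil := (@fil k).

Definition factor_spec (a b : nat) (L : rep k gen) : Prop :=
  forall (Ha : is_submod (fil a)) (Hb : is_submod (fil b)),
  [/\ fil a `<=` fil b, simple (subquo (Submod Ha) (Submod Hb)) &
      rep_iso (subquo (Submod Ha) (Submod Hb)) L].

Lemma fil10_proper n : (10 <= n)%N -> fil 10 `<=` fil n.
Proof. exact: fil_mono. Qed.

Lemma socle_factor : factor_spec 0 10 (simple_head (M_sigma k true)).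
Proof.
move=> H0 H10.
have sW : sigma_weight (avec 0) by exact: sigma_weight_socle.
apply: (factor_iso char3 H0 H10 (b0 := t12) _ (M_sigma_simple k true) (M_sigma_lift k sW)) => //.
- move=> a; rewrite /sig_family -sig_app.
  by apply: (submod_act _ H10); exact: fil_avm.
- move=> x a; have -> : @act k gen M (Y x) (vec (sig_mon k) (sig_family (avec 0) (zcode a)))
      = vec (sig_mon k) (app (OpY (zcode x)) (sig_family (avec 0) (zcode a))).
    by rewrite -sig_app [gen_of _]/= zcodeK.
  rewrite vec_zero; first exact: (submod0 H0).
  have /andP[_ /allP E] := allP lowest_weights _ (mem_z3 (zcode x)).
  exact: E (mem_z3 _).
- move=> /(_ 0 isT isT)/eqP; rewrite acf_vec ?app_supported ?avec_supported//.
  rewrite (trzK z0 : zcode t12 = z0).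
  rewrite (_ : pairing _ _ = 3); last by vm_compute.
  by rewrite mulVf// oner_eq0.
move=> Z y i HZ _ Z10 Zy _ yi j /andP[_ j10].
apply: (socle_minimal char3 HZ Zy).
  by move=> y0; rewrite y0 acf0 eqxx in yi.
by apply: fil_avm => //; exact: ltn_trans j10 _.
Qed.

Lemma act_Gr_fil n g v : is_submod (fil n) -> fil n v -> fil n (act (H (Gr g)) v).
Proof. by move=> Hn; exact: submod_act. Qed.

Lemma opu_factor : factor_spec 10 17 (simple_head (M_tau zeta 0)).
Proof.
move=> H10 H17.
have zD h : act (H (De h)) (avm 10) = if tau == h then avm 10 else 0.
  by rewrite avm_D.
have zT : act (H (Gr tau)) (avm 10) = zeta ^+ 0 *: avm 10.
  by rewrite scale1r; exact: (act_tau_avm k (u := avec 10)).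
have hom := M_tau_lift zetaP (HM_DS3 (k := k)) zD zT.
have z17 : fil 17 (avm 10) by exact: fil_avm.
have zY a : fil 10 (act (Y a) (avm 10)) by exact: lowest_Y.
apply: (factor_iso char3 H10 H17 (b0 := true) _ (M_tau_simple zetaP 0) hom) => //.
- by case=> //; exact: act_Gr_fil.
- by move=> x [] //; exact: Y_translate.
- exact: fil_notin.
move=> Z y i HZ Z10 Z17 Zy /andP[i10 i17] yi j /andP[j10 j17].
apply: (isolate_gen char3 HZ Z10 (fil_mono _ (Z17 _ Zy)) Zy _ yi) => //.
- by rewrite i10 (ltn_trans i17).
- by rewrite j10 (ltn_trans j17).
- by rewrite i17 j17.
Qed.

Lemma vqn_factor : factor_spec 17 24 (simple_head (M_rho zeta)).
Proof.
move=> H17 H24.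
(* The opposite of [vec_v]: tau sends entries 17 and 18 to -18 and 17 - 18, and this is its
   eigenvector for zeta. *)
set z := avm 17 + zeta *: avm 18.
have zD h : act (H (De h)) z = if 1%g == h then z else 0.
  by rewrite /z actD actZ !avm_D// -[decode _]/1%g; case: eqP => // _; rewrite scaler0 addr0.
have zT : act (H (Gr tau)) z = zeta *: z.
  have T17 := act_tau_avm k (j := 17%N) (u := sv_scale (-1) (avec 18)) isT.
  have T18 := act_tau_avm k (j := 18%N) (u := sv_sub (avec 17) (avec 18)) isT.
  have E (V : lmodType k) (a b : V) : - b + zeta *: (a - b) = zeta *: (a + zeta *: b).
    have -> : zeta *: (a + zeta *: b) = zeta *: a + (- (1 + zeta)) *: b.
      rewrite scalerDr scalerA; congr (_ + _ *: _).
      by apply/eqP; rewrite -addr_eq0 addrC (zeta_sum zetaP).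
    by rewrite scaleNr scalerDl scale1r scalerBr opprD addrCA.
  by rewrite /z actD actZ T17 T18 vec_sub vec_scale scaleN1r; exact: E.
have hom := M_rho_lift zetaP (HM_DS3 (k := k)) zD zT.
have z24 : fil 24 z.
  by apply: (submodD H24); [|apply: (submodZ _ H24)]; exact: fil_avm.
have zY a : fil 17 (act (Y a) z).
  rewrite actD actZ; apply: (submodD H17); [|apply: (submodZ _ H17)];
    by apply: (fil10_proper (n := 17)) => //; exact: lowest_Y.
apply: (factor_iso char3 H17 H24 (b0 := true) _ (M_rho_simple zetaP) hom) => //.
- by case=> //; exact: act_Gr_fil.
- by move=> x [] //; exact: Y_translate.
- move=> /(_ 17%N isT isT)/eqP; rewrite acfD acfZ !acf_avm//= mulr0 addr0.
  by rewrite oner_eq0.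
move=> Z y i HZ Z17 Z24 Zy /andP[i17 i24] yi j /andP[j17 j24].
have Z10 : fil 10 `<=` Z by move=> v v10; apply: Z17; exact: fil10_proper v10.
apply: (isolate_gen char3 HZ Z10 (fil_mono _ (Z24 _ Zy)) Zy _ yi) => //.
- by rewrite i24 (leq_trans _ i17).
- by rewrite j24 (leq_trans _ j17).
- by rewrite (leq_gtF i17) (leq_gtF j17).
Qed.

Lemma trivial_lift j : j \in [:: 24; 25]%N ->
  is_hom (mono_lift (V := HM) (fun _ => avm j) : M_e k false -> HM).
Proof.
move=> jin; apply: mono_lift_hom => [g b|h b].
  rewrite scale1r -[g]encodeK.
  have -> : act (Gr (decode (encode g))) (avm j : HM) = vec (sig_mon k) (app (OpG (encode g)) (avec j)).
    exact: (sig_app k (OpG (encode g))).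
  apply: vec_eq; exact: (allP (allP trivial_weights_exact _ jin) _ (mem_codes _)).
have j36 : (j < 36)%N by move: jin; rewrite !inE => /orP[] /eqP ->.
have -> : act (De h) (avm j : HM) = act (H (De h)) (avm j) by [].
rewrite avm_D//; suff -> : decode (avec_deg j) = 1%g by [].
by move: jin; rewrite !inE => /orP[] /eqP ->.
Qed.

Lemma trivial_factor j : j \in [:: 24; 25]%N ->
  factor_spec j j.+1 (simple_head (M_e k false)).
Proof.
move=> jin Ha Hb.
have [j36 j24 j26] : [/\ j < 36, 24 <= j & j < 26]%N.
  by move: jin; rewrite !inE => /orP[] /eqP ->.
have hom := trivial_lift jin.
apply: (factor_iso char3 Ha Hb (b0 := tt) _ (M_e_simple k false) hom) => //.
- by move=> _; exact: fil_avm.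
- move=> x _; apply: (fil10_proper (n := j)); first exact: leq_trans j24.
  by apply: lowest_Y; rewrite !inE in jin *; case/orP: jin => ->; rewrite !orbT.
- exact: fil_notin.
move=> Z y i HZ Zj Zj1 Zy /andP[ji ij] yi l /andP[jl lj].
have lj' : l = j by apply/eqP; rewrite eqn_leq jl andbT.
have ij' : i = j by apply/eqP; rewrite eqn_leq ji andbT.
rewrite lj'; rewrite ij' in yi.
have Z10 : fil 10 `<=` Z by move=> v v10; apply/Zj/(fil10_proper _ v10); exact: leq_trans j24.
have y26 : fil 26 y by apply: (fil_mono _ (Zj1 _ Zy)).
have := symmetrize_in char3 char2 HZ Z10 y26 Zy.
(* The symmetrizer yields a combination of both lines. For j = 24 the coordinate 25 vanishes on
   [fil 25]; for j = 25 the other line lies in [fil 25] and is subtracted. *)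
move: jin yi Zj Zj1; rewrite !inE => /orP[] /eqP -> yi Zj Zj1.
  have -> : acf 25 y = 0 by exact: (Zj1 _ Zy 25%N).
  by rewrite scale0r addr0 => /(submod_unscale HZ yi).
move=> Zs; apply: (submod_unscale HZ yi).
rewrite -[_ *: _](addKr (acf 24 y *: avm 24)) addrC; apply: (submodB HZ) => //.
by apply: (submodZ _ HZ); apply: Zj; exact: fil_avm.
Qed.

Lemma vac_lift : is_hom (mono_lift (V := HM) (fun a => vac k (zcode a)) : M_sigma k true -> HM).
Proof.
apply: mono_lift_hom => [g a|h a].
  have E := vac_g k (encode g) (zcode a).
  by rewrite encodeK -sgn_encode -zcode_conj in E.
have E := vac_d k (encode h) (zcode a).
by rewrite encodeK -encode_transp (inj_eq encode_inj) in E.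
Qed.

Lemma head_factor : factor_spec 26 36 (simple_head (M_sigma k true)).
Proof.
move=> H26 H36.
have vacE : vac k z0 = avm 26 by rewrite /avm [avec 26]/= vec1.
apply: (factor_iso char3 H26 H36 (b0 := t12) _ (M_sigma_simple k true) vac_lift) => //.
- by move=> a i i36 ni; move: i36; rewrite ltnNge (ni : (36 <= i)%N).
- move=> x a; have -> : @act k gen M (Y x) (vac k (zcode a)) = 0.
    by rewrite -(zcodeK x); exact: vac_y.
  exact: submod0.
- by rewrite (trzK z0 : zcode t12 = z0) vacE; exact: fil_notin.
move=> Z y i HZ _ _ Zy /andP[i26 i36] yi j _.
suff -> : Z = setT by [].
apply: contrapT => ZT; move/eqP: yi; apply.
have Zs := proper_fil char3 HZ ZT; exact: (Zs y Zy i i36 i26).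
Qed.

Lemma fil36 : fil 36 = setT.
Proof. by apply/seteqP; split=> // v _ i i36 ni; move: i36; rewrite ltnNge (ni : (36 <= i)%N). Qed.

Lemma verma_composition : has_composition_factors M
  [:: simple_head (M_sigma k true); simple_head (M_tau zeta 0);
      simple_head (M_rho zeta); simple_head (M_e k false);
      simple_head (M_e k false); simple_head (M_sigma k true)].
Proof.
have Hn n : n \in [:: 0; 10; 17; 24; 25; 26; 36]%N -> is_submod (fil n).
  exact: fil_submod.
pose F n (n_in : n \in [:: 0; 10; 17; 24; 25; 26; 36]%N) := Submod (Hn n n_in).
(* The seventh term, N 6, is the default value: the whole module. *)
pose N i := nth (F 36%N isT) [:: F 0%N isT; F 10%N isT; F 17%N isT; F 24%N isT;
  F 25%N isT; F 26%N isT] i.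
exists N, 1%g; split.
- by apply/seteqP; split=> v; [move=> /(fil0 char3)|move=> ->; exact: submod0 (Hn 0%N isT)].
- exact: fil36.
case=> [[|[|[|[|[|[|//]]]]]] i6]; rewrite perm1 /N /=.
- exact: socle_factor.
- exact: opu_factor.
- exact: vqn_factor.
- exact: (@trivial_factor 24).
- exact: (@trivial_factor 25).
- exact: head_factor.
Qed.

End Chain.

(** * The head *)

(** Generates the second copy of M(sigma,-) in the head. Its middle term lies in the radical and
    makes S_3 act exactly, not only modulo the radical; the translates are plus or minus twice
    entries 33 to 35 there. *)
Definition sv_head2 : svec :=
  [:: (1, ([:: z2; z0], z1)); (-1, ([:: z0; z2], z2)); (-1, ([:: z2; z1], z2))].

Lemma sigma_weight_head2 : sigma_weight sv_head2.
Proof. by vm_compute. Qed.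

Lemma head2_coords : supported sv_head2 &&
  all (fun b => all (fun i =>
    let n := pairing (covec i) (sig_family sv_head2 b) in
    if (i == 33 + z3_val b)%N
    then (n == 6) || (n == -6) else n == 0) (iota 26 10)) z3_all.
Proof. by vm_compute. Qed.

Section Head.
Variables (k : fieldType) (char3 : 3%:R != 0 :> k) (char2 : 2%:R != 0 :> k).
Variables (zeta : k) (zetaP : 3.-primitive_root zeta).
Local Notation M := (verma_sm k).
Local Notation HM := (restrict H M).
Local Notation acf := (@acf k).
Local Notation avm := (@avm k).
Local Notation fil := (@fil k).

(* The [zeta ^ l]-eigenvector of [tau] generated by [x12 |23>]. *)
Definition tau_vec (l : nat) : M :=
  avm 29 + zeta ^+ (2 * l) *: avm 30 + zeta ^+ l *: (avm 10 - avm 29 - avm 30).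

Lemma tau_vec_D l h : act (H (De h)) (tau_vec l) = if tau == h then tau_vec l else 0.
Proof.
have D10 : act (H (De h)) (avm 10) = if tau == h then avm 10 else 0 by rewrite avm_D.
have D29 : act (H (De h)) (avm 29) = if tau == h then avm 29 else 0 by rewrite avm_D.
have D30 : act (H (De h)) (avm 30) = if tau == h then avm 30 else 0 by rewrite avm_D.
rewrite /tau_vec !actD !actZ !actD !actN D10 D29 D30.
by case: eqP => // _; rewrite !subr0 !scaler0 !addr0.
Qed.

Lemma act_tau30 : act (H (Gr tau)) (avm 30) = avm 10 - avm 29 - avm 30.
Proof.
by rewrite (act_tau_avm k (j := 30%N) (u := sv_sub (sv_sub (avec 10) (avec 29)) (avec 30)))
  // !vec_sub.
Qed.

Lemma act_sigma30 : act (H (Gr sigma)) (avm 30) = avm 11 - avm 31 - avm 32.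
Proof.
by rewrite (act_sigma_avm k (j := 30%N) (u := sv_sub (sv_sub (avec 11) (avec 31)) (avec 32)))
  // !vec_sub.
Qed.

(** tau permutes x_12 |23>, x_23 |13> and x_13 |12> cyclically, and the last of these is entry 10
    minus entries 29 and 30. *)
Lemma tau_vec_tau l : act (H (Gr tau)) (tau_vec l) = zeta ^+ l *: tau_vec l.
Proof.
have T10 : act (H (Gr tau)) (avm 10) = avm 10 by exact: (act_tau_avm k (u := avec 10)).
have T29 : act (H (Gr tau)) (avm 29) = avm 30.
  exact: (act_tau_avm k (j := 29%N) (u := avec 30)).
have E (V : lmodType k) (a b c : V) (w : k) : w ^+ 3 = 1 ->
    b + w ^+ 2 *: c + w *: a = w *: (a + w ^+ 2 *: b + w *: c).
  move=> w3; rewrite !scalerDr !scalerA -expr2 -exprS w3 scale1r.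
  by rewrite addrC addrA.
have w3 : (zeta ^+ l) ^+ 3 = 1 by rewrite exprAC (zeta3 zetaP) expr1n.
rewrite /tau_vec mulnC exprM !actD !actZ !actD !actN T10 T29 act_tau30.
rewrite -E//; congr (_ + _ *: _).
by rewrite opprB addrA subrK opprB addrC subrK.
Qed.

Lemma sigma_tau_vec l : act (H (Gr sigma)) (tau_vec l) =
  avm 31 + zeta ^+ (2 * l) *: (avm 11 - avm 31 - avm 32) + zeta ^+ l *: avm 32.
Proof.
have S10 : act (H (Gr sigma)) (avm 10) = avm 11.
  exact: (act_sigma_avm k (j := 10%N) (u := avec 11)).
have S29 : act (H (Gr sigma)) (avm 29) = avm 31.
  exact: (act_sigma_avm k (j := 29%N) (u := avec 31)).
rewrite /tau_vec !actD !actZ !actD !actN S10 S29 act_sigma30; congr (_ + _ *: _).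
by rewrite opprB addrC subrK.
Qed.

Local Notation f1 := (mono_lift (V := HM) (fun a => vac k (zcode a)) : M_sigma k true -> HM).
Local Notation ft l := (mono_lift (V := HM) (rot_family (V := HM) (tau_vec l)) : M_tau zeta l -> HM).
Local Notation f4 := (mono_lift (V := HM)
  (fun a => vec (sig_mon k) (sig_family sv_head2 (zcode a))) : M_sigma k true -> HM).

Lemma f1_hom : is_hom f1.
Proof. exact: vac_lift. Qed.

Lemma ft_hom l : is_hom (ft l).
Proof.
apply: (M_tau_lift zetaP (HM_DS3 (k := k))) => [h|]; first exact: tau_vec_D.
exact: tau_vec_tau.
Qed.

Lemma f4_hom : is_hom f4.
Proof. exact: (M_sigma_lift k sigma_weight_head2). Qed.

Definition head_weights : rep k ggen :=
  dsum (dsum (dsum (M_sigma k true) (M_tau zeta 1)) (M_tau zeta 2)) (M_sigma k true).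

Definition head_map (m : head_weights) : HM :=
  f1 m.1.1.1 + ft 1 m.1.1.2 + ft 2 m.1.2 + f4 m.2.

Lemma head_map_hom : is_hom head_map.
Proof. exact: dsum_hom (dsum_hom (dsum_hom f1_hom (ft_hom 1)) (ft_hom 2)) f4_hom. Qed.

Lemma vac_avm b : vac k b = avm (26 + z3_val b)%N.
Proof. by case: b; rewrite /avm [avec _]/= vec1. Qed.

Lemma acf_sums (B : finType) deg p c (z : B -> HM) (v : mono deg p c) i :
  acf i (mono_lift z v) = \sum_b ((v : {ffun B -> k^o}) b : k) * acf i (z b).
Proof. by rewrite /mono_lift acf_sum; apply: eq_bigr => b _; rewrite acfZ. Qed.

Lemma sum_only (B : finType) (f : B -> k) b0 : (forall b, b != b0 -> f b = 0) ->
  \sum_b f b = f b0.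
Proof. by move=> f0; rewrite (bigD1 b0)//= big1 ?addr0. Qed.

Lemma acf_tau_vec i l : (26 <= i < 36)%N -> acf i (tau_vec l) =
  if i == 29%N then 1 - zeta ^+ l
  else if i == 30%N then zeta ^+ (2 * l) - zeta ^+ l else 0.
Proof.
move=> /andP[i26 i36]; rewrite /tau_vec !acfD !acfZ !acfB !acf_avm//.
rewrite (_ : (i == 10)%N = false); last by apply/negbTE; rewrite gtn_eqF ?(leq_trans _ i26).
have [->|i29] := eqVneq i 29%N; first by rewrite /= mulr0 addr0 subr0 sub0r mulrN1.
by case: eqVneq => _; rewrite /= ?mulr0 ?mulr1 !subr0 ?sub0r ?mulr0 ?mulrN1 ?add0r ?addr0.
Qed.

Lemma acf_sigma_tau_vec i l : (26 <= i < 36)%N ->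
  acf i (act (H (Gr sigma)) (tau_vec l)) =
  if i == 31%N then 1 - zeta ^+ (2 * l)
  else if i == 32%N then zeta ^+ l - zeta ^+ (2 * l) else 0.
Proof.
move=> /andP[i26 i36]; rewrite sigma_tau_vec !acfD !acfZ !acfB !acf_avm//.
rewrite (_ : (i == 11)%N = false); last by apply/negbTE; rewrite gtn_eqF ?(leq_trans _ i26).
have [->|i31] := eqVneq i 31%N; first by rewrite /= mulr0 addr0 subr0 sub0r mulrN1.
case: eqVneq => _; rewrite /= ?mulr0 ?mulr1 !subr0 ?sub0r ?mulr0 ?mulrN1 ?add0r ?addr0//.
by rewrite addrC.
Qed.

Lemma acf_head2 i b : (26 <= i < 36)%N ->
  (acf i (vec (sig_mon k) (sig_family sv_head2 b)) != 0) =
  (i == 33 + z3_val b)%N.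
Proof.
move=> ir; have /andP[us /allP/(_ b (mem_z3 b))] := head2_coords.
move=> /iota_all/(_ ir) /=; rewrite acf_vec ?app_supported//.
have n6 : 6%:~R != 0 :> k by rewrite (intrM _ 2 3) mulf_neq0.
case: ifP => _; last by move=> /eqP ->; rewrite mulr0 eqxx.
by case/orP=> /eqP ->; rewrite mulf_neq0 ?invr_neq0// intrN oppr_eq0.
Qed.

Lemma acf_f1 i (v : M_sigma k true) : (26 <= i < 36)%N ->
  acf i (f1 v) = \sum_a ((v : {ffun transp -> k^o}) a : k) * (i == 26 + z3_val (zcode a))%N%:R.
Proof.
move=> /andP[_ i36]; rewrite acf_sums; apply: eq_bigr => a _.
by rewrite vac_avm acf_avm//; case: (zcode a).
Qed.

Lemma acf_ft i l (v : M_tau zeta l) : acf i (ft l v) =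
  ((v : {ffun bool -> k^o}) true : k) * acf i (tau_vec l) +
  ((v : {ffun bool -> k^o}) false : k) * acf i (act (H (Gr sigma)) (tau_vec l)).
Proof. by rewrite acf_sums big_bool. Qed.

(** The second equation is (zeta^2 - zeta)(x - y) = 0, so x = y, and the first becomes (2 - zeta -
    zeta^2) x = 3 x = 0. *)
Lemma zeta_system (x y : k) :
  x * (1 - zeta) + y * (1 - zeta ^+ 2) = 0 ->
  x * (zeta ^+ 2 - zeta) + y * (zeta - zeta ^+ 2) = 0 -> x = 0 /\ y = 0.
Proof.
move=> E1 E2.
have z2 : zeta ^+ 2 = - 1 - zeta.
  by apply/eqP; rewrite -subr_eq0 -(zeta_sum zetaP); apply/eqP; ring.
have z20 : zeta ^+ 2 - zeta != 0.
  rewrite expr2 -{3}[zeta]mulr1 -mulrBr; apply: mulf_neq0; first exact: zeta_neq0 zetaP.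
  by rewrite subr_eq0; exact: zeta_neq1 zetaP.
have xy : x = y.
  apply/eqP; rewrite -subr_eq0; apply/eqP; apply: (mulfI z20); rewrite mulr0 -[RHS]E2.
  by ring.
have x0 : x = 0.
  apply: (mulfI char3); rewrite mulr0 -[RHS]E1 -xy z2; ring.
by rewrite -xy.
Qed.

(** The coordinates split into blocks: 26-28 see only the first M(sigma,-), 33-35 only the last one,
    and 29-32 the two M(tau,l), where injectivity is the system above. *)
Lemma head_map_injective (m : head_weights) : fil 26 (head_map m) -> m = 0.
Proof.
case: m => [[[m1 m2] m3] m4] Hm.
have C i : (26 <= i < 36)%N ->
    acf i (f1 m1) + acf i (ft 1 m2) + acf i (ft 2 m3) + acf i (f4 m4) = 0.
  by move=> /andP[i26 i36]; rewrite -!acfD; exact: Hm i i36 i26.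
have C1 i : (29 <= i < 36)%N -> acf i (f1 m1) = 0.
  move=> /andP[i29 i36]; rewrite acf_f1 ?i36 ?(leq_trans _ i29)// big1// => a _.
  rewrite gtn_eqF ?mulr0//; apply: leq_trans i29.
  by case: (zcode a).
have C4 i : (26 <= i < 33)%N -> acf i (f4 m4) = 0.
  move=> /andP[i26 i33]; have ir : (26 <= i < 36)%N by rewrite i26 (ltn_trans i33).
  rewrite acf_sums big1// => a _; apply/eqP; rewrite mulf_eq0; apply/orP; right.
  by rewrite -[_ == _]negbK acf_head2// ltn_eqF// (leq_trans i33)// leq_addr.
have Ct i l (v : M_tau zeta l) : (26 <= i < 36)%N -> (i < 29)%N || (33 <= i)%N ->
    acf i (ft l v) = 0.
  move=> ir i_out; rewrite acf_ft acf_tau_vec// acf_sigma_tau_vec//.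
  by do !(case: eqVneq => [i_eq|_]; first by rewrite i_eq in i_out); rewrite !mulr0 addr0.
have m10 : m1 = 0.
  apply/ffunP => a; rewrite ffunE -[a]zcodeK.
  have ir : (26 <= 26 + z3_val (zcode a) < 29)%N by case: (zcode a).
  have /andP[ir1 ir2] := ir.
  have := C _ (_ : (26 <= 26 + z3_val (zcode a) < 36)%N); rewrite ir1 (leq_trans ir2)//.
  rewrite Ct ?ir1 ?ir2 ?(leq_trans ir2)// Ct ?ir1 ?ir2 ?(leq_trans ir2)// C4 ?ir1 ?(leq_trans ir2)//.
  rewrite !addr0 acf_f1 ?ir1 ?(leq_trans ir2)// => /(_ isT) <-.
  rewrite (@sum_only _ _ a) ?eqxx ?mulr1 ?zcodeK// => b ba.
  rewrite eqn_add2l (_ : _ == _ = false) ?mulr0//.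
  apply: contraNF ba; rewrite -(can_eq zcodeK).
  by case: (zcode a) (zcode b) => [] [].
have m40 : m4 = 0.
  apply/ffunP => a; rewrite ffunE -[a]zcodeK.
  have ir : (33 <= 33 + z3_val (zcode a) < 36)%N by case: (zcode a).
  have /andP[ir1 ir2] := ir.
  have := C _ (_ : (26 <= 33 + z3_val (zcode a) < 36)%N); rewrite (leq_trans _ ir1)// ir2.
  rewrite Ct ?ir1 ?ir2 ?orbT ?(leq_trans _ ir1)// Ct ?ir1 ?ir2 ?orbT ?(leq_trans _ ir1)//.
  rewrite C1 ?ir2 ?(leq_trans _ ir1)// !add0r acf_sums (@sum_only _ _ a) => [/(_ isT)/eqP|b ba].
    rewrite mulf_eq0 -[X in _ || X]negbK acf_head2 ?ir2 ?(leq_trans _ ir1)// eqxx orbF.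
    by rewrite zcodeK => /eqP.
  apply/eqP; rewrite mulf_eq0 -[X in _ || X]negbK acf_head2 ?ir2 ?(leq_trans _ ir1)//.
  rewrite eqn_add2l; apply/orP; right; apply: contra ba; rewrite -(can_eq zcodeK).
  by case: (zcode a) (zcode b) => [] [].
have z4 : zeta ^+ (2 * 2) = zeta by rewrite -[(2 * 2)%N]/4%N exprS (zeta3 zetaP) mulr1.
have [x0 y0] : m2 true = 0 /\ m3 true = 0.
  apply: zeta_system.
    have := C 29%N isT; rewrite C1// C4// !acf_ft !acf_tau_vec// !acf_sigma_tau_vec//=.
    by rewrite !mulr0 !addr0 add0r expr1.
  have := C 30%N isT; rewrite C1// C4// !acf_ft !acf_tau_vec// !acf_sigma_tau_vec//=.
  by rewrite !mulr0 !addr0 add0r expr1 z4.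
have [y1 x1] : m3 false = 0 /\ m2 false = 0.
  apply: zeta_system.
    have := C 31%N isT; rewrite C1// C4// !acf_ft !acf_tau_vec// !acf_sigma_tau_vec//=.
    by rewrite z4 muln1 !mulr0 addr0 !add0r addrC.
  have := C 32%N isT; rewrite C1// C4// !acf_ft !acf_tau_vec// !acf_sigma_tau_vec//=.
  by rewrite z4 muln1 expr1 !mulr0 addr0 !add0r addrC.
have m20 : m2 = 0 by apply/ffunP => -[]; rewrite ffunE.
have m30 : m3 = 0 by apply/ffunP => -[]; rewrite ffunE.
by rewrite m10 m20 m30 m40.
Qed.

(** Inverse discrete Fourier transform of order 3: the three combinations determine a, b, c because
    3 and zeta^2 - zeta are invertible. *)
Lemma submod_fourier (R : set HM) (a b c : HM) : is_submod R ->
  R (a + zeta ^+ (2 * 1) *: b + zeta ^+ 1 *: c) ->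
  R (a + zeta ^+ (2 * 2) *: b + zeta ^+ 2 *: c) -> R (a + b + c) ->
  R a /\ R b /\ R c.
Proof.
rewrite muln1 -[(2 * 2)%N]/4%N expr1 => HR R1 R2 R0.
have z4 : zeta ^+ 4 = zeta by rewrite exprS (zeta3 zetaP) mulr1.
rewrite z4 in R2.
have zs : 1 + zeta ^+ 2 + zeta = 0 by rewrite -[RHS](zeta_sum zetaP); ring.
have Ra : R a.
  apply: (submod_unscale HR char3).
  have := submodD HR (submodD HR R0 R1) R2.
  have E (V : zmodType) (x y z p q r s : V) :
      x + y + z + (x + p + q) + (x + r + s) = x + x + x + (y + p + r) + (z + q + s).
    by rewrite (addrACA (x + y)) (addrACA x) (addrACA (x + x + _)) (addrACA (x + x)).
  have Ea : a + a + a = 3%:R *: a by rewrite scaler_nat !mulrS mulr0n addr0 addrA.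
  have Eb : b + zeta ^+ 2 *: b + zeta *: b = 0.
    by rewrite -{1}[b]scale1r -!scalerDl zs scale0r.
  have Ec : c + zeta *: c + zeta ^+ 2 *: c = 0.
    by rewrite -{1}[c]scale1r -!scalerDl addrAC zs scale0r.
  by rewrite E Ea Eb Ec !addr0.
have Rbc : R (b + c) by rewrite -[_ + _](addKr a) addrC addrA; exact: (submodB HR).
have z20 : zeta ^+ 2 - zeta != 0.
  rewrite expr2 -{3}[zeta]mulr1 -mulrBr; apply: mulf_neq0; first exact: zeta_neq0 zetaP.
  by rewrite subr_eq0; exact: zeta_neq1 zetaP.
have Rb : R b.
  apply: (submod_unscale HR z20).
  have Rz : R (zeta ^+ 2 *: b + zeta *: c).
    by rewrite -[_ + _](addKr a) addrC addrA; exact: (submodB HR).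
  have := submodB HR Rz (submodZ zeta HR Rbc).
  by rewrite scalerDr opprD addrACA subrr addr0 -scalerBl.
split=> //; split=> //; rewrite -[c](addKr b) addrC; exact: (submodB HR).
Qed.

Lemma head_map_surjective v : exists m, fil 26 (v - head_map m).
Proof.
have H26 : is_submod (fil 26) by exact: fil_submod.
have HI := image_submod head_map_hom (@setT_submod k ggen head_weights).
pose R : set HM := add_set (fil 26) (head_map @` setT).
have HR : is_submod R := add_set_submod (restrict_submod H26) HI.
have sR u : fil 26 u -> R u by exact: (add_setl HI).
have Rmap m : R (head_map m) by apply: (add_setr (restrict_submod H26)); exists m.
have l0 (B : finType) deg p c (z : B -> HM) : mono_lift z (0 : mono deg p c) = 0.
  by rewrite /mono_lift big1// => b _; rewrite ffunE scale0r.
have R1 b : R (vac k b).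
  have := Rmap (ket k (trz b), 0, 0, 0).
  by rewrite /head_map /= !l0 !addr0 mono_lift_ket trzK.
have Rt1 b : R (rot_family (V := HM) (tau_vec 1) b).
  have := Rmap (0, ket k b, 0, 0).
  by rewrite /head_map /= !l0 !addr0 add0r mono_lift_ket.
have Rt2 b : R (rot_family (V := HM) (tau_vec 2) b).
  have := Rmap (0, 0, ket k b, 0).
  by rewrite /head_map /= !l0 !addr0 !add0r mono_lift_ket.
have R4 b : R (vec (sig_mon k) (sig_family sv_head2 b)).
  have := Rmap (0, 0, 0, ket k (trz b)).
  by rewrite /head_map /= !l0 !addr0 !add0r mono_lift_ket trzK.
suff Rj j : (26 <= j < 36)%N -> R (avm j).
  have : R v.
    rewrite [v](avm_expand char3); apply: (submod_sum _ HR) => j _.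
    apply: (submodZ _ HR); case: (ltnP j 26) => [j26|j26]; first exact/sR/fil_avm.
    by apply: Rj; rewrite j26 ltn_ord.
  by move=> [u [_ [u26 [m _ <-] ->]]]; exists m; rewrite addrK.
(* The third combination, the invariant of tau, is entry 10, which lies in OPU; this is why M(tau,0)
   is absent from the head. *)
have [R29 [R30 _]] : R (avm 29) /\ R (avm 30) /\ R (avm 10 - avm 29 - avm 30).
  apply: (submod_fourier HR) => //; [exact: (Rt1 true)|exact: (Rt2 true)|].
  rewrite [X in R X](_ : _ = avm 10); first by apply/sR/fil_avm.
  by rewrite -[avm 10 - _ - _]addrA -opprD [LHS]addrC subrK.
have [R31 [_ R32]] : R (avm 31) /\ R (avm 11 - avm 31 - avm 32) /\ R (avm 32).
  apply: (submod_fourier HR).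
  - by rewrite -sigma_tau_vec; exact: (Rt1 false).
  - by rewrite -sigma_tau_vec; exact: (Rt2 false).
  - rewrite [X in R X](_ : _ = avm 11); first by apply/sR/fil_avm.
    by rewrite [avm 31 + _]addrA subrK [LHS]addrC subrK.
have R33 b : R (avm (33 + z3_val b)).
  have n36 : (33 + z3_val b < 36)%N by case: (b).
  have n26 : (26 <= 33 + z3_val b)%N by [].
  set n := (33 + z3_val b)%N in n26 n36 *; set w := vec (sig_mon k) (sig_family sv_head2 b).
  have wj : acf n w != 0 by rewrite acf_head2 ?n26 ?n36// eqxx.
  apply: (submod_unscale HR wj); rewrite -[_ *: _](subKr w); apply: (submodB HR).
    exact: R4.
  (* Modulo the radical [w] has a single nonzero coordinate, the n-th. *)
  apply: sR => i i36 i26; rewrite acfB acfZ acf_avm//.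
  have [->|ij] := eqVneq i n; first by rewrite mulr1 subrr.
  have : (acf i w != 0) = (i == n) by rewrite acf_head2// i36 andbT.
  by rewrite (negPf ij) => /negbFE/eqP ->; rewrite mulr0 subr0.
move=> /andP[j26 j36]; have : j \in iota 26 10 by rewrite mem_iota j26.
rewrite !inE.
case/orP=> [/eqP ->|]; first by rewrite -(vac_avm z0).
case/orP=> [/eqP ->|]; first by rewrite -(vac_avm z1).
case/orP=> [/eqP ->|]; first by rewrite -(vac_avm z2).
case/orP=> [/eqP -> //|]; case/orP=> [/eqP -> //|].
case/orP=> [/eqP -> //|]; case/orP=> [/eqP -> //|].
case/orP=> [/eqP ->|]; first exact: (R33 z0).
case/orP=> [/eqP ->|]; first exact: (R33 z1).
by move=> /eqP ->; exact: (R33 z2).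
Qed.

Lemma head_weights_iso :
  rep_iso (restrict H (simple_head (M_sigma k true))) head_weights.
Proof.
apply: rep_iso_sym.
have radE v : sset (Submod (@rad_submod k gen M)) v <-> fil 26 v.
  have max26 : maximal_submod (fil 26) by apply/(maximal_fil26 char3).
  by split=> [/(_ _ max26)|v26 W /(maximal_fil26 char3) ->].
pose theta (m : head_weights) : restrict H (simple_head (M_sigma k true)) :=
  qpi (Submod (@rad_submod k gen M)) (head_map m).
have qh := restrict_hom H (quo_hom (Submod (@rad_submod k gen M))).
apply: (@bij_iso _ _ _ _ theta).
- split=> [c u v|s v]; rewrite /theta.
    by rewrite (homD _ _ head_map_hom) (homZ _ _ head_map_hom) (homD _ _ qh) (homZ _ _ qh).
  by rewrite (hom_act _ _ head_map_hom) (hom_act _ _ qh).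
- move=> m; rewrite /theta -(hom0 qh) => /qpi_eq/radE; rewrite subr0.
  exact: head_map_injective.
move=> q; have [v ->] := qpi_surj q; have [m vm] := head_map_surjective v.
by exists m; apply/esym/qpi_eq/radE.
Qed.

End Head.

Theorem theorem7 (k : closedFieldType) (char_k : [pchar k] =i pred0)
    (zeta : k) (zeta_prim : 3.-primitive_root zeta) :
  (forall U : set (verma_sm k), listed zeta U -> is_submod U)
  /\ (forall U : set (verma_sm k), is_submod U -> U <> setT ->
        exists F : set (set (verma_sm k)),
          F `<=` listed zeta /\ U = sum_of F)
  /\ (forall U : set (verma_sm k),
        maximal_submod U <->
        U = add_set (add_set (add_set (OPU zeta) (VQN zeta)) (T_sm 1 0))
              (T_sm 0 1))
  /\ rep_iso (restrict H (simple_head (M_sigma k true)))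
       (dsum (dsum (dsum (M_sigma k true) (M_tau zeta 1)) (M_tau zeta 2))
          (M_sigma k true))
  /\ has_composition_factors (verma_sm k)
       [:: simple_head (M_sigma k true); simple_head (M_tau zeta 0);
           simple_head (M_rho zeta); simple_head (M_e k false);
           simple_head (M_e k false); simple_head (M_sigma k true)].
Proof.
have char2 : 2%:R != 0 :> k by have := char_k 2%N; rewrite !inE /= => ->.
have char3 : 3%:R != 0 :> k by have := char_k 3%N; rewrite !inE /= => ->.
split; first exact: listed_submod.
split; first exact: proper_submod_sum.
split; first by move=> U; rewrite radicalE//; exact: maximal_fil26.
split; first exact: head_weights_iso.
exact: verma_composition.
Qed.
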